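(* Let $\mathcal{A},\mathcal{B}$ be unital $C^*$-algebras which are neither isomorphic to $\mathbb{C}^2$ nor to $\mathcal{B}(\mathbb{C}^2)$, with spectral presheaves $\underline{\Sigma}^{\mathcal{A}},\underline{\Sigma}^{\mathcal{B}}$, context categories $\mathcal{C}(\mathcal{A}),\mathcal{C}(\mathcal{B})$, Bohrifications $\overline{\mathcal{A}},\overline{\mathcal{B}}$ and partial unital $C^*$-algebras $\mathcal{A}_{part},\mathcal{B}_{part}$. Every isomorphism $\underline{\Sigma}^{\mathcal{B}}\to\underline{\Sigma}^{\mathcal{A}}$ of the spectral presheaves induces a unique quasi-Jordan $*$-isomorphism $T$ from $\mathcal{A}$ to $\mathcal{B}$ (in the opposite direction). Conversely, every quasi-Jordan $*$-isomorphism $T$ from $\mathcal{A}$ to $\mathcal{B}$ induces a unique isomorphism $\langle\Gamma,\iota\rangle:\underline{\Sigma}^{\mathcal{B}}\to\underline{\Sigma}^{\mathcal{A}}$ of the spectral presheaves (in the opposite direction). Moreover, every quasi-Jordan $*$-isomorphism $T$ from $\mathcal{A}$ to $\mathcal{B}$ gives an isomorphism $\langle\tilde\Gamma,\kappa\rangle:\overline{\mathcal{A}}\to\overline{\mathcal{B}}$ of the Bohrifications in the category $\mathbf{Copresh}(\mathbf{ucC^*})$ of unital commutative $C^*$-algebra-valued copresheaves and vice versa, which induces an order-isomorphism $\gamma:\mathcal{C}(\mathcal{A})\to\mathcal{C}(\mathcal{B})$ of the context categories and vice versa. Here, $\gamma$ is the base map underlying the isomorphism $\langle\Gamma,\iota\rangle:\underline{\Sigma}^{\mathcal{B}}\to\underline{\Sigma}^{\mathcal{A}}$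 corresponding to the quasi-Jordan $*$-isomorphism $T$.
   Context: For a unital $C^*$-algebra $\mathcal{A}$: $\mathcal{C}(\mathcal{A})$ is the set of unital abelian $C^*$-subalgebras of $\mathcal{A}$ sharing the unit of $\mathcal{A}$ (including $\mathbb{C}1$), ordered by inclusion and viewed as a category. $\underline{\Sigma}^{\mathcal{A}}$ is the presheaf over $\mathcal{C}(\mathcal{A})$ with $\underline{\Sigma}^{\mathcal{A}}_C=\Sigma(C)$ the Gelfand spectrum and restriction maps $\lambda\mapsto\lambda|_{C'}$ for $C'\subseteq C$. The Bohrification $\overline{\mathcal{A}}$ is the copresheaf over $\mathcal{C}(\mathcal{A})$ with $\overline{\mathcal{A}}_C=C$ and inclusions as copresheaf maps. $\mathcal{A}_{part}$ is the set of normal elements of $\mathcal{A}$ with the involution of $\mathcal{A}$ and addition and multiplication defined only for commuting pairs. Quasi-Jordan $*$-isomorphism: let $\mathcal{A}_{sa}$ be the self-adjoint part of $\mathcal{A}$ with Jordan product $A\cdot B=\frac12(AB+BA)$. A quasi-Jordan homomorphism is a unital map $Q:\mathcal{A}_{sa}\to\mathcal{B}_{sa}$ such that for every $C\in\mathcal{C}(\mathcal{A})$ the restriction $Q|_{C_{sa}}:C_{sa}\to\mathcal{B}_{sa}$ is a unital Jordan homomorphism (in particular real-linear). A quasi-Jordan isomorphism is a bijection $Q$ such that $Q$ and $Q^{-1}$ are quasi-Jordan homomorphisms. A quasi-Jordan $*$-isomorphism $T$ from $\mathcal{A}$ to $\mathcal{B}$ is such a $Q$, extended to normal elements by $T(A_1+iA_2)=Q(A_1)+iQ(A_2)$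 for commuting self-adjoint $A_1,A_2$; equivalently it is an isomorphism $\mathcal{A}_{part}\to\mathcal{B}_{part}$ of partial unital $C^*$-algebras, i.e. a bijection such that it and its inverse are unital, involution-preserving, and linear and multiplicative on commuting elements. An isomorphism from $\underline{\Sigma}^{\mathcal{B}}$ to $\underline{\Sigma}^{\mathcal{A}}$ is a pair $\langle\Gamma,\iota\rangle$, where $\Gamma:\mathbf{Set}^{\mathcal{C}(\mathcal{A})^{op}}\to\mathbf{Set}^{\mathcal{C}(\mathcal{B})^{op}}$ is the essential geometric isomorphism induced by an order-isomorphism $\gamma:\mathcal{C}(\mathcal{A})\to\mathcal{C}(\mathcal{B})$ (the base map), with inverse image functor $\Gamma^*(\underline{P})=\underline{P}\circ\gamma$, and $\iota:\Gamma^*(\underline{\Sigma}^{\mathcal{B}})\to\underline{\Sigma}^{\mathcal{A}}$ is a natural isomorphism whose components $\iota_C:\underline{\Sigma}^{\mathcal{B}}_{\gamma(C)}\to\underline{\Sigma}^{\mathcal{A}}_C$ are homeomorphisms. An isomorphism from $\overline{\mathcal{A}}$ to $\overline{\mathcal{B}}$ is a pair $\langle\tilde\Gamma,\kappa\rangle$, where $\tilde\Gamma:\mathbf{Set}^{\mathcal{C}(\mathcal{A})}\to\mathbf{Set}^{\mathcal{C}(\mathcal{B})}$ is the essential geometric isomorphism induced by an order-isomorphism $\gamma:\mathcal{C}(\mathcal{A})\to\mathcal{C}(\mathcal{B})$ and $\kappa:\overline{\mathcal{A}}\to\tilde\Gamma^*(\overline{\mathcal{B}})=\overline{\mathcal{B}}\circ\gamma$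 is a natural isomorphism whose components $\kappa_C:C\to\gamma(C)$ are unital $*$-isomorphisms. Meaning of ''induces''/''gives''/''corresponds'': $\langle\Gamma,\iota\rangle$ corresponds to $T$ when $\gamma(C)=T[C]$ and $\iota_C(\lambda)=\lambda\circ T|_C$ for all $C\in\mathcal{C}(\mathcal{A})$; $\langle\tilde\Gamma,\kappa\rangle$ corresponds to $T$ when $\gamma(C)=T[C]$ and $\kappa_C=T|_C$; $\gamma$ corresponds to $T$ when $\gamma(C)=T[C]$ for all $C$. ''And vice versa'' means that each object of the second kind arises from a unique one of the first kind. *)

(* Defs.v *)
From HB Require Import structures.
From mathcomp Require Import all_boot all_order all_algebra.
From mathcomp Require Import all_classical all_reals all_analysis.
From mathcomp Require Import complex spectral.
Set Implicit Arguments.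
Unset Strict Implicit.
Unset Printing Implicit Defensive.
Import Order.TTheory GRing.Theory Num.Theory.
Import numFieldNormedType.Exports.
Local Open Scope classical_set_scope.
Local Open Scope complex_scope.
Local Open Scope ring_scope.

HB.mixin Record hasInvolution (K : numClosedFieldType) A of GRing.Algebra K A := {
  star : A -> A;
  starK : involutive star;
  starD : {morph star : x y / x + y};
  starZ : forall (a : K) x, star (a *: x) = a^* *: star x;
  starM : forall x y, star (x * y) = star y * star x
}.

#[short(type="starAlgType")]
HB.structure Definition StarAlgebra (K : numClosedFieldType) :=
  {A of GRing.Algebra K A & hasInvolution K A}.

HB.mixin Record hasCStarNorm (R : realType) A of StarAlgebra R[i] A := {
  cnorm : A -> R[i];
  cnormD : forall x y, cnorm (x + y) <= cnorm x + cnorm y;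
  cnormZ : forall (a : R[i]) x, cnorm (a *: x) = `|a| * cnorm x;
  cnorm0_eq0 : forall x, cnorm x = 0 -> x = 0;
  cnormM : forall x y, cnorm (x * y) <= cnorm x * cnorm y;
  cnorm_starM : forall x, cnorm (star x * x) = cnorm x ^+ 2
}.

#[short(type="preCstarAlgType")]
HB.structure Definition PreCStarAlgebra (R : realType) :=
  {A of StarAlgebra R[i] A & hasCStarNorm R A}.

(* The normed space underlying A. It is an alias because the library's hierarchy
   admits no common structure of normed modules and (non-commutative) rings.
   As for every normed module over R[i] in the library, norms are R[i]-valued. *)
Definition normed_space (R : realType) (A : preCstarAlgType R) : Type := A.

HB.instance Definition _ (R : realType) (A : preCstarAlgType R) :=
  GRing.Lmodule.copy (normed_space A) A.
HB.instance Definition _ (R : realType) (A : preCstarAlgType R) :=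
  @Lmodule_isNormed.Build R[i] (normed_space A) (@cnorm R A)
    (@cnormD R A) (@cnormZ R A) (@cnorm0_eq0 R A).

HB.mixin Record isCStarComplete (R : realType) A of PreCStarAlgebra R A := {
  cstar_complete : forall F : set_system (normed_space A),
    ProperFilter F -> cauchy F -> cvg F
}.

#[short(type="cstarAlgType")]
HB.structure Definition CStarAlgebra (R : realType) :=
  {A of PreCStarAlgebra R A & isCStarComplete R A}.

HB.instance Definition _ (R : realType) (A : cstarAlgType R) :=
  Uniform_isComplete.Build (normed_space A) (@cstar_complete R A).

#[short(type="comCstarAlgType")]
HB.structure Definition ComCStarAlgebra (R : realType) :=
  {A of CStarAlgebra R A & GRing.ComNzRing A}.

HB.instance Definition _ (K : numClosedFieldType) :=
  hasInvolution.Build K K^o (@conjCK K) (rmorphD Num.conj) (rmorphM Num.conj)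
    (fun x y : K => etrans (rmorphM Num.conj x y) (mulrC _ _)).

Section PairInvolution.
Variables (K : numClosedFieldType) (A B : starAlgType K).
Let pstar (x : A * B) : A * B := (star x.1, star x.2).
Let pstarK : involutive pstar.
Proof. by move=> [x y]; rewrite /pstar /= !starK. Qed.
Let pstarD : {morph pstar : x y / x + y}.
Proof. by move=> x y; rewrite /pstar /= !starD. Qed.
Let pstarZ (a : K) x : pstar (a *: x) = a^* *: pstar x.
Proof. by rewrite /pstar /= !starZ. Qed.
Let pstarM x y : pstar (x * y) = pstar y * pstar x.
Proof. by rewrite /pstar /= !starM. Qed.
HB.instance Definition _ :=
  hasInvolution.Build K (A * B)%type pstarK pstarD pstarZ pstarM.
End PairInvolution.

Section MatrixInvolution.
Variables (K : numClosedFieldType) (n : nat).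
Local Open Scope sesquilinear_scope.
Let mstar (x : 'M[K]_n.+1) : 'M[K]_n.+1 := x^t*.
Let mstarK : involutive mstar.
Proof. exact: trmxCK. Qed.
Let mstarD : {morph mstar : x y / x + y}.
Proof. by move=> x y; apply/matrixP => i j; rewrite !mxE rmorphD. Qed.
Let mstarZ (a : K) x : mstar (a *: x) = a^* *: mstar x.
Proof. by apply/matrixP => i j; rewrite !mxE rmorphM. Qed.
Let mstarM x y : mstar (x * y) = mstar y * mstar x.
Proof. by rewrite /mstar -!mulmxE trmx_mul map_mxM. Qed.
HB.instance Definition _ :=
  hasInvolution.Build K 'M[K]_n.+1 mstarK mstarD mstarZ mstarM.
End MatrixInvolution.

Record star_morphism (K : numClosedFieldType) (A B : starAlgType K) (f : A -> B) :
    Prop := StarMorphism {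
  star_morph_linear : linear f;
  star_morph_mul : monoid_morphism f;
  star_morph_star : {morph f : x / star x}
}.

Definition star_isomorphism (K : numClosedFieldType) (A B : starAlgType K)
  (f : A -> B) : Prop := bijective f /\ star_morphism f.

Definition star_isomorphic (K : numClosedFieldType) (A B : starAlgType K) : Prop :=
  exists f : A -> B, star_isomorphism f.

Definition C2 (R : realType) : starAlgType R[i] := (R[i]^o * R[i]^o)%type.

(* B(C^2): the operators on C^2 as matrices, with the conjugate transpose. *)
Definition B_C2 (R : realType) : starAlgType R[i] := 'M[R[i]]_2.

Section Context.
Variables (R : realType) (A : cstarAlgType R).

Record context := Context {
  context_set :> set A;
  context1 : context_set 1;
  contextL : forall (a : R[i]) x y,
    context_set x -> context_set y -> context_set (a *: x + y);
  contextM : forall x y, context_set x -> context_set y -> context_set (x * y);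
  context_star : forall x, context_set x -> context_set (star x);
  context_comm : forall x y, context_set x -> context_set y -> x * y = y * x;
  context_closed : closed (context_set : set (normed_space A))
}.

HB.instance Definition _ := gen_eqMixin context.
HB.instance Definition _ := gen_choiceMixin context.

Lemma context_eq (C D : context) : context_set C = context_set D -> C = D.
Proof.
case: C D => [C C1 CL CM CS CC Cc] [D D1 DL DM DS DC Dc] /= CD.
by subst D; congr Context; exact: Prop_irrelevance.
Qed.

Definition context_le (C D : context) : bool := `[< C `<=` D >].

Lemma context_le_refl : reflexive context_le.
Proof. by move=> C; apply/asboolP. Qed.

Lemma context_le_anti : antisymmetric context_le.
Proof.
by move=> C D /andP[/asboolP CD /asboolP DC]; apply: context_eq; apply/seteqP.
Qed.

Lemma context_le_trans : transitive context_le.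
Proof.
by move=> D C E /asboolP CD /asboolP DE; apply/asboolP; exact: subset_trans DE.
Qed.

Fact context_display : Order.disp_t. Proof. exact: Order.default_display. Qed.

HB.instance Definition _ := Order.Le_isPOrder.Build context_display context
  context_le_refl context_le_anti context_le_trans.

End Context.

Section ContextAlgebra.
Variables (R : realType) (A : cstarAlgType R) (C : context A).

Definition context_alg : Type := {x : A | x \in context_set C}.

HB.instance Definition _ := SubChoice.copy context_alg {x : A | x \in context_set C}.

Lemma context_subalg : GRing.subalg_closed [pred x : A | x \in context_set C].
Proof.
split=> [|a x y|x y]; rewrite ?inE; first exact: context1.
- exact: contextL.
- exact: contextM.
Qed.

HB.instance Definition _ :=
  GRing.SubChoice_isSubAlgebra.Build R[i] A _ context_alg context_subalg.

Lemma context_algP (x : context_alg) : context_set C (val x).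
Proof. exact: set_valP x. Qed.

Let cmulC : commutative (@GRing.mul context_alg).
Proof.
move=> x y; apply: val_inj.
by rewrite !rmorphM; apply: context_comm; exact: context_algP.
Qed.

HB.instance Definition _ := GRing.PzSemiRing_hasCommutativeMul.Build context_alg cmulC.

Definition context_alg_star (x : context_alg) : context_alg :=
  exist _ (star (val x)) (mem_set (context_star (context_algP x))).

Let cstarK : involutive context_alg_star.
Proof. by move=> x; apply: val_inj; exact: starK. Qed.
Let cstarD : {morph context_alg_star : x y / x + y}.
Proof. by move=> x y; apply: val_inj; exact: starD. Qed.
Let cstarZ (a : R[i]) x : context_alg_star (a *: x) = a^* *: context_alg_star x.
Proof. by apply: val_inj; exact: starZ. Qed.
Let cstarM x y : context_alg_star (x * y) = context_alg_star y * context_alg_star x.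
Proof. by apply: val_inj; exact: starM. Qed.

HB.instance Definition _ :=
  hasInvolution.Build R[i] context_alg cstarK cstarD cstarZ cstarM.

Let knorm (x : context_alg) : R[i] := cnorm (val x).
Let knormD x y : knorm (x + y) <= knorm x + knorm y.
Proof. exact: cnormD. Qed.
Let knormZ (a : R[i]) x : knorm (a *: x) = `|a| * knorm x.
Proof. exact: cnormZ. Qed.
Let knorm0_eq0 x : knorm x = 0 -> x = 0.
Proof. by move=> /cnorm0_eq0 x0; exact: val_inj. Qed.
Let knormM x y : knorm (x * y) <= knorm x * knorm y.
Proof. exact: cnormM. Qed.
Let knorm_starM x : knorm (star x * x) = knorm x ^+ 2.
Proof. exact: cnorm_starM. Qed.

HB.instance Definition _ := hasCStarNorm.Build R context_alg
  knormD knormZ knorm0_eq0 knormM knorm_starM.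

Let complete (F : set_system (normed_space context_alg)) :
  ProperFilter F -> cauchy F -> cvg F.
Proof.
move=> FF Fc.
pose v := (fun x : context_alg => val x : normed_space A).
have ballv (x y : context_alg) e :
    ball (x : normed_space context_alg) e y <-> ball (v x) e (v y).
  by rewrite -!ball_normE /= {2}/Num.norm /= /v -raddfB.
have vF : ProperFilter (v @ F) by apply: fmap_proper_filter.
have /cstar_complete : cauchy (v @ F).
  apply/cauchyP => e e0.
  have /cauchyP /(_ e e0) [x Fx] := Fc.
  exists (v x); rewrite /fmapE /=.
  by apply: filterS Fx => y /ballv.
move=> /cvg_ex[l vl].
have Cl : context_set C l.
  have vC : \forall x \near F, context_set C (v x).
    by apply: nearW => x; exact: context_algP.
  exact: (closed_cvg (V := normed_space A) _ (@context_closed _ _ C) vC l vl).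
apply/cvg_ex; exists (exist _ l (mem_set Cl) : context_alg).
apply/cvg_ballP => e e0.
have /cvg_ballP /(_ e e0) := vl.
by apply: filterS => x Hx; apply/ballv.
Qed.

HB.instance Definition _ := isCStarComplete.Build R context_alg complete.

End ContextAlgebra.

Section ContextInclusion.
Variables (R : realType) (A : cstarAlgType R) (C D : context A).
Hypothesis CD : (C <= D)%O.

Let inclP (x : context_alg C) : val x \in context_set D.
Proof. by apply: mem_set; move/asboolP: CD; apply; exact: context_algP. Qed.

Definition context_incl (x : context_alg C) : context_alg D := exist _ (val x) (inclP x).

Let incl_linear : linear context_incl.
Proof. by move=> a x y; exact: val_inj. Qed.
HB.instance Definition _ := GRing.isLinear.Build R[i] _ _ _ context_incl incl_linear.

Let incl_monoid : monoid_morphism context_incl.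
Proof. by split=> [|x y]; exact: val_inj. Qed.
HB.instance Definition _ :=
  GRing.isMonoidMorphism.Build (context_alg C) (context_alg D) context_incl incl_monoid.

Lemma context_incl_star : star_morphism context_incl.
Proof.
by split; [exact: incl_linear|exact: incl_monoid|move=> x; exact: val_inj].
Qed.
End ContextInclusion.

(* The Gelfand spectrum: the unital (equivalently, nonzero) characters, with the
   topology of pointwise convergence. *)
Definition spectrum (R : realType) (D : comCstarAlgType R) : Type :=
  {lrmorphism D -> R[i]^o}.

HB.instance Definition _ (R : realType) (D : comCstarAlgType R) := gen_eqMixin (spectrum D).
HB.instance Definition _ (R : realType) (D : comCstarAlgType R) := gen_choiceMixin (spectrum D).
HB.instance Definition _ (R : realType) (D : comCstarAlgType R) :=
  Topological.copy (spectrum D)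
    (initial_topology (fun l : spectrum D =>
       (l : {lrmorphism D -> R[i]^o}) : {ptws D -> R[i]^o})).

Lemma spectrum_eq (R : realType) (D : comCstarAlgType R) (l m : spectrum D) :
  (forall x, (l : {lrmorphism _ -> _}) x = (m : {lrmorphism _ -> _}) x) -> l = m.
Proof.
move=> lm; have {lm} : GRing.LRMorphism.sort l = GRing.LRMorphism.sort m by exact/funext.
case: l m => [f [[f0] [f1] [f2]]] [g [[g0] [g1] [g2]]] /= fg.
by subst g; rewrite (Prop_irrelevance f0 g0) (Prop_irrelevance f1 g1) (Prop_irrelevance f2 g2).
Qed.

Lemma spectrum_eval_continuous (R : realType) (D : comCstarAlgType R) (x : D) :
  continuous (fun l : spectrum D => (l : {lrmorphism D -> R[i]^o}) x).
Proof.
move=> l; apply: (@continuous_comp (spectrum D) {ptws D -> R[i]^o} R[i]^o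
  (fun l : spectrum D => (l : {lrmorphism D -> R[i]^o}) : {ptws D -> R[i]^o})
  (proj x)).
  exact: initial_continuous.
exact: (@proj_continuous D (fun=> R[i]^o)).
Qed.

Section SpectrumRestriction.
Variables (R : realType) (A : cstarAlgType R).

Definition spectrum_res (C C' : context A) (CC' : (C' <= C)%O)
    (l : spectrum (context_alg C)) : spectrum (context_alg C') :=
  (l : {lrmorphism _ -> _}) \o context_incl CC'.

Lemma spectrum_res_continuous (C C' : context A) (CC' : (C' <= C)%O) :
  continuous (spectrum_res CC').
Proof.
apply: (@continuous_comp_initial _ (spectrum (context_alg C))
  {ptws context_alg C' -> R[i]^o}) => l.
apply/cvg_sup; first exact: (fmap_filter _ (nbhs_filter (l : spectrum (context_alg C)))).
move=> x; move: l.
apply: (@continuous_comp_initial _ (spectrum (context_alg C)) R[i]^o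
  (fun f : context_alg C' -> R[i]^o => f x)).
exact: (@spectrum_eval_continuous R (context_alg C) (context_incl CC' x)).
Qed.

End SpectrumRestriction.

Definition homeomorphism (X Y : topologicalType) (f : X -> Y) : Prop :=
  exists g : Y -> X, [/\ cancel f g, cancel g f, continuous f & continuous g].

Record order_iso d d' (P : porderType d) (Q : porderType d') := OrderIso {
  oiso_fun :> P -> Q;
  oiso_bij : bijective oiso_fun;
  oiso_mono : {mono oiso_fun : x y / (x <= y)%O}
}.

Lemma oiso_homo d d' (P : porderType d) (Q : porderType d') (g : order_iso P Q) x y :
  (x <= y)%O -> (g x <= g y)%O.
Proof. by rewrite oiso_mono. Qed.

(* Presheaves of topological spaces over a poset: for the spectral presheaf the
   topologies of the fibres are part of the data, since the components of its
   isomorphisms have to be homeomorphisms. *)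
Record presheaf d (P : porderType d) := Presheaf {
  psh_obj :> P -> topologicalType;
  psh_res : forall c c' : P, (c' <= c)%O -> psh_obj c -> psh_obj c';
  psh_continuous : forall c c' (h : (c' <= c)%O), continuous (psh_res h);
  psh_id : forall c (h : (c <= c)%O) x, psh_res h x = x;
  psh_comp : forall c c' c'' (h : (c' <= c)%O) (h' : (c'' <= c')%O)
    (h'' : (c'' <= c)%O) x, psh_res h' (psh_res h x) = psh_res h'' x
}.

Record copresheaf (R : realType) d (P : porderType d) := Copresheaf {
  cpsh_obj :> P -> comCstarAlgType R;
  cpsh_map : forall c c' : P, (c <= c')%O -> cpsh_obj c -> cpsh_obj c';
  cpsh_morph : forall c c' (h : (c <= c')%O), star_morphism (cpsh_map h);
  cpsh_id : forall c (h : (c <= c)%O) x, cpsh_map h x = x;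
  cpsh_comp : forall c c' c'' (h : (c <= c')%O) (h' : (c' <= c'')%O)
    (h'' : (c <= c'')%O) x, cpsh_map h' (cpsh_map h x) = cpsh_map h'' x
}.

(* The inverse image functors, on objects, of the essential geometric
   isomorphisms induced by an order-isomorphism g. *)
Section InverseImage.
Variables (R : realType) (d d' : Order.disp_t).
Variables (P : porderType d) (Q : porderType d') (g : order_iso P Q).

Definition inverse_image (X : presheaf Q) : presheaf P :=
  @Presheaf d P (fun c => X (g c))
    (fun c c' h => psh_res (oiso_homo g h))
    (fun c c' h => @psh_continuous _ _ X _ _ (oiso_homo g h))
    (fun c h => @psh_id _ _ X _ (oiso_homo g h))
    (fun c c' c'' h h' h'' =>
       @psh_comp _ _ X _ _ _ (oiso_homo g h) (oiso_homo g h') (oiso_homo g h'')).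

Definition co_inverse_image (X : copresheaf R Q) : copresheaf R P :=
  @Copresheaf R d P (fun c => X (g c))
    (fun c c' h => cpsh_map (oiso_homo g h))
    (fun c c' h => @cpsh_morph _ _ _ X _ _ (oiso_homo g h))
    (fun c h => @cpsh_id _ _ _ X _ (oiso_homo g h))
    (fun c c' c'' h h' h'' =>
       @cpsh_comp _ _ _ X _ _ _ (oiso_homo g h) (oiso_homo g h') (oiso_homo g h'')).

End InverseImage.

Record presheaf_nat_iso d (P : porderType d) (X Y : presheaf P) := PresheafNatIso {
  pnat_fun :> forall c, X c -> Y c;
  pnat_homeo : forall c, homeomorphism (@pnat_fun c);
  pnat_natural : forall c c' (h : (c' <= c)%O) x,
    pnat_fun (psh_res h x) = psh_res h (pnat_fun x)
}.

Record copresheaf_nat_iso (R : realType) d (P : porderType d) (X Y : copresheaf R P) :=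
  CopresheafNatIso {
  cnat_fun :> forall c, X c -> Y c;
  cnat_iso : forall c, star_isomorphism (@cnat_fun c);
  cnat_natural : forall c c' (h : (c <= c')%O) x,
    cnat_fun (cpsh_map h x) = cpsh_map h (cnat_fun x)
}.

(* An isomorphism <Gamma, iota> from X to Y lives over base : P -> Q, where X is
   over Q and Y over P. Gamma is determined by base and is represented by it. *)
Record presheaf_iso d d' (Q : porderType d') (P : porderType d)
    (X : presheaf Q) (Y : presheaf P) := PresheafIso {
  psh_base : order_iso P Q;
  psh_iota : presheaf_nat_iso (inverse_image psh_base X) Y
}.

Record copresheaf_iso (R : realType) d d' (P : porderType d) (Q : porderType d')
    (X : copresheaf R P) (Y : copresheaf R Q) := CopresheafIso {
  cpsh_base : order_iso P Q;
  cpsh_kappa : copresheaf_nat_iso X (co_inverse_image cpsh_base Y)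
}.

Section SpectralPresheaf.
Variables (R : realType) (A : cstarAlgType R).

Let res_id (C : context A) (h : (C <= C)%O) (l : spectrum (context_alg C)) :
  spectrum_res h l = l.
Proof.
apply: spectrum_eq => x /=; congr (_ _); exact: val_inj.
Qed.

Let res_comp (C C' C'' : context A) (h : (C' <= C)%O) (h' : (C'' <= C')%O)
  (h'' : (C'' <= C)%O) (l : spectrum (context_alg C)) :
  spectrum_res h' (spectrum_res h l) = spectrum_res h'' l.
Proof.
apply: spectrum_eq => x /=; congr (_ _); exact: val_inj.
Qed.

Definition spectral_presheaf : presheaf (context A) :=
  @Presheaf _ _ (fun C => spectrum (context_alg C))
    (@spectrum_res R A) (@spectrum_res_continuous R A) res_id res_comp.

Let incl_id (C : context A) (h : (C <= C)%O) (x : context_alg C) :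
  context_incl h x = x.
Proof. exact: val_inj. Qed.

Let incl_comp (C C' C'' : context A) (h : (C <= C')%O) (h' : (C' <= C'')%O)
  (h'' : (C <= C'')%O) (x : context_alg C) :
  context_incl h' (context_incl h x) = context_incl h'' x.
Proof. exact: val_inj. Qed.

Definition bohrification : copresheaf R (context A) :=
  @Copresheaf R _ _ (fun C => context_alg C)
    (@context_incl R A) (@context_incl_star R A) incl_id incl_comp.

End SpectralPresheaf.

(* [partial_alg A] is the carrier of A_part. *)
Section SelfAdjoint.
Variables (R : realType) (A : cstarAlgType R).

Definition self_adjoint : Type := {x : A | star x == x}.
Definition partial_alg : Type := {x : A | star x * x == x * star x}.

HB.instance Definition _ := SubChoice.copy self_adjoint {x : A | star x == x}.
HB.instance Definition _ :=
  SubChoice.copy partial_alg {x : A | star x * x == x * star x}.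

Lemma star1 : star 1 = 1 :> A.
Proof. by rewrite -[LHS]mul1r -{1}(@starK _ A 1) -starM mul1r starK. Qed.

Fact sa_one_subproof : star (1 : A) == 1.
Proof. exact/eqP/star1. Qed.
Definition sa_one : self_adjoint := exist _ 1 sa_one_subproof.

Fact sa_add_subproof (x y : self_adjoint) : star (val x + val y) == val x + val y.
Proof. by rewrite starD (eqP (valP x)) (eqP (valP y)). Qed.
Definition sa_add (x y : self_adjoint) : self_adjoint := exist _ (val x + val y) (sa_add_subproof x y).

Fact sa_scale_subproof (a : R) (x : self_adjoint) : star (a%:C *: val x) == a%:C *: val x.
Proof. by rewrite starZ (eqP (valP x)) (CrealP _) // complex_real. Qed.
Definition sa_scale (a : R) (x : self_adjoint) : self_adjoint :=
  exist _ (a%:C *: val x) (sa_scale_subproof a x).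

Fact sa_jordan_subproof (x y : self_adjoint) :
  star ((2^-1 : R[i]) *: (val x * val y + val y * val x)) ==
  (2^-1 : R[i]) *: (val x * val y + val y * val x).
Proof.
rewrite starZ starD !starM (eqP (valP x)) (eqP (valP y)) addrC.
by rewrite (CrealP _) // realV realn.
Qed.
Definition sa_jordan (x y : self_adjoint) : self_adjoint :=
  exist _ ((2^-1 : R[i]) *: (val x * val y + val y * val x)) (sa_jordan_subproof x y).

Fact normal_of_sa_subproof (x y : self_adjoint) (xy : GRing.comm (val x) (val y)) :
  let z := val x + ('i : R[i]) *: val y in star z * z == z * star z.
Proof.
rewrite /= starD starZ (eqP (valP x)) (eqP (valP y)) conjCi scaleNr.
have xiy : GRing.comm (val x) (('i : R[i]) *: val y).
  by rewrite /GRing.comm -scalerAr -scalerAl xy.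
apply/eqP/commrD; apply/commr_sym/commrB => //; exact: commr_sym.
Qed.
Definition normal_of_sa (x y : self_adjoint) (xy : GRing.comm (val x) (val y)) :
  partial_alg := exist _ (val x + ('i : R[i]) *: val y) (normal_of_sa_subproof xy).

End SelfAdjoint.

Section QuasiJordan.
Variables (R : realType) (A B : cstarAlgType R).

(* Q restricts to a unital Jordan homomorphism on the self-adjoint part of C. *)
Record jordan_on (C : context A) (Q : self_adjoint A -> self_adjoint B) : Prop :=
  JordanOn {
  jordan_one : Q (sa_one A) = sa_one B;
  jordan_add : forall x y, context_set C (val x) -> context_set C (val y) ->
    Q (sa_add x y) = sa_add (Q x) (Q y);
  jordan_scale : forall (a : R) x, context_set C (val x) ->
    Q (sa_scale a x) = sa_scale a (Q x);
  jordan_mul : forall x y, context_set C (val x) -> context_set C (val y) ->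
    Q (sa_jordan x y) = sa_jordan (Q x) (Q y)
}.

Definition quasi_jordan_hom (Q : self_adjoint A -> self_adjoint B) : Prop :=
  Q (sa_one A) = sa_one B /\ forall C : context A, jordan_on C Q.

End QuasiJordan.

Section QuasiJordanStarIso.
Variables (R : realType) (A B : cstarAlgType R).

Definition quasi_jordan_iso (Q : self_adjoint A -> self_adjoint B) : Prop :=
  exists Q' : self_adjoint B -> self_adjoint A,
    [/\ cancel Q Q', cancel Q' Q, quasi_jordan_hom Q & quasi_jordan_hom Q'].

Definition quasi_jordan_star_iso (T : partial_alg A -> partial_alg B) : Prop :=
  exists2 Q : self_adjoint A -> self_adjoint B, quasi_jordan_iso Q &
    forall (x y : self_adjoint A) (xy : GRing.comm (val x) (val y)),
      val (T (normal_of_sa xy)) = val (Q x) + ('i : R[i]) *: val (Q y).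

End QuasiJordanStarIso.

Fact partial_of_context_subproof (R : realType) (A : cstarAlgType R) (C : context A)
  (x : context_alg C) : star (val x) * val x == val x * star (val x).
Proof.
apply/eqP/(@context_comm _ _ C); last exact: context_algP.
by apply: context_star; exact: context_algP.
Qed.

Definition partial_of_context (R : realType) (A : cstarAlgType R) (C : context A)
  (x : context_alg C) : partial_alg A := exist _ (val x) (partial_of_context_subproof x).

Section Correspondence.
Variables (R : realType) (A B : cstarAlgType R).
Implicit Type T : partial_alg A -> partial_alg B.

(* T[C] *)
Definition context_image T (C : context A) : set B :=
  [set val (T x) | x in [set x | context_set C (val x)]].

Fact context_restrict_subproof T (C : context A) (D : context B)
  (TCD : context_image T C = context_set D) (x : context_alg C) :
  val (T (partial_of_context x)) \in context_set D.
Proof.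
rewrite inE -TCD; exists (partial_of_context x) => //=; exact: context_algP.
Qed.

(* T|_C : C -> D, for D = T[C] *)
Definition context_restrict T (C : context A) (D : context B)
    (TCD : context_image T C = context_set D) (x : context_alg C) : context_alg D :=
  exist _ (val (T (partial_of_context x))) (context_restrict_subproof TCD x).

Definition spectral_iso : Type :=
  presheaf_iso (spectral_presheaf B) (spectral_presheaf A).

Definition bohr_iso : Type := copresheaf_iso (bohrification A) (bohrification B).

Definition base_corresponds (g : order_iso (context A) (context B)) T : Prop :=
  forall C, context_image T C = context_set (g C).

Definition spectral_corresponds (s : spectral_iso) T : Prop :=
  exists Ts : base_corresponds (psh_base s) T,
    forall (C : context A) (l : spectrum (context_alg (psh_base s C))) (x : context_alg C),
      (psh_iota s C l : spectrum (context_alg C)) x = l (context_restrict (Ts C) x).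

Definition bohr_corresponds (b : bohr_iso) T : Prop :=
  exists Tb : base_corresponds (cpsh_base b) T,
    forall (C : context A) (x : context_alg C),
      cpsh_kappa b C x = context_restrict (Tb C) x.

End Correspondence.

(* Main.v *)
(* A character of a commutative C*-algebra is obtained from a maximal preordering of its
   self-adjoint part containing the closed cone of squares: such a preordering is total, and
   the order defines a real-valued multiplicative functional (Kadison, Dubois). This gives
   Gelfand duality, and the lattice form of the Stone-Weierstrass theorem shows that every
   context is the meet of the maximal ones {x | l x = m x}, for characters l <> m. An order
   isomorphism permutes these coatoms, hence maps pairs of characters to pairs; it preserves
   triangles of pairs, so with at least three characters it comes from a unique bijection of
   the spectra, which is a homeomorphism because sets of constancy are preserved, and by
   duality from a unique *-isomorphism.
   In the noncommutative case these *-isomorphisms agree on overlaps of contexts. Only a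
   two-dimensional overlap spanned by a projection p and 1 - p is not covered by uniqueness:
   there the two candidate images of p could be swapped, which is excluded by a third context
   containing the summand below p of one context and the summand below 1 - p of the other,
   either in A or in B. A two-dimensional context not contained in a bigger one only exists
   in C^2 and M_2(C). All other correspondences are translations of the resulting map
   F : A -> B, which is meaningful on normal elements only.
   A Jordan homomorphism of a context has a commuting image since [a, [a, c]] = 0 for all
   elements a, c of the image. *)

(* With only two characters there is a single coatom, and exchanging the characters moves no
   context. This is why three characters are required, and why a maximal two-dimensional context has
   to be excluded: exchanging its projections p and 1 - p alters T but not the base map. Square
   roots come from one contraction near 1, and the C*-identity enters mostly through [nrm_sqr_le].
   Strict positivity is therefore a norm condition, [nrm (rsc t - x) < t], and the cone [pos] is a
   closure, so arguments about it carry an arbitrarily small error e. All objects are compared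
   through one total function F : A -> B, arbitrary where no context constrains it, and the relation
   [implements g C F]. It prescribes the images of all subcontexts of C; so it passes to
   subcontexts, and it determines F on every context with three characters. Equality of families
   indexed by contexts thereby becomes equality of plain elements. *)
Require Import Defs.
From HB Require Import structures.
From mathcomp Require Import all_boot all_order all_algebra.
From mathcomp Require Import all_classical all_reals all_analysis.
From mathcomp Require Import complex.
From mathcomp Require Import ring lra.
Set Implicit Arguments.
Unset Strict Implicit.
Unset Printing Implicit Defensive.
Import Order.TTheory GRing.Theory Num.Theory.
Import numFieldNormedType.Exports.
Local Open Scope classical_set_scope.
Local Open Scope complex_scope.
Local Open Scope ring_scope.

(** * Norms, self-adjoint elements and square roots *)

Definition nrm (R : realType) (A : cstarAlgType R) (x : A) : R :=
  complex.Re (cnorm x).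
Arguments nrm {R A} x.

Section Norm.
Variables (R : realType) (A : cstarAlgType R).
Implicit Types (x y z : A) (r s : R).

Lemma cnorm_zero : cnorm (0 : A) = 0.
Proof. by rewrite -(scale0r (0 : A)) cnormZ normr0 mul0r. Qed.

Lemma cnormN x : cnorm (- x) = cnorm x.
Proof. by rewrite -scaleN1r cnormZ normrN1 mul1r. Qed.

Lemma cnorm_ge0 x : 0 <= cnorm x.
Proof.
have := cnormD x (- x); rewrite subrr cnorm_zero cnormN -mulr2n.
by rewrite pmulrn_lge0.
Qed.

Lemma cnormE x : cnorm x = (nrm x)%:C.
Proof. by rewrite /nrm RRe_real // ger0_real // cnorm_ge0. Qed.

Lemma nrm_ge0 x : 0 <= nrm x.
Proof. by rewrite -lecR -cnormE cnorm_ge0. Qed.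

Lemma nrm0 : nrm (0 : A) = 0.
Proof. by rewrite /nrm cnorm_zero. Qed.

Lemma nrm0_eq0 x : nrm x = 0 -> x = 0.
Proof. by move=> x0; apply: cnorm0_eq0; rewrite cnormE x0. Qed.

Lemma nrmN x : nrm (- x) = nrm x.
Proof. by rewrite /nrm cnormN. Qed.

Lemma nrmBC x y : nrm (x - y) = nrm (y - x).
Proof. by rewrite -nrmN opprB. Qed.

Lemma nrmD x y : nrm (x + y) <= nrm x + nrm y.
Proof. by rewrite -lecR rmorphD /= -!cnormE cnormD. Qed.

Lemma nrmB x y : nrm (x - y) <= nrm x + nrm y.
Proof. by rewrite -(nrmN y) nrmD. Qed.

Lemma nrmM x y : nrm (x * y) <= nrm x * nrm y.
Proof. by rewrite -lecR rmorphM /= -!cnormE cnormM. Qed.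

Lemma nrm_starM x : nrm (star x * x) = nrm x ^+ 2.
Proof. by apply: complexI; rewrite rmorphXn /= -!cnormE cnorm_starM. Qed.

(** The C*-identity gives [nrm y ^+ 2 <= nrm (star y) * nrm y]; the reverse bound is the same one at
    [star y]. *)
Lemma nrm_star x : nrm (star x) = nrm x.
Proof.
have H y : nrm y <= nrm (star y).
  have [->|y0] := eqVneq (nrm y) 0; first exact: nrm_ge0.
  have yp : 0 < nrm y by rewrite lt0r y0 nrm_ge0.
  by rewrite -(ler_pM2r yp) -expr2 -nrm_starM nrmM.
by apply/eqP; rewrite eq_le H andbT -{2}(starK x) H.
Qed.

(** Real scalars as elements of the algebra, declared a ring morphism below so that [ring] computes
    with them. *)
Definition rsc r : A := (r%:C)%:A.

Fact rsc_additive : zmod_morphism rsc.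
Proof. by move=> r s; rewrite /rsc !rmorphB /= scalerBl. Qed.
HB.instance Definition _ := GRing.isZmodMorphism.Build R A rsc rsc_additive.

Fact rsc_monoid : monoid_morphism rsc.
Proof.
split=> [|r s]; rewrite /rsc; first by rewrite rmorph1 scale1r.
by rewrite rmorphM /= -scalerAl mul1r scalerA.
Qed.
HB.instance Definition _ := GRing.isMonoidMorphism.Build R A rsc rsc_monoid.

Lemma rscE r x : rsc r * x = r%:C *: x.
Proof. by rewrite /rsc -scalerAl mul1r. Qed.

Lemma rscC r x : x * rsc r = rsc r * x.
Proof. by rewrite rscE /rsc -scalerAr mulr1. Qed.

Lemma normCR r : `|r%:C| = `|r|%:C :> R[i].
Proof. by rewrite normc_def /= expr0n addr0 sqrtr_sqr. Qed.

Lemma nrm_rscM r x : nrm (rsc r * x) = `|r| * nrm x.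
Proof. by apply: complexI; rewrite rscE -cnormE cnormZ normCR rmorphM /= cnormE. Qed.

Lemma nrm1 : nrm (1 : A) = 1.
Proof.
have := nrm_starM 1; rewrite star1 mul1r expr2.
have n10 : nrm (1 : A) != 0 by apply/eqP => /nrm0_eq0 /eqP; rewrite oner_eq0.
by move=> /(congr1 (fun t => t / nrm (1 : A))); rewrite divff // mulfK.
Qed.

Lemma nrm_rsc r : nrm (rsc r) = `|r|.
Proof. by rewrite -[rsc r]mulr1 nrm_rscM nrm1 mulr1. Qed.

Lemma star0 : star 0 = 0 :> A.
Proof. by apply: (addrI (star 0)); rewrite -starD !addr0. Qed.

Lemma starN x : star (- x) = - star x.
Proof. by apply: (addrI (star x)); rewrite -starD !subrr star0. Qed.

Lemma starB x y : star (x - y) = star x - star y.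
Proof. by rewrite starD starN. Qed.

Definition sa x := star x = x.

Lemma sa_rsc r : sa (rsc r).
Proof. by rewrite /sa /rsc starZ star1 (CrealP _) // complex_real. Qed.
Lemma sa0 : sa 0. Proof. exact: star0. Qed.
Lemma sa1 : sa 1. Proof. exact: star1. Qed.
Lemma saD x y : sa x -> sa y -> sa (x + y).
Proof. by rewrite /sa starD => -> ->. Qed.
Lemma saN x : sa x -> sa (- x).
Proof. by rewrite /sa starN => ->. Qed.
Lemma saB x y : sa x -> sa y -> sa (x - y).
Proof. by rewrite /sa starB => -> ->. Qed.
Lemma sa_rscM r x : sa x -> sa (rsc r * x).
Proof. by rewrite /sa starM => ->; rewrite sa_rsc rscC. Qed.
Lemma sa_starM x : sa (star x * x).
Proof. by rewrite /sa starM starK. Qed.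
Lemma saM x y : sa x -> sa y -> x * y = y * x -> sa (x * y).
Proof. by rewrite /sa starM => -> ->. Qed.

(* [a] is the real part of [a + ib], whose squared norm is [nrm (a ^+ 2 + b ^+ 2)]. *)
Lemma nrm_sqr_le a b : sa a -> sa b -> a * b = b * a ->
  nrm a ^+ 2 <= nrm (a ^+ 2 + b ^+ 2).
Proof.
move=> aa bb ab; pose z := a + ('i : R[i]) *: b.
have sz : star z = a - ('i : R[i]) *: b.
  by rewrite /z starD starZ aa bb -scaleNr; congr (_ + _ *: _); rewrite /= conjCi.
have zz : star z * z = a ^+ 2 + b ^+ 2.
  have ii : ('i : R[i]) * 'i = -1 by rewrite -expr2 sqrCi.
  rewrite sz /z mulrDr !mulrBl -!scalerAl -!scalerAr scalerA ii scaleN1r.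
  by rewrite ab opprK addrA subrK !expr2.
rewrite -zz nrm_starM ler_sqr ?nnegrE ?nrm_ge0 //.
have az : a = rsc 2^-1 * (z + star z).
  rewrite sz /z addrACA subrr addr0 -{2 3}[a]mul1r -mulrDl mulrA.
  by rewrite -(rmorph1 rsc) -rmorphD -rmorphM mulVf ?pnatr_eq0 // rmorph1 mul1r.
rewrite {1}az nrm_rscM ger0_norm ?invr_ge0 //.
rewrite mulrC ler_pdivrMr // mulr_natr mulr2n.
by rewrite -{2}(nrm_star z) nrmD.
Qed.

Lemma nrm_sqr a : sa a -> nrm (a ^+ 2) = nrm a ^+ 2.
Proof. by move=> aa; rewrite -nrm_starM aa. Qed.

End Norm.

Section Complete.
Variables (R : realType) (A : cstarAlgType R).
Implicit Types (x y z : A) (r s : R).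

Lemma ball_nrm x y (e : R[i]) :
  0 < e -> ball (x : normed_space A) e y <-> nrm (x - y) < complex.Re e.
Proof.
move=> e0; rewrite -ball_normE /= /ball_ /Num.norm /= cnormE.
by rewrite -{1}(RRe_real (gtr0_real e0)) ltcR.
Qed.

Lemma closed_nrmP (S : set A) :
  closed (S : set (normed_space A)) <->
  forall x, (forall e : R, 0 < e -> exists2 y, S y & nrm (x - y) < e) -> S x.
Proof.
split=> [clS x Sx|H x clx].
  apply: clS => U /nbhs_ballP[e /= e0 eU].
  have [|y Sy xy] := Sx (complex.Re e).
    by move: e0; rewrite ltcE /= => /andP[].
  by exists y; split=> //; apply: eU; apply/ball_nrm.
apply: H => e e0.
have [|y [Sy xy]] := clx (ball (x : normed_space A) e%:C).
  by apply: nbhsx_ballx; rewrite ltcR.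
have e0' : 0 < e%:C by rewrite ltcR.
by exists y => //; exact: (proj1 (ball_nrm x y e0') xy).
Qed.

Lemma nrm_complete (u : nat -> A) :
  (forall e : R, 0 < e -> exists N, forall m n, (N <= m)%N -> (N <= n)%N ->
     nrm (u m - u n) < e) ->
  exists l, forall e : R, 0 < e -> exists N, forall n, (N <= n)%N -> nrm (u n - l) < e.
Proof.
move=> cu.
have : cauchy ((u : nat -> normed_space A) @ \oo).
  apply/cauchyP => e e0.
  have er : 0 < complex.Re e by move: e0; rewrite ltcE /= => /andP[].
  have [N HN] := cu _ er; exists (u N).
  exists N => // n /= Nn; apply/ball_nrm => //; exact: HN.
move=> /cstar_complete /cvg_ex[l ul]; exists l => e e0.
have /cvg_ballP /(_ e%:C) := ul; rewrite ltcR => /(_ e0) [N _ HN].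
exists N => n Nn; rewrite nrmBC.
have e0' : 0 < e%:C by rewrite ltcR.
exact: (proj1 (ball_nrm l (u n) e0') (HN n Nn)).
Qed.

Lemma geometric_limit (u : nat -> A) (M k : R) : 0 <= k < 1 ->
  (forall n, nrm (u n.+1 - u n) <= M * k ^+ n) ->
  exists l, forall e : R, 0 < e -> exists N, forall n, (N <= n)%N -> nrm (u n - l) < e.
Proof.
move=> /andP[k0 k1] uM; apply: nrm_complete => e e0.
have k1' : 0 < 1 - k by rewrite subr_gt0.
have M0 : 0 <= M by have := uM 0%N; rewrite expr0 mulr1; apply: le_trans; exact: nrm_ge0.
(* The difference [k ^+ n - k ^+ m], in place of [k ^+ n] alone, makes the induction on m close with
   equality. *)
have tail n m : (n <= m)%N -> nrm (u m - u n) <= M * (k ^+ n - k ^+ m) / (1 - k).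
  elim: m => [|m IH]; first by rewrite leqn0 => /eqP ->; rewrite !subrr mulr0 mul0r nrm0.
  rewrite leq_eqVlt => /orP[/eqP ->|]; first by rewrite !subrr mulr0 mul0r nrm0.
  rewrite ltnS => /IH {}IH.
  have -> : u m.+1 - u n = (u m.+1 - u m) + (u m - u n) by rewrite addrA subrK.
  apply: le_trans (nrmD _ _) (le_trans (lerD (uM m) IH) _).
  rewrite le_eqVlt; apply/orP; left; apply/eqP.
  by rewrite exprS; field; rewrite gt_eqF.
have [N HN] : exists N, M * k ^+ N / (1 - k) < e / 2.
  have [->|M1] := eqVneq M 0; first by exists 0%N; rewrite !mul0r divr_gt0.
  have kc : (k ^+ n @[n --> \oo] --> 0)%classic.
    by apply: cvg_expr; rewrite ger0_norm.
  have Mp : 0 < M by rewrite lt0r M1.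
  have d0 : 0 < (1 - k) * e / 2 / M by rewrite !divr_gt0 // mulr_gt0.
  have /cvgrPdist_lt /(_ _ d0) [N _ HN] := kc; exists N.
  have := HN N (leqnn _); rewrite /= sub0r normrN ger0_norm ?exprn_ge0 //.
  rewrite ltr_pdivlMr // => H.
  by rewrite ltr_pdivrMr // [M * _]mulrC (lt_le_trans H) // -mulrA mulrC.
have tailN n : (N <= n)%N -> nrm (u n - u N) < e / 2.
  move=> Nn; apply: le_lt_trans (tail _ _ Nn) (le_lt_trans _ HN).
  rewrite ler_pM2r ?invr_gt0 // ler_wpM2l // gerBl exprn_ge0 //.
exists N => m n Nm Nn.
have -> : u m - u n = (u m - u N) - (u n - u N) by rewrite opprB addrA subrK.
by apply: le_lt_trans (nrmB _ _) _; rewrite [e]splitr ltrD // tailN.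
Qed.

End Complete.

Section ContextClosure.
Variables (R : realType) (A : cstarAlgType R) (S : context A).
Implicit Types (x y z : A) (r s : R).

Lemma context0 : context_set S 0.
Proof. by have := contextL (-1) (context1 S) (context1 S); rewrite scaleN1r addNr. Qed.

Lemma contextZ (a : R[i]) x : context_set S x -> context_set S (a *: x).
Proof. by move=> Sx; rewrite -[_ *: _]addr0; apply: contextL => //; exact: context0. Qed.

Lemma contextD x y : context_set S x -> context_set S y -> context_set S (x + y).
Proof. by move=> Sx Sy; rewrite -[x]scale1r; exact: contextL. Qed.

Lemma contextN x : context_set S x -> context_set S (- x).
Proof. by move=> Sx; rewrite -scaleN1r; exact: contextZ. Qed.

Lemma contextB x y : context_set S x -> context_set S y -> context_set S (x - y).
Proof. by move=> Sx Sy; apply: contextD => //; exact: contextN. Qed.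

Lemma context_rsc r : context_set S (rsc A r).
Proof. by apply: contextZ; exact: context1. Qed.

Lemma contextX x n : context_set S x -> context_set S (x ^+ n).
Proof.
move=> Sx; elim: n => [|n IH]; first exact: context1.
by rewrite exprS; exact: contextM.
Qed.

End ContextClosure.

Section Commutative.
Variables (R : realType) (D : comCstarAlgType R).
Implicit Types (x y z a b c : D) (r s : R).
Local Notation rsc := (rsc D).

Lemma saM_com x y : sa x -> sa y -> sa (x * y).
Proof. by move=> sx sy; apply: saM => //; rewrite mulrC. Qed.

Lemma saX_com x n : sa x -> sa (x ^+ n).
Proof.
move=> sx; elim: n => [|n IH]; first exact: sa1.
by rewrite exprS; exact: saM_com.
Qed.

(* The square root is [1 - v] for the fixed point [v] of [v |-> (u + v ^+ 2) / 2]. *)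
Lemma sqrt_one_minus (S : context D) u : context_set S u -> sa u -> nrm u < 1 ->
  exists v, [/\ context_set S v, sa v, nrm (1 - v) < 1 & v ^+ 2 = 1 - u].
Proof.
move=> Su su u1; pose k := nrm u.
have k0 : 0 <= k := nrm_ge0 u.
have h2 : `|2^-1 : R| = 2^-1 by rewrite ger0_norm // invr_ge0.
pose F v := rsc 2^-1 * (u + v ^+ 2).
pose v := fix v n := if n is n'.+1 then F (v n') else 0.
(* The ball of radius k is stable because [(k + k ^+ 2) / 2 <= k] for [k < 1]; on it the map has
   Lipschitz constant k. *)
have vP n : [/\ context_set S (v n), sa (v n) & nrm (v n) <= k].
  elim: n => [|n [Sv sv vk]] /=; first by split; [exact: context0|exact: sa0|rewrite nrm0].
  split.
  - apply: contextM; first exact: context_rsc.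
    by apply: contextD => //; exact: contextX.
  - by apply: sa_rscM; apply: saD => //; exact: saX_com.
  - rewrite nrm_rscM h2; apply: (@le_trans _ _ (2^-1 * (k + k ^+ 2))).
      rewrite ler_pM2l ?invr_gt0 //; apply: le_trans (nrmD _ _) _.
      by rewrite lerD2l nrm_sqr // lerXn2r ?nnegrE ?nrm_ge0.
    by rewrite -/k in u1; nra.
have contr n : nrm (v n.+2 - v n.+1) <= k * nrm (v n.+1 - v n).
  have -> : v n.+2 - v n.+1 = rsc 2^-1 * ((v n.+1 - v n) * (v n.+1 + v n)).
    have FB a b : F a - F b = rsc 2^-1 * ((a - b) * (a + b)) by rewrite /F; ring.
    exact: FB.
  have v2k : nrm (v n.+1 + v n) <= 2 * k.
    apply: le_trans (nrmD _ _) _.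
    by case: (vP n) => _ _ ?; case: (vP n.+1) => _ _ ?; lra.
  rewrite nrm_rscM h2.
  have := le_trans (nrmM _ _) (ler_wpM2l (nrm_ge0 (v n.+1 - v n)) v2k); lra.
have [|n|l lim] := @geometric_limit _ _ v k k; first by rewrite k0.
  elim: n => [|n IH].
    rewrite expr0 mulr1 subr0 /= /F expr0n addr0 nrm_rscM h2.
    by rewrite -/k; lra.
  by apply: le_trans (contr n) _; rewrite exprS mulrCA ler_wpM2l.
have Sl : context_set S l.
  have /closed_nrmP := @context_closed _ _ S; apply => e /lim [N HN].
  by exists (v N); [case: (vP N)|rewrite nrmBC HN].
have sl : sa l.
  apply/eqP; rewrite -subr_eq0; apply/eqP/nrm0_eq0/eqP.
  rewrite eq_le nrm_ge0 andbT; apply/ler_addgt0Pl => e e0; rewrite addr0.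
  have /lim[N /(_ N (leqnn _)) HN] : 0 < e / 2 by rewrite divr_gt0.
  have -> : star l - l = (v N - l) - star (v N - l).
    by rewrite starB; case: (vP N) => _ -> _; ring.
  by apply: le_trans (nrmB _ _) _; rewrite nrm_star; lra.
have lk : nrm l <= k.
  apply/ler_addgt0Pl => e /lim [N /(_ N (leqnn _)) HN].
  have -> : l = v N - (v N - l) by rewrite opprB addrC subrK.
  by apply: le_trans (nrmB _ _) _; case: (vP N) => _ _ vk; lra.
have fix_l : l = F l.
  apply/eqP; rewrite -subr_eq0; apply/eqP/nrm0_eq0/eqP.
  rewrite eq_le nrm_ge0 andbT; apply/ler_addgt0Pl => e e0; rewrite addr0.
  have /lim[N HN] : 0 < e / 2 by rewrite divr_gt0.
  have -> : l - F l = rsc 2^-1 * ((v N - l) * (v N + l)) - (v N.+1 - l).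
    have FB a b c : c - F a = rsc 2^-1 * ((b - a) * (b + a)) - (F b - c).
      by rewrite /F; ring.
    exact: FB.
  apply: le_trans (nrmB _ _) _; rewrite nrm_rscM h2.
  have := HN N (leqnn _); have := HN N.+1 (leqnSn _).
  have := nrmM (v N - l) (v N + l); have := nrmD (v N) l.
  case: (vP N) => _ _; rewrite -/k in u1.
  move: (nrm_ge0 (v N - l)) (nrm_ge0 (v N + l)); nra.
exists (1 - l); split.
- by apply: contextB => //; exact: context1.
- by apply: saB => //; exact: sa1.
- by rewrite subKr (le_lt_trans lk).
- have E : u = 2 * l - l ^+ 2.
    rewrite {1}fix_l /F mulrA -(rmorph_nat rsc 2) -rmorphM divff ?pnatr_eq0 //.
    by rewrite rmorph1 mul1r addrK.
  by rewrite E; ring.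
Qed.

(** The hypothesis is strict positivity of x in norm form. It says that [x = r (1 - u)] with
    [nrm u < 1], and the root satisfies the same condition with t the square root of r. *)
Lemma sqrt_pos (S : context D) x r : context_set S x -> sa x -> nrm (rsc r - x) < r ->
  exists v, [/\ context_set S v, sa v, exists t, nrm (rsc t - v) < t & v ^+ 2 = x].
Proof.
move=> Sx sx xr; have r0 : 0 < r by apply: le_lt_trans xr; exact: nrm_ge0.
have rr : rsc r * rsc r^-1 = 1 by rewrite -rmorphM divff ?rmorph1 ?gt_eqF.
pose u := rsc r^-1 * (rsc r - x).
have [||| v [Sv sv v1 vE]] := @sqrt_one_minus S u.
- apply: contextM; first exact: context_rsc.
  by apply: contextB => //; exact: context_rsc.
- by apply: sa_rscM; apply: saB => //; exact: sa_rsc.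
- by rewrite nrm_rscM ger0_norm ?invr_ge0 ?ltW // mulrC ltr_pdivrMr // mul1r.
exists (rsc (Num.sqrt r) * v); split.
- by apply: contextM => //; exact: context_rsc.
- exact: sa_rscM.
- exists (Num.sqrt r).
  rewrite -{1}[rsc (Num.sqrt r)]mulr1 -mulrBr nrm_rscM ger0_norm ?sqrtr_ge0 //.
  by rewrite gtr_pMr // sqrtr_gt0.
- rewrite exprMn -rmorphXn /= sqr_sqrtr ?ltW // vE /u mulrBr mulr1 mulrA rr mul1r.
  by rewrite opprB addrC subrK.
Qed.

(** With [t ^+ 2 = 4 r], the squares of [r - 2 a^2] and [t a] add up to [r^2 + 4 a^4], so
    [nrm_sqr_le] applies. For large r the bound is close to [r ^+ 2]: squares are almost positive in
    norm form. *)
Lemma nrm_one_minus_sqr a r : sa a -> 0 < r ->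
  nrm (rsc r - rsc 2 * a ^+ 2) ^+ 2 <= r ^+ 2 + 4 * nrm a ^+ 4.
Proof.
move=> sa_a r0; pose t := Num.sqrt (4 * r).
have t2 : t ^+ 2 = 4 * r by rewrite sqr_sqrtr // mulr_ge0 // ltW.
have := @nrm_sqr_le _ _ (rsc r - rsc 2 * a ^+ 2) (rsc t * a).
have -> : (rsc r - rsc 2 * a ^+ 2) ^+ 2 + (rsc t * a) ^+ 2 =
    rsc (r ^+ 2) + rsc 4 * a ^+ 4.
  have -> : (rsc t * a) ^+ 2 = rsc (4 * r) * a ^+ 2 by rewrite -t2; ring.
  by ring.
move=> H; apply: le_trans (H _ _ _) _.
- by apply: saB; [exact: sa_rsc|apply: sa_rscM; exact: saX_com].
- exact: sa_rscM.
- by rewrite mulrC.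
apply: le_trans (nrmD _ _) _; rewrite nrm_rsc nrm_rscM !ger0_norm ?sqr_ge0 //.
have -> : a ^+ 4 = (a ^+ 2) ^+ 2 by rewrite -exprM.
by rewrite lerD2l ler_pM2l // !nrm_sqr -?exprM //; exact: saX_com.
Qed.

(** The summand e provides the strict positivity needed by [sqrt_pos]. The distance to [r + e] is
    measured by the average of [r - 2 a^2] and [r - 2 b^2], whence the factor 2 in
    [nrm_one_minus_sqr]. *)
Lemma sqrt_sum_squares (S : context D) a b e :
  context_set S a -> sa a -> context_set S b -> sa b -> 0 < e ->
  exists c, [/\ context_set S c, sa c, exists t, nrm (rsc t - c) < t &
    c ^+ 2 = a ^+ 2 + b ^+ 2 + rsc e].
Proof.
move=> Sa sa_a Sb sa_b e0.
pose M := nrm a ^+ 4 + nrm b ^+ 4.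
have M0 : 0 <= M by rewrite addr_ge0 // exprn_ge0 // nrm_ge0.
(* This r makes [4 * M < r * e], hence [r ^+ 2 + 4 * M < (r + e) ^+ 2], which beats the bound of
   [nrm_one_minus_sqr]. *)
pose r := 4 * M / e + 1.
have r0 : 0 < r by rewrite ltr_pwDr // divr_ge0 ?mulr_ge0 // ltW.
have rM : 4 * M < r * e.
  have -> : r * e = 4 * M + e by rewrite /r; field; rewrite gt_eqF.
  by rewrite ltrDl.
apply: (@sqrt_pos S _ (r + e)).
- apply: contextD; last exact: context_rsc.
  by apply: contextD; exact: contextX.
- apply: saD; last exact: sa_rsc.
  by apply: saD; exact: saX_com.
have -> : rsc (r + e) - (a ^+ 2 + b ^+ 2 + rsc e) =
   rsc 2^-1 * ((rsc r - rsc 2 * a ^+ 2) + (rsc r - rsc 2 * b ^+ 2)).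
  have h : rsc 2^-1 * 2 = 1.
    by rewrite -(rmorph_nat rsc 2) -rmorphM mulVf ?pnatr_eq0 ?rmorph1.
  rewrite [rsc (r + e)]rmorphD (rmorph_nat rsc 2).
  transitivity ((rsc 2^-1 * 2) * (rsc r - a ^+ 2 - b ^+ 2)); last by ring.
  by rewrite h; ring.
rewrite nrm_rscM ger0_norm ?invr_ge0 // mulrC ltr_pdivrMr //.
apply: le_lt_trans (nrmD _ _) _.
have bound c : sa c -> nrm c ^+ 4 <= M -> nrm (rsc r - rsc 2 * c ^+ 2) < r + e.
  move=> sc cM; have := nrm_one_minus_sqr sc r0.
  set N := nrm _; have N0 : 0 <= N by exact: nrm_ge0.
  move=> H; rewrite ltNge; apply/negP => rN.
  have re0 : 0 < r * e by rewrite mulr_gt0.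
  have : (r + e) ^+ 2 <= N ^+ 2 by rewrite lerXn2r ?nnegrE // addr_ge0 // ltW.
  have -> : (r + e) ^+ 2 = r ^+ 2 + 2 * (r * e) + e ^+ 2 by ring.
  by have := sqr_ge0 e; lra.
have Ha : nrm a ^+ 4 <= M by rewrite lerDl exprn_ge0 ?nrm_ge0.
have Hb : nrm b ^+ 4 <= M by rewrite lerDr exprn_ge0 ?nrm_ge0.
by have := bound _ sa_a Ha; have := bound _ sa_b Hb; lra.
Qed.

End Commutative.

(** * Gelfand theory *)

Section FullContext.
Variables (R : realType) (D : comCstarAlgType R).

Definition full_context : context D :=
  @Context R D setT I (fun _ _ _ _ _ => I) (fun _ _ _ _ => I) (fun _ _ => I)
    (fun x y _ _ => mulrC x y) closedT.

End FullContext.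

Section PositiveCone.
Variables (R : realType) (D : comCstarAlgType R).
Implicit Types (x y z a b c p q : D) (r s t e : R).
Local Notation rsc := (rsc D).

(** The closure of the cone of squares: roots are available for strictly positive elements, so a
    square is asked for only after adding e. *)
Definition pos x := sa x /\ forall e, 0 < e -> exists2 c, sa c & c ^+ 2 = x + rsc e.

Lemma pos_sqr a : sa a -> pos (a ^+ 2).
Proof.
move=> sa_a; split=> [|e e0]; first exact: saX_com.
have [c [_ sc _ cE]] :=
  @sqrt_sum_squares _ _ (full_context D) a 0 e I sa_a I (@sa0 _ D) e0.
by exists c => //; rewrite cE expr0n addr0.
Qed.

Lemma pos_rsc r : 0 <= r -> pos (rsc r).
Proof.
move=> r0; have -> : rsc r = rsc (Num.sqrt r) ^+ 2 by rewrite -rmorphXn /= sqr_sqrtr.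
by apply: pos_sqr; exact: sa_rsc.
Qed.

Lemma posD x y : pos x -> pos y -> pos (x + y).
Proof.
move=> [sx Px] [sy Py]; split=> [|e e0]; first exact: saD.
have e3 : 0 < e / 3 by rewrite divr_gt0.
have [c sc cE] := Px _ e3; have [d sd dE] := Py _ e3.
have [f [_ sf _ fE]] := @sqrt_sum_squares _ _ (full_context D) c d _ I sc I sd e3.
exists f => //; rewrite fE cE dE.
by rewrite [in RHS](_ : e = e / 3 + e / 3 + e / 3); [ring|field].
Qed.

Lemma pos_nrm x t : sa x -> nrm x <= t -> pos (rsc t - x).
Proof.
move=> sx xt; split=> [|e e0]; first by apply: saB => //; exact: sa_rsc.
have [||c [_ sc _ cE]] := @sqrt_pos _ _ (full_context D) (rsc t - x + rsc e) (t + e) I.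
- by apply: saD; [apply: saB => //|]; exact: sa_rsc.
- rewrite [X in nrm X](_ : _ = x); last by ring.
  by rewrite (le_lt_trans xt) // ltrDl.
by exists c.
Qed.

Lemma posM x y : pos x -> pos y -> pos (x * y).
Proof.
move=> [sx Px] [sy Py]; split=> [|e e0]; first exact: saM_com.
(* The product of [x + d] and [y + d] is a square and exceeds [x * y] by [d^2 + d (x + y)]; K and d
   are chosen so that this excess has norm at most [e / 2]. *)
pose K := nrm x + nrm y + 1.
have K0 : 0 < K by rewrite ltr_wpDl // addr_ge0 // nrm_ge0.
pose d := Num.min 1 (e / 4 / K).
have d0 : 0 < d by rewrite lt_min ltr01 !divr_gt0.
have d1 : d <= 1 by rewrite ge_min lexx.
have dK : d * K <= e / 4 by rewrite -ler_pdivlMr // ge_min lexx orbT.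
have [c sc cE] := Px _ d0; have [c' sc' cE'] := Py _ d0.
have nb : nrm (rsc (d ^+ 2) + rsc d * (x + y)) <= e / 2.
  apply: le_trans (nrmD _ _) _; rewrite nrm_rsc nrm_rscM !ger0_norm ?sqr_ge0 ?ltW //.
  have : d * nrm (x + y) <= d * (nrm x + nrm y) by rewrite ler_wpM2l ?nrmD // ltW.
  have : d ^+ 2 <= d by rewrite expr2 ger_pMl.
  by move: dK; rewrite /K !mulrDr mulr1; have := nrm_ge0 x; have := nrm_ge0 y; nra.
have sb : sa (rsc (d ^+ 2) + rsc d * (x + y)).
  by apply: saD; [exact: sa_rsc|apply: sa_rscM; exact: saD].
have e4 : 0 < e / 4 by rewrite divr_gt0.
have [f sf fE] := (pos_nrm sb nb).2 _ e4.
have [h [_ sh _ hE]] :=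
  @sqrt_sum_squares _ _ (full_context D) (c * c') f _ I (saM_com sc sc') I sf e4.
exists h => //; rewrite hE fE exprMn cE cE'.
rewrite [in RHS](_ : e = e / 2 + e / 4 + e / 4); last by field.
by rewrite rmorphXn; ring.
Qed.

(** With c and d roots of [t - x + e] and [t + x + e], the squares of x and [c * d] add up to the
    scalar [(e + t) ^+ 2], so [nrm_sqr_le] bounds x. *)
Lemma nrm_le_pos x t : sa x -> pos (rsc t - x) -> pos (rsc t + x) -> 0 <= t ->
  nrm x <= t.
Proof.
move=> sx [_ Pm] [_ Pp] t0; apply/ler_addgt0Pl => e e0.
have [c sc cE] := Pm _ e0; have [d sd dE] := Pp _ e0.
have et : 0 <= e + t by rewrite addr_ge0 // ltW.
rewrite -[_ <= _](ler_sqr (nrm_ge0 x) et).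
have := nrm_sqr_le sx (saM_com sc sd) (mulrC _ _).
rewrite exprMn cE dE.
have -> : x ^+ 2 + (rsc t - x + rsc e) * (rsc t + x + rsc e) = rsc ((e + t) ^+ 2).
  by ring.
by rewrite nrm_rsc ger0_norm // sqr_ge0.
Qed.

End PositiveCone.

(** * Maximal preorderings and the real characters they define *)

Section Preordering.
Variables (R : realType) (D : comCstarAlgType R).
Implicit Types (x y z a b c p q : D) (r s t e : R).
Local Notation rsc := (rsc D).

Record preordering (Q : set D) : Prop := Preordering {
  preord_sa : forall x, Q x -> sa x;
  preord_pos : forall x, pos x -> Q x;
  preordD : forall x y, Q x -> Q y -> Q (x + y);
  preordM : forall x y, Q x -> Q y -> Q (x * y);
  preordN1 : ~ Q (-1)
}.

Lemma maximal_preordering (Q0 : set D) : preordering Q0 ->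
  exists Q, [/\ preordering Q, Q0 `<=` Q & forall Q', preordering Q' -> Q `<=` Q' -> Q' `<=` Q].
Proof.
move=> pQ0; pose P (X : set D) := X = set0 \/ (preordering X /\ Q0 `<=` X).
have [F FP Ftot|Q [PQ Qmax]] := @Zorn_bigcup _ P.
  have [[X [FX [X0 Q0X]]]|none] := pselect (exists X, F X /\ preordering X /\ Q0 `<=` X).
    right; split; last by move=> x /Q0X ?; exists X.
    have good Y y : F Y -> Y y -> preordering Y by move=> /FP [->|[]].
    split.
    - by move=> x [Y /good FY Yx]; apply: preord_sa (Yx); exact: FY Yx.
    - by move=> x px; exists X => //; exact: preord_pos.
    - move=> x y [Y FY Yx] [Z FZ Zy].
      have [YZ|ZY] := Ftot _ _ FY FZ.
        by exists Z => //; apply: preordD (YZ _ Yx) (Zy); exact: good FZ Zy.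
      by exists Y => //; apply: preordD (Yx) (ZY _ Zy); exact: good FY Yx.
    - move=> x y [Y FY Yx] [Z FZ Zy].
      have [YZ|ZY] := Ftot _ _ FY FZ.
        by exists Z => //; apply: preordM (YZ _ Yx) (Zy); exact: good FZ Zy.
      by exists Y => //; apply: preordM (Yx) (ZY _ Zy); exact: good FY Yx.
    - by move=> [Y FY YN]; apply: preordN1 (YN); exact: good FY YN.
  left; apply/seteqP; split=> // x [Y FY Yx].
  case: (FP _ FY) => [Y0|YP]; first by rewrite Y0 in Yx.
  by exfalso; apply: none; exists Y.
have Q00 : Q0 0 by apply: preord_pos => //; rewrite -(rmorph0 rsc); exact: pos_rsc.
case: PQ => [Q_empty|[pQ Q0Q]].
  exfalso; apply: (Qmax Q0); last by right; split.
  by split; rewrite Q_empty // => /(_ _ Q00).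
exists Q; split=> // Q' pQ' QQ' x Q'x.
have [//|nQx] := pselect (Q x).
exfalso; apply: (Qmax Q'); first by split=> // /(_ _ Q'x).
by right; split=> //; exact: subset_trans QQ'.
Qed.

Section Maximal.
Variable Q : set D.
Hypothesis pQ : preordering Q.
Hypothesis Qmax : forall Q', preordering Q' -> Q `<=` Q' -> Q' `<=` Q.

Let Q1 : Q 1.
Proof. by apply: (preord_pos pQ); rewrite -(rmorph1 rsc); exact: pos_rsc. Qed.
Let Q0 : Q 0.
Proof. by apply: (preord_pos pQ); rewrite -(rmorph0 rsc); exact: pos_rsc. Qed.
Let Qsqr a : sa a -> Q (a ^+ 2).
Proof. by move=> /pos_sqr; exact: (preord_pos pQ). Qed.
Let Qrsc r : 0 <= r -> Q (rsc r).
Proof. by move=> r0; apply: (preord_pos pQ); exact: pos_rsc. Qed.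
Let QM := @preordM _ pQ.
Let QD := @preordD _ pQ.

(** For x outside Q the set [Q + x * Q], closed under products since [x ^+ 2] is in Q, strictly
    extends Q; by maximality it must contain -1. *)
Let Q_notin x : sa x -> ~ Q x -> exists p q, [/\ Q p, Q q & -1 = p + x * q].
Proof.
move=> sx nQx; apply: contrapT => none; apply: nQx.
pose Q' := [set y | exists p q, [/\ Q p, Q q & y = p + x * q]].
apply: (Qmax (Q' := Q')); last by exists 0, 1; rewrite add0r mulr1.
  split.
  - move=> _ [p [q [/(preord_sa pQ) sp /(preord_sa pQ) sq ->]]].
    by apply: saD => //; exact: saM_com.
  - by move=> y /(preord_pos pQ) Qy; exists y, 0; rewrite mulr0 addr0.
  - move=> _ _ [p [q [Qp Qq ->]]] [p' [q' [Qp' Qq' ->]]].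
    by exists (p + p'), (q + q'); split; [exact: QD|exact: QD|ring].
  - move=> _ _ [p [q [Qp Qq ->]]] [p' [q' [Qp' Qq' ->]]].
    exists (p * p' + x ^+ 2 * (q * q')), (p * q' + q * p'); split; last by ring.
      by apply: QD; [exact: QM|apply: QM; [exact: Qsqr|exact: QM]].
    by apply: QD; exact: QM.
  - by move=> [p [q H]]; apply: none; exists p, q.
by move=> y Qy; exists y, 0; rewrite mulr0 addr0.
Qed.

(** If neither sign belonged to Q, multiplying [x q = -1 - p] by [- x q' = -1 - p'] would exhibit -1
    as a sum of elements of Q. *)
Lemma preord_total x : sa x -> Q x \/ Q (- x).
Proof.
move=> sx; have [|/(Q_notin sx) [p [q [Qp Qq E]]]] := pselect (Q x); first by left.
have [|/(Q_notin (saN sx)) [p' [q' [Qp' Qq' E']]]] := pselect (Q (- x)); first by right.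
exfalso; apply: (preordN1 pQ).
have -> : -1 = x ^+ 2 * (q * q') + (p + p' + p * p').
  have -> : x ^+ 2 * (q * q') = - ((x * q) * (- x * q')) by ring.
  have -> : x * q = -1 - p by rewrite E addrAC subrr add0r.
  have -> : - x * q' = -1 - p' by rewrite E' addrAC subrr add0r.
  by ring.
apply: QD; first by apply: QM; [exact: Qsqr|exact: QM].
by apply: QD; [exact: QD|exact: QM].
Qed.

Let Q_neg r : r < 0 -> ~ Q (rsc r).
Proof.
move=> r0 Qr; apply: (preordN1 pQ).
have -> : -1 = rsc (- r^-1) * rsc r.
  by rewrite -rmorphM mulNr mulVf ?lt_eqF // rmorphN rmorph1.
by apply: QM => //; apply: Qrsc; rewrite oppr_ge0 invr_le0 ltW.
Qed.

(* [r] is the value at [x] of the real character attached to the total preordering. *)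
Let value x r := (forall s, r < s -> Q (rsc s - x)) /\ (forall s, s < r -> Q (x - rsc s)).

(** The value is the supremum of the s with [x - rsc s] in Q; above it, totality puts [rsc s - x] in
    Q. *)
Let value_ex x : sa x -> exists r, value x r.
Proof.
move=> sx; pose E := [set s | Q (x - rsc s)].
have E0 : E (- nrm x).
  rewrite /E /= rmorphN opprK addrC -[X in _ + X]opprK; apply: (preord_pos pQ).
    by apply: pos_nrm; [exact: saN|rewrite nrmN].
have Eub : ubound E (nrm x).
  move=> s Es; rewrite leNgt; apply/negP => xs.
  have /(preord_pos pQ) Qx := pos_nrm sx (lexx (nrm x)).
  apply: (@Q_neg (nrm x - s)); first by rewrite subr_lt0.
  have -> : rsc (nrm x - s) = (x - rsc s) + (rsc (nrm x) - x) by ring.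
  exact: QD.
have hsE : has_sup E by split; [exists (- nrm x)|exists (nrm x)].
exists (sup E); split=> s.
  move=> Es; have [|] := preord_total (saB sx (sa_rsc _ s)); last by rewrite opprB.
  by move=> /(ub_le_sup hsE.2); rewrite leNgt Es.
move=> sE; have [t Et st] := sup_adherent (eps := sup E - s) ltac:(by rewrite subr_gt0) hsE.
rewrite subKr in st.
have -> : x - rsc s = (x - rsc t) + rsc (t - s) by ring.
by apply: QD => //; apply: Qrsc; rewrite subr_ge0 ltW.
Qed.

Let value_uniq x r s : value x r -> value x s -> r = s.
Proof.
wlog rs : r s / r < s => [H vr vs|].
  by have [/H|/H|//] := ltgtP r s; [apply|move=> /(_ vs vr)].
move=> [vr _] [_ vs]; exfalso.
pose t := (r + (r + s) / 2) / 2; pose t' := (r + s) / 2.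
apply: (@Q_neg (t - t')); first by rewrite /t /t'; lra.
have -> : rsc (t - t') = (rsc t - x) + (x - rsc t') by ring.
by apply: QD; [apply: vr|apply: vs]; rewrite /t /t'; lra.
Qed.

Let value_rsc r : value (rsc r) r.
Proof.
by split=> s ?; rewrite -rmorphB; apply: Qrsc; rewrite subr_ge0 ltW.
Qed.

Let valueD x y r s : value x r -> value y s -> value (x + y) (r + s).
Proof.
move=> [vx1 vx2] [vy1 vy2]; split=> t rst.
  have -> : rsc t - (x + y) =
     (rsc (r + (t - r - s) / 2) - x) + (rsc (s + (t - r - s) / 2) - y).
    rewrite {1}(_ : t = r + (t - r - s) / 2 + (s + (t - r - s) / 2)); first by ring.
    by field.
  by apply: QD; [apply: vx1|apply: vy1]; lra.
have -> : x + y - rsc t =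
   (x - rsc (r + (t - r - s) / 2)) + (y - rsc (s + (t - r - s) / 2)).
  rewrite {1}(_ : t = r + (t - r - s) / 2 + (s + (t - r - s) / 2)); first by ring.
  by field.
by apply: QD; [apply: vx2|apply: vy2]; lra.
Qed.

Let valueN x r : value x r -> value (- x) (- r).
Proof.
move=> [v1 v2]; split=> s rs.
  have -> : rsc s - - x = x - rsc (- s) by ring.
  by apply: v2; lra.
have -> : - x - rsc s = rsc (- s) - x by ring.
by apply: v1; lra.
Qed.

(** Multiplicativity starts at value 0, where [s - x^2] factors into two elements of Q. A shift by r
    then gives all squares, and polarization gives products. *)
Let value_sqr0 x : sa x -> value x 0 -> value (x ^+ 2) 0.
Proof.
move=> sx [v1 v2]; split=> s s0.
  have t0 : 0 < Num.sqrt s by rewrite sqrtr_gt0.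
  have -> : rsc s - x ^+ 2 = (rsc (Num.sqrt s) - x) * (x - rsc (- Num.sqrt s)).
    by rewrite -[in LHS](sqr_sqrtr (ltW s0)); ring.
  by apply: QM; [exact: v1|apply: v2; lra].
rewrite -rmorphN; apply: QD; first exact: Qsqr.
by apply: Qrsc; lra.
Qed.

Let valueZ t x r : sa x -> value x r -> value (rsc t * x) (t * r).
Proof.
wlog t0 : t / 0 < t => [H sx vx|].
  have [t0|t0|<-] := ltgtP 0 t.
  - exact: H.
  - have Nt0 : 0 < - t by lra.
    by have := valueN (H _ Nt0 sx vx); rewrite rmorphN !mulNr !opprK.
  - by rewrite rmorph0 !mul0r -(rmorph0 rsc); exact: value_rsc.
move=> sx [v1 v2].
have tt s : rsc s = rsc t * rsc (s / t) by rewrite -rmorphM mulrCA divff ?mulr1 ?gt_eqF.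
split=> s rs.
  rewrite (tt s) -mulrBr; apply: QM; first by apply: Qrsc; exact: ltW.
  by apply: v1; rewrite ltr_pdivlMr // mulrC.
rewrite (tt s) -mulrBr; apply: QM; first by apply: Qrsc; exact: ltW.
by apply: v2; rewrite ltr_pdivrMr // mulrC.
Qed.

Let value_sqr x r : sa x -> value x r -> value (x ^+ 2) (r ^+ 2).
Proof.
move=> sx vx; have s0 : sa (x - rsc r) by apply: saB => //; exact: sa_rsc.
have v0 : value (x - rsc r) 0.
  by rewrite -(subrr r); apply: valueD => //; apply: valueN; exact: value_rsc.
have -> : x ^+ 2 = (x - rsc r) ^+ 2 + (rsc (2 * r) * x + rsc (- r ^+ 2)) by ring.
rewrite [X in value _ X](_ : _ = 0 + ((2 * r) * r + (- r ^+ 2))); last by ring.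
apply: valueD; first exact: value_sqr0.
by apply: valueD; [exact: valueZ|exact: value_rsc].
Qed.

Let valueM x y r s : sa x -> sa y -> value x r -> value y s -> value (x * y) (r * s).
Proof.
move=> sx sy vx vy.
have -> : x * y = rsc 4^-1 * ((x + y) ^+ 2 - (x - y) ^+ 2).
  have h : rsc 4^-1 * 4 = 1.
    by rewrite -(rmorph_nat rsc 4) -rmorphM mulVf ?pnatr_eq0 ?rmorph1.
  by rewrite -[LHS]mul1r -h; ring.
have -> : r * s = 4^-1 * ((r + s) ^+ 2 - (r - s) ^+ 2) by field.
have sp : sa (x + y) by exact: saD.
have sm : sa (x - y) by exact: saB.
apply: valueZ; first by apply: saB; exact: saX_com.
apply: valueD; first by apply: value_sqr => //; exact: valueD.
by apply: valueN; apply: value_sqr => //; apply: valueD => //; exact: valueN.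
Qed.

Lemma preord_real_character : exists v : D -> R,
  [/\ forall r, v (rsc r) = r,
      forall x y, sa x -> sa y -> v (x + y) = v x + v y,
      forall x y, sa x -> sa y -> v (x * y) = v x * v y &
      forall x, Q x -> 0 <= v x].
Proof.
pose v x := xget 0 [set r | value x r].
have vP x : sa x -> value x (v x).
  by move=> /value_ex[r vr]; rewrite /v; case: xgetP => // /(_ r).
exists v; split.
- by move=> r; apply: value_uniq (vP _ (sa_rsc _ _)) (value_rsc _).
- by move=> x y sx sy; apply: value_uniq (vP _ (saD sx sy)) (valueD (vP _ sx) (vP _ sy)).
- move=> x y sx sy.
  by apply: value_uniq (vP _ (saM_com sx sy)) (valueM sx sy (vP _ sx) (vP _ sy)).
- move=> x Qx; have [v1 _] := vP _ (preord_sa pQ Qx).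
  rewrite leNgt; apply/negP => v0; apply: (@Q_neg (v x / 2)); first lra.
  rewrite -(subrK x (rsc _)); apply: QD => //; apply: v1; lra.
Qed.

End Maximal.

End Preordering.

Section Parts.
Variables (R : realType) (A : cstarAlgType R).
Implicit Types x y p q : A.
Local Notation rsc := (rsc A).

Definition repart x : A := rsc 2^-1 * (x + star x).
Definition impart x : A := (- 'i / 2) *: (x - star x).

Lemma sa_repart x : sa (repart x).
Proof. by apply: sa_rscM; rewrite /sa starD starK addrC. Qed.

Lemma sa_impart x : sa (impart x).
Proof.
rewrite /sa /impart starZ starB starK -opprB scalerN -scaleNr; congr (_ *: _).
by apply/eqP; rewrite eq_complex /=; apply/andP; split; apply/eqP; field.
Qed.

Lemma repart_impart x : x = repart x + 'i *: impart x.
Proof.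
rewrite /impart scalerA /repart rscE.
have -> : 'i * (- 'i / 2) = (2^-1)%:C :> R[i].
  by rewrite mulrA mulrN -expr2 sqr_i opprK mul1r rmorphV ?unitfE ?pnatr_eq0 // rmorph_nat.
rewrite -scalerDr addrACA subrr addr0 scalerDr -scalerDl.
have -> : (2^-1)%:C + (2^-1)%:C = 1 :> R[i].
  by apply/eqP; rewrite eq_complex /= addr0 eqxx andbT; apply/eqP; field.
by rewrite scale1r.
Qed.

Lemma star_parts x : star x = repart x - 'i *: impart x.
Proof.
rewrite {1}(repart_impart x) starD starZ sa_repart sa_impart -scaleNr.
by congr (_ + _ *: _); apply/eqP; rewrite eq_complex /= oppr0 !eqxx.
Qed.

Lemma parts_unique x p q : sa p -> sa q -> x = p + 'i *: q ->
  repart x = p /\ impart x = q.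
Proof.
move=> sp sq ->; have si : star (p + 'i *: q) = p - 'i *: q.
  rewrite starD starZ sp sq -scaleNr.
  by congr (_ + _ *: _); apply/eqP; rewrite eq_complex /= oppr0 !eqxx.
have half y : (2^-1)%:C *: (y + y) = y.
  rewrite scalerDr -scalerDl.
  have -> : (2^-1)%:C + (2^-1)%:C = 1 :> R[i].
    by apply/eqP; rewrite eq_complex /= addr0 eqxx andbT; apply/eqP; field.
  by rewrite scale1r.
split; first by rewrite /repart si rscE addrACA subrr addr0 half.
rewrite /impart si opprB addrC addrA subrK -scalerDr scalerA.
suff -> : - 'i / 2 * 'i = (2^-1)%:C :> R[i] by exact: half.
rewrite mulrAC mulNr -expr2 sqr_i opprK mul1r.
by apply/eqP; rewrite eq_complex /=; apply/andP; split; apply/eqP; field.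
Qed.

Lemma context_repart (S : context A) x : context_set S x -> context_set S (repart x).
Proof.
move=> Sx; apply: contextM; first exact: context_rsc.
by apply: contextD => //; exact: context_star.
Qed.

Lemma context_impart (S : context A) x : context_set S x -> context_set S (impart x).
Proof.
by move=> Sx; apply: contextZ; apply: contextB => //; exact: context_star.
Qed.

End Parts.

Section MakeCharacter.
Variables (R : realType) (D : comCstarAlgType R) (f : D -> R[i]^o).
Hypotheses (f_linear : linear f) (f_monoid : monoid_morphism f).
Definition make_character : spectrum D := HB.pack_for {lrmorphism D -> R[i]^o} f
  (GRing.isLinear.Build R[i] D R[i]^o *:%R f f_linear)
  (GRing.isMonoidMorphism.Build D R[i]^o f f_monoid).
End MakeCharacter.

Lemma conj_conjc (R : realType) (k : R[i]) : Num.conj k = conjc k.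
Proof. by []. Qed.

Definition ev (R : realType) (D : comCstarAlgType R) (l : spectrum D) (x : D) : R[i] :=
  (l : {lrmorphism D -> R[i]^o}) x.
Arguments ev {R D} l x.

Definition rv (R : realType) (D : comCstarAlgType R) (l : spectrum D) (x : D) : R :=
  complex.Re (ev l x).
Arguments rv {R D} l x.

Section Characters.
Variables (R : realType) (D : comCstarAlgType R).
Implicit Types (x y z a b c p q : D) (r s t e : R) (l : spectrum D).
Local Notation rsc := (rsc D).

Lemma evD l x y : ev l (x + y) = ev l x + ev l y.
Proof. by rewrite /ev rmorphD. Qed.
Lemma evN l x : ev l (- x) = - ev l x.
Proof. by rewrite /ev rmorphN. Qed.
Lemma evB l x y : ev l (x - y) = ev l x - ev l y.
Proof. by rewrite evD evN. Qed.
Lemma evM l x y : ev l (x * y) = ev l x * ev l y.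
Proof. by rewrite /ev rmorphM. Qed.
Lemma ev1 l : ev l 1 = 1.
Proof. by rewrite /ev rmorph1. Qed.
Lemma ev0 l : ev l 0 = 0.
Proof. by rewrite /ev rmorph0. Qed.
Lemma evX l x n : ev l (x ^+ n) = ev l x ^+ n.
Proof. by rewrite /ev rmorphXn. Qed.
Lemma evZ l (k : R[i]) x : ev l (k *: x) = k * ev l x.
Proof. by rewrite /ev linearZ. Qed.
Lemma ev_rsc l r : ev l (rsc r) = r%:C.
Proof. by rewrite evZ ev1 mulr1. Qed.

(* If [ev l x] exceeded the norm of [x], the Neumann series [w] of [z := x / ev l x]
   would satisfy [w = 1 + z * w], and applying [l] would give [0 = 1]. *)
Lemma ev_le_nrm l x : `|ev l x| <= (nrm x)%:C.
Proof.
rewrite normc_def lecR leNgt -ltcR -normc_def; apply/negP.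
move=> lx; set a := ev l x in lx.
have ap : 0 < `|a| by apply: le_lt_trans lx; rewrite lecR nrm_ge0.
have a0 : a != 0 by rewrite -normr_gt0.
pose z := a^-1 *: x; have lz : ev l z = 1 by rewrite evZ mulVf.
have z1 : nrm z < 1.
  by rewrite -ltcR -cnormE cnormZ normfV cnormE mulrC ltr_pdivrMr // mul1r.
pose w := fix w n := if n is n'.+1 then 1 + z * w n' else 0 : D.
have wS n : w n.+1 - w n = z ^+ n.
  elim: n => [|n IH]; first by rewrite /= mulr0 addr0 subr0.
  by rewrite -[w n.+2]/(1 + z * w n.+1) -{2}[w n.+1]/(1 + z * w n) exprS -IH; ring.
have nX n : nrm (z ^+ n) <= nrm z ^+ n.
  elim: n => [|n IH]; first by rewrite !expr0 nrm1.
  by rewrite !exprS; apply: le_trans (nrmM _ _) _; rewrite ler_wpM2l ?nrm_ge0.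
have [|n|v lim] := @geometric_limit _ _ w 1 (nrm z); first by rewrite nrm_ge0.
  by rewrite wS mul1r.
have vE : v = 1 + z * v.
  apply/eqP; rewrite -subr_eq0; apply/eqP/nrm0_eq0/eqP.
  rewrite eq_le nrm_ge0 andbT; apply/ler_addgt0Pl => e e0; rewrite addr0.
  have /lim[N HN] : 0 < e / 2 by rewrite divr_gt0.
  have -> : v - (1 + z * v) = z * (w N - v) - (w N.+1 - v) by rewrite /=; ring.
  apply: le_trans (nrmB _ _) _.
  have H1 := HN N (leqnn _); have H2 := HN N.+1 (leqnSn _).
  have H3 : nrm (z * (w N - v)) <= nrm (w N - v).
    by apply: le_trans (nrmM _ _) _; rewrite ler_piMl ?nrm_ge0 // ltW.
  move: H1 H2 H3; move: (nrm _) => h1; move: (nrm _) => h2; move: (nrm _) => h3; lra.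
have /eqP := congr1 (ev l) vE; rewrite evD ev1 evM lz mul1r.
by rewrite -subr_eq0 opprD addrCA subrr addr0 oppr_eq0 oner_eq0.
Qed.

(** Arens' trick: x + it takes the value a + i(b + t), while its squared norm is at most
    [nrm x ^+ 2 + t ^+ 2]. Hence 2bt is bounded above over all real t, and b = 0. *)
Lemma ev_sa_im l x : sa x -> complex.Im (ev l x) = 0.
Proof.
move=> sx; case E : (ev l x) => [a b] /=.
have bound t : a ^+ 2 + (b + t) ^+ 2 <= nrm x ^+ 2 + t ^+ 2.
  pose y := x + (t%:C * 'i) *: (1 : D).
  have ly : ev l y = a +i* (b + t).
    rewrite evD evZ ev1 mulr1 E; apply/eqP; rewrite eq_complex /=.
    by rewrite mulr0 !mul0r mulr1 subrr !addr0 !eqxx.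
  have yy : star y * y = x ^+ 2 + rsc (t ^+ 2).
    rewrite /y starD starZ star1 sx conj_conjc.
    have -> : conjc (t%:C * 'i) = - (t%:C * 'i) :> R[i].
      apply/eqP; rewrite eq_complex /= !(mulr0, mul0r, mulr1) !addr0. by rewrite subr0 oppr0 !eqxx.
    set k := t%:C * 'i; rewrite scaleNr.
    have -> : (x - k%:A) * (x + k%:A) = x ^+ 2 - (k%:A) ^+ 2 by ring.
    rewrite [k%:A ^+ 2]expr2 -scalerAl mul1r scalerA.
    have -> : k * k = - (t ^+ 2)%:C.
      by rewrite /k mulrACA -!expr2 sqr_i mulrN1 rmorphXn.
    by rewrite scaleNr opprK.
  have := ev_le_nrm l y; rewrite ly normc_def lecR /= => H.
  have := nrm_starM y; rewrite yy => yE.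
  have {}H : a ^+ 2 + (b + t) ^+ 2 <= nrm y ^+ 2.
    rewrite -[X in X <= _]sqr_sqrtr ?addr_ge0 ?sqr_ge0 //.
    by rewrite lerXn2r ?nnegrE ?sqrtr_ge0 ?nrm_ge0.
  apply: le_trans H _; rewrite -yE; apply: le_trans (nrmD _ _) _.
  by rewrite nrm_sqr // nrm_rsc ger0_norm ?sqr_ge0.
apply: contrapT => /eqP b0.
(* This t makes the cross term 2bt equal to [nrm x ^+ 2 + 1], just beyond the bound. *)
have := bound ((nrm x ^+ 2 + 1) / (2 * b)).
have -> : (b + (nrm x ^+ 2 + 1) / (2 * b)) ^+ 2 =
  b ^+ 2 + (nrm x ^+ 2 + 1) + ((nrm x ^+ 2 + 1) / (2 * b)) ^+ 2 by field.
by have := sqr_ge0 a; have := sqr_ge0 b; lra.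
Qed.

Lemma ev_sa l x : sa x -> ev l x = (rv l x)%:C.
Proof.
by move=> sx; rewrite /rv; apply/eqP; rewrite eq_complex /= eqxx ev_sa_im //= eqxx.
Qed.

Lemma rvD l x y : rv l (x + y) = rv l x + rv l y.
Proof. by rewrite /rv evD raddfD. Qed.
Lemma rvN l x : rv l (- x) = - rv l x.
Proof. by rewrite /rv evN raddfN. Qed.
Lemma rvB l x y : rv l (x - y) = rv l x - rv l y.
Proof. by rewrite rvD rvN. Qed.
Lemma rv_rsc l r : rv l (rsc r) = r.
Proof. by rewrite /rv ev_rsc. Qed.
Lemma rvM l x y : sa x -> sa y -> rv l (x * y) = rv l x * rv l y.
Proof. by move=> sx sy; rewrite {1}/rv evM !ev_sa // -rmorphM. Qed.
Lemma rvX l x n : sa x -> rv l (x ^+ n) = rv l x ^+ n.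
Proof. by move=> sx; rewrite {1}/rv evX ev_sa // -rmorphXn. Qed.
Lemma rv_rscM l r x : rv l (rsc r * x) = r * rv l x.
Proof.
by rewrite /rv evM ev_rsc; case: (ev l x) => u v /=; rewrite mul0r subr0.
Qed.
Lemma rv_le_nrm l x : sa x -> `|rv l x| <= nrm x.
Proof. by move=> sx; have := ev_le_nrm l x; rewrite ev_sa // normCR lecR. Qed.

Lemma ev_parts l x : ev l x = rv l (repart x) +i* rv l (impart x).
Proof.
rewrite {1}(repart_impart x) evD evZ !ev_sa; [|exact: sa_impart|exact: sa_repart].
by apply/eqP; rewrite eq_complex /= !(mul0r, mul1r, mulr0, subr0, addr0, add0r) !eqxx.
Qed.

Lemma ev_star l x : ev l (star x) = (ev l x)^*%C.
Proof.
rewrite (ev_parts l x) star_parts evB evZ !ev_sa; [|exact: sa_impart|exact: sa_repart].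
apply/eqP; rewrite eq_complex /=.
by rewrite !(mul0r, mul1r, mulr0, subr0, addr0, add0r, oppr0, subrr) !eqxx.
Qed.

End Characters.

Section CharacterExistence.
Variables (R : realType) (D : comCstarAlgType R).
Implicit Types (x y z a b c p q : D) (r s t e : R) (l : spectrum D).
Local Notation rsc := (rsc D).

(* The imaginary unit of [D], hidden behind an existential so that rewriting
   scalar multiplications into products terminates. *)
Let imaginary_unit : exists j : D, [/\ j * j = -1, forall x, ('i : R[i]) *: x = j * x &
  forall (k : R[i]) x, k *: x = (rsc (complex.Re k) + j * rsc (complex.Im k)) * x].
Proof.
exists ('i%:A); have iE x : ('i : R[i]) *: x = 'i%:A * x by rewrite mulr_algl.
split=> //; first by rewrite -scalerAl mul1r scalerA -expr2 sqr_i scaleN1r.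
move=> k x; rewrite mulrDl rscE -mulrA -iE rscE scalerA -scalerDl.
by rewrite -complexE.
Qed.

Lemma character_of_preordering (Q0 : set D) : preordering Q0 ->
  exists l, forall x, Q0 x -> 0 <= rv l x.
Proof.
move=> /maximal_preordering[Q [pQ Q0Q Qmax]].
have [v [vr vD vM vQ]] := preord_real_character pQ Qmax.
pose f z : R[i]^o := v (repart z) +i* v (impart z).
have vZ r x : sa x -> v (rsc r * x) = r * v x.
  by move=> sx; rewrite vM ?vr //; exact: sa_rsc.
have vN x : sa x -> v (- x) = - v x.
  by move=> sx; rewrite -mulN1r -(rmorph1 rsc) -rmorphN vZ // mulN1r.
have fE p q : sa p -> sa q -> f (p + 'i *: q) = v p +i* v q.
  by move=> sp sq; rewrite /f; have [-> ->] := parts_unique sp sq erefl.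
have [j [jE scale_i scale_parts]] := imaginary_unit.
have f_linear : linear f.
  move=> k x y; rewrite {1}(repart_impart x) {1}(repart_impart y).
  rewrite [f x]/f [f y]/f; move: (sa_repart x) (sa_impart x) (sa_repart y) (sa_impart y).
  move: (repart x) (impart x) (repart y) (impart y) => p q p' q' sp sq sp' sq'.
  case: k => r s.
  have -> : (r +i* s) *: (p + 'i *: q) + (p' + 'i *: q') =
     (rsc r * p + rsc (- s) * q + p') + 'i *: (rsc r * q + rsc s * p + q').
    rewrite scale_parts !scale_i /= rmorphN.
    transitivity (rsc r * p + rsc s * q * (j * j) + p' +
      j * (rsc r * q + rsc s * p + q')); last by rewrite jE; ring.
    by ring.
  have sa1 : sa (rsc r * p + rsc (- s) * q) by apply: saD; exact: sa_rscM.
  have sa2 : sa (rsc r * q + rsc s * p) by apply: saD; exact: sa_rscM.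
  rewrite fE; [|exact: saD|exact: saD].
  rewrite !vD ?vZ //; try exact: sa_rscM.
  apply/eqP; rewrite eq_complex /=; apply/andP; split; apply/eqP; ring.
have f_monoid : monoid_morphism f.
  split.
    have := fE 1 0 (@sa1 _ D) (@sa0 _ D); rewrite scaler0 addr0 => ->.
    by rewrite -(rmorph1 rsc) -(rmorph0 rsc) !vr.
  move=> x y; rewrite {1}(repart_impart x) {1}(repart_impart y).
  rewrite [f x]/f [f y]/f; move: (sa_repart x) (sa_impart x) (sa_repart y) (sa_impart y).
  move: (repart x) (impart x) (repart y) (impart y) => p q p' q' sp sq sp' sq'.
  have -> : (p + 'i *: q) * (p' + 'i *: q') =
      (p * p' - q * q') + 'i *: (p * q' + q * p').
    rewrite !scale_i.
    transitivity (p * p' + q * q' * (j * j) + j * (p * q' + q * p')); first by ring.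
    by rewrite jE; ring.
  have spp : sa (p * p') by exact: saM_com.
  have sqq : sa (q * q') by exact: saM_com.
  have spq : sa (p * q') by exact: saM_com.
  have sqp : sa (q * p') by exact: saM_com.
  rewrite fE; [|exact: saB|exact: saD].
  rewrite !vD ?vN ?vM //; last exact: saN.
exists (make_character f_linear f_monoid) => x Qx.
have sx : sa x by apply: (preord_sa pQ); exact: Q0Q.
rewrite /rv /ev /= /f.
have [-> _] := @parts_unique _ _ x x 0 sx (@sa0 _ D) ltac:(by rewrite scaler0 addr0).
by apply: vQ; exact: Q0Q.
Qed.

(* [t0] is the maximum of the spectrum of [x]. If [-1] were in [pos - pos * y] for
   [y := t0 - x], then [q * y = 1 + p] would give [nrm q * y >= 1], hence
   [pos (t0 - 1 / nrm q - x)], contradicting the minimality of [t0]. *)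
Lemma character_max x : sa x -> exists l, forall t, rv l x <= t -> pos (rsc t - x).
Proof.
move=> sx; pose E := [set t | pos (rsc t - x)].
have hE : has_inf E.
  split; first by exists (nrm x); exact: pos_nrm.
  exists (- nrm x) => t Et; rewrite -subr_ge0 opprK leNgt; apply/negP => tx.
  have := posD Et (pos_nrm (saN sx) (lexx _)); rewrite nrmN.
  have -> : rsc t - x + (rsc (nrm x) - - x) = rsc (t + nrm x) by ring.
  move=> [_ /(_ (- (t + nrm x) / 2))] [|c sc].
    by rewrite divr_gt0 // oppr_gt0.
  rewrite -rmorphD /= => cE.
  have := @nrm_sqr_le _ _ (rsc (Num.sqrt (- (t + nrm x) / 2))) c (sa_rsc _ _) sc (mulrC _ _).
  rewrite cE -rmorphXn /= sqr_sqrtr; last by rewrite divr_ge0 // oppr_ge0 ltW.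
  rewrite -rmorphD /= !nrm_rsc.
  have -> : - (t + nrm x) / 2 + (t + nrm x + - (t + nrm x) / 2) = 0 by field.
  rewrite normr0 ger0_norm ?sqrtr_ge0 // sqr_sqrtr; last by rewrite divr_ge0 // oppr_ge0 ltW.
  by move: tx; move: (t + nrm x) => u; lra.
pose t0 := inf E; pose y := rsc t0 - x.
have Eup t t' : E t -> t <= t' -> E t'.
  move=> Et tt'; rewrite /E /=.
  have -> : rsc t' - x = (rsc t - x) + rsc (t' - t) by ring.
  by apply: posD => //; apply: pos_rsc; rewrite subr_ge0.
(* The infimum is attained because [pos] only asks for squares up to every positive error. *)
have Et0 : E t0.
  split=> [|e e0]; first by apply: saB => //; exact: sa_rsc.
  have [t Et tt0] := inf_adherent (divr_gt0 e0 (ltr0n _ 2)) hE.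
  have /(_ (e / 2)) [|c sc cE] := (Eup _ _ Et (ltW tt0)).2; first by rewrite divr_gt0.
  exists c => //; rewrite cE /t0.
  by rewrite [in RHS](_ : e = e / 2 + e / 2); [ring|field].
pose Q0 := [set z | exists p q, [/\ pos p, pos q & z = p - q * y]].
have pos0 : pos (0 : D) by rewrite -(rmorph0 rsc); exact: pos_rsc.
have pos1 : pos (1 : D) by rewrite -(rmorph1 rsc); exact: pos_rsc.
have pQ0 : preordering Q0.
  split.
  - move=> _ [p [q [[sp _] [sq _] ->]]]; apply: saB => //.
    by apply: saM_com => //; case: Et0.
  - by move=> z pz; exists z, 0; rewrite mul0r subr0.
  - move=> _ _ [p [q [Pp Pq ->]]] [p' [q' [Pp' Pq' ->]]].
    by exists (p + p'), (q + q'); split; [exact: posD|exact: posD|ring].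
  - move=> _ _ [p [q [Pp Pq ->]]] [p' [q' [Pp' Pq' ->]]].
    exists (p * p' + y ^+ 2 * (q * q')), (p * q' + q * p'); split; last by ring.
      apply: posD; first exact: posM.
      by apply: posM; [apply: pos_sqr; case: Et0|exact: posM].
    by apply: posD; exact: posM.
  move=> [p [q [Pp Pq E1]]].
  have qy : q * y = 1 + p by rewrite -[1]opprK E1; ring.
  (* The added 1 keeps K invertible. Since [q * y = 1 + p], the element [(p + (K - q) y) / K] is
     [y - 1 / K]. *)
  pose K := nrm q + 1; have K0 : 0 < K by rewrite ltr_wpDl // nrm_ge0.
  have PKq : pos (rsc K - q) by apply: pos_nrm; [case: Pq|rewrite lerDl].
  have : E (t0 - K^-1).
    rewrite /E /=.
    have KK : rsc K^-1 * rsc K = 1 by rewrite -rmorphM mulVf ?rmorph1 // gt_eqF.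
    have -> : rsc (t0 - K^-1) - x = rsc K^-1 * (p + (rsc K - q) * y).
      transitivity (rsc K^-1 * rsc K * y - rsc K^-1); first by rewrite KK /y; ring.
      have -> : p = q * y - 1 by rewrite qy addrC addKr.
      by ring.
    apply: posM; first by apply: pos_rsc; rewrite invr_ge0 ltW.
    by apply: posD => //; exact: posM.
  move=> /(inf_lbound hE.2); rewrite -/t0 lerBrDr gerDl.
  by rewrite leNgt invr_gt0 K0.
have [l lQ0] := character_of_preordering pQ0; exists l => t tx.
apply: Eup Et0 _; apply: le_trans tx.
have /lQ0 : Q0 (- y) by exists 0, 1; rewrite mul1r sub0r.
by rewrite rvN rvB rv_rsc opprB subr_ge0.
Qed.

Lemma spectrum_nonempty : exists l : spectrum D, True.
Proof. by have [l _] := character_max (@sa0 _ D); exists l. Qed.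

(** A character maximizing x and one maximizing -x bound x in the cone from both sides. Together
    with [rv_le_nrm] this makes the Gelfand transform isometric on self-adjoint elements. *)
Lemma nrm_le_characters x t : sa x -> (forall l, `|rv l x| <= t) -> nrm x <= t.
Proof.
move=> sx lt; have [l lx] := character_max sx; have [m mx] := character_max (saN sx).
apply: nrm_le_pos => //.
- by apply: lx; have := lt l; rewrite ler_norml => /andP[].
- have -> : rsc t + x = rsc t - (- x) by rewrite opprK.
  by apply: mx; have := lt m; rewrite ler_norml rvN => /andP[? ?]; lra.
- by apply: le_trans (lt l).
Qed.

Lemma ev_inj x y : (forall l, ev l x = ev l y) -> x = y.
Proof.
move=> xy; apply/eqP; rewrite -subr_eq0; apply/eqP.
have z0 l : ev l (x - y) = 0 by rewrite evB xy subrr.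
have part0 p : sa p -> (forall l, rv l p = 0) -> p = 0.
  move=> sp p0; apply: nrm0_eq0; apply/eqP; rewrite eq_le nrm_ge0 andbT.
  by apply: nrm_le_characters => // l; rewrite p0 normr0.
have r0 : repart (x - y) = 0.
  apply: part0; first exact: sa_repart.
  by move=> l; have := z0 l; rewrite ev_parts => -[].
have i0 : impart (x - y) = 0.
  apply: part0; first exact: sa_impart.
  by move=> l; have := z0 l; rewrite ev_parts => -[].
by rewrite (repart_impart (x - y)) r0 i0 scaler0 addr0.
Qed.

End CharacterExistence.

(** * The Stone-Weierstrass theorem *)

Section SpectrumTopology.
Variables (R : realType) (D : comCstarAlgType R).
Implicit Types (x y z a b c p q : D) (r s t e : R) (l m : spectrum D).
Local Notation rsc := (rsc D).

Lemma spectrum_cvg (F : set_system (spectrum D)) l : Filter F ->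
  (forall x, (fun m => ev m x : R[i]^o) @ F --> (ev l x : R[i]^o)) -> F --> l.
Proof.
rewrite /ev => FF Fl.
pose coe (m : spectrum D) : {ptws D -> R[i]^o} := (m : {lrmorphism D -> R[i]^o}).
have cvg_coe : coe @ F --> coe l.
  apply/cvg_sup => x V [_ [[B Bop <-] Bl BV]].
  have /(Fl x) FB : nbhs (coe l x : R[i]^o) B by apply: open_nbhs_nbhs.
  by apply: (@filterS _ F FF _ _ _ FB) => m Bm; exact: BV.
move=> U [_ [[B Bop <-] Bl BU]].
have /cvg_coe FB : nbhs (coe l) B by apply: open_nbhs_nbhs.
by apply: (@filterS _ F FF _ _ _ FB) => m Bm; exact: BU.
Qed.

Lemma continuous_to_spectrum (X : topologicalType) (h : X -> spectrum D) :
  (forall x, continuous (fun u : X => ev (h u) x : R[i]^o)) -> continuous h.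
Proof. by move=> hx t; apply: spectrum_cvg => x; exact: hx. Qed.

Lemma ev_near l x e : 0 < e -> \forall m \near l, `|ev l x - ev m x| < e%:C.
Proof.
move=> e0; have /cvgrPdist_lt : (fun m => ev m x : R[i]^o) @ l --> (ev l x : R[i]^o).
  rewrite /ev; exact: (@spectrum_eval_continuous R D x l).
by apply; rewrite ltcR.
Qed.

(** Continuity of real functions in epsilon form, ready for [lra], while the topology of the
    spectrum comes from [R[i]]-valued evaluations. *)
Definition near_continuous (X : topologicalType) (f : X -> R) : Prop :=
  forall (u : X) e, 0 < e -> \forall v \near u, `|f u - f v| < e.

Lemma near_continuousB (X : topologicalType) (f g : X -> R) :
  near_continuous f -> near_continuous g -> near_continuous (fun u : X => f u - g u).
Proof.
move=> fc gc u e e0; have e2 : 0 < e / 2 by rewrite divr_gt0.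
apply: filterS2 (fc u _ e2) (gc u _ e2) => v fv gv.
rewrite [X in `|X|](_ : _ = (f u - f v) - (g u - g v)); last by ring.
by apply: le_lt_trans (ler_normB _ _) _; lra.
Qed.

Lemma rv_near_continuous x : sa x -> near_continuous (fun l => rv l x).
Proof.
move=> sx l e e0; apply: filterS (ev_near l x e0) => m.
by rewrite !ev_sa // -rmorphB normCR ltcR.
Qed.

(** The elements whose values along an ultrafilter are eventually above every negative number form a
    preordering; a character that is nonnegative on it is a limit of the ultrafilter. *)
Lemma spectrum_compact : compact [set: spectrum D].
Proof.
rewrite compact_ultra => F UF _.
pose Q0 := [set x | sa x /\ forall e, 0 < e -> F [set l | - e < rv l x]].
have pQ0 : preordering Q0.
  split.
  - by move=> x [].
  - move=> x [sx px]; split=> // e e0.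
    apply: (@filterS _ F _ setT); last exact: filterT.
    move=> l _ /=; have [c sc cE] := px _ (divr_gt0 e0 (ltr0n _ 2)).
    have := congr1 (rv l) cE; rewrite rvX // rvD rv_rsc.
    by have := sqr_ge0 (rv l c); lra.
  - move=> x y [sx Fx] [sy Fy]; split=> [|e e0]; first exact: saD.
    have e2 : 0 < e / 2 by rewrite divr_gt0.
    by apply: filterS2 (Fx _ e2) (Fy _ e2) => l /= ? ?; rewrite rvD; lra.
  - move=> x y [sx Fx] [sy Fy]; split=> [|e e0]; first exact: saM_com.
    pose K := nrm x + nrm y + 1.
    have K1 : 1 <= K by rewrite lerDr addr_ge0 // nrm_ge0.
    pose d := Num.min 1 (e / K / 2).
    have d0 : 0 < d by rewrite lt_min ltr01 !divr_gt0 // (lt_le_trans _ K1).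
    have dK : d * K <= e / 2.
      rewrite -ler_pdivlMr ?(lt_le_trans _ K1) // mulrAC.
      by rewrite /d ge_min lexx orbT.
    apply: filterS2 (Fx _ d0) (Fy _ d0) => l /= lx ly.
    rewrite rvM //; have := rv_le_nrm l sx; have := rv_le_nrm l sy.
    rewrite !ler_norml => /andP[y1 y2] /andP[x1 x2].
    have d1 : d <= 1 by rewrite /d ge_min lexx.
    have X0 := nrm_ge0 x; have Y0 := nrm_ge0 y; rewrite /K in dK.
    have : 0 < (rv l x + d) * (rv l y + d) by rewrite mulr_gt0 //; lra.
    by nra.
  - move=> [_ /(_ 1 ltr01) F0]; have PF := @ultra_proper _ F UF.
    apply: (@filter_not_empty _ F PF); apply: filterS F0 => l /=.
    by rewrite rvN -(rmorph1 rsc) rv_rsc ltxx.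
have [l lQ0] := character_of_preordering pQ0; exists l; split=> //.
(* Otherwise the ultrafilter contains the complement, so [x - (rv l x + e)] lies in [Q0], although
   its value at l is [- e]. *)
have upper x e : sa x -> 0 < e -> F [set m | rv m x < rv l x + e].
  move=> sx e0; have [//|H] := in_ultra_setVsetC [set m | rv m x < rv l x + e] UF.
  have /lQ0 : Q0 (x - rsc (rv l x + e)).
    split=> [|d d0]; first by apply: saB => //; exact: sa_rsc.
    apply: filterS H => m /= /negP; rewrite -leNgt rvB rv_rsc; lra.
  by rewrite rvB rv_rsc; lra.
have close x e : sa x -> 0 < e -> F [set m | `|rv l x - rv m x| < e].
  move=> sx e0; apply: filterS2 (upper x e sx e0) (upper (- x) e (saN sx) e0) => m /=.
  by rewrite !rvN ltr_norml => ? ?; apply/andP; split; lra.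
apply: spectrum_cvg => x; apply/cvgrPdist_lt => e e0.
have er : 0 < complex.Re e / 2 by move: e0; rewrite ltcE /= => /andP[_ ?]; rewrite divr_gt0.
apply: filterS2 (close _ _ (sa_repart x) er) (close _ _ (sa_impart x) er) => m /=.
rewrite !ev_parts => H1 H2.
rewrite -(RRe_real (gtr0_real e0)) normc_def ltcR /=.
set u := rv l _ - rv m _ in H1 *; set v := rv l _ - rv m _ in H2 *.
have H : u ^+ 2 + v ^+ 2 < complex.Re e ^+ 2.
  rewrite -(real_normK (num_real u)) -(real_normK (num_real v)).
  by have := normr_ge0 u; have := normr_ge0 v; nra.
have er' : 0 < complex.Re e by lra.
by rewrite -[ltRHS](ger0_norm (ltW er')) -sqrtr_sqr ltr_sqrt // exprn_gt0.
Qed.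

(** Closure under maxima directs the family, so compactness turns a choice of g at each point into a
    single g. *)
Lemma exists_uniform_upper (I : set (spectrum D -> R)) (f : spectrum D -> R) :
  near_continuous f -> (forall g, I g -> near_continuous g) ->
  (forall g h, I g -> I h -> I (fun l => Num.max (g l) (h l))) ->
  (forall l, exists2 g, I g & f l < g l) ->
  exists2 g, I g & forall l, f l < g l.
Proof.
move=> fc Ic Imax If.
have [l0 _] := spectrum_nonempty D; have [g0 Ig0 _] := If l0.
(* The filter of sufficiently large members of I; near-covering compactness then replaces finite
   subcovers. *)
pose F := filter_from I (fun g => [set h | I h /\ forall l, g l <= h l]).
have FF : Filter F.
  apply: filter_from_filter; first by exists g0.
  move=> g h Ig Ih; exists (fun l => Num.max (g l) (h l)); first exact: Imax.
  move=> k [Ik km]; split; split=> // l; apply: le_trans (km l).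
    by rewrite le_max lexx.
  by rewrite le_max lexx orbT.
have /compact_near_coveringP := spectrum_compact.
move=> /(_ _ F (fun g l => f l < g l) FF) [l _|g Ig gF].
  have [g Ig fg] := If l.
  have d0 : 0 < (g l - f l) / 2 by rewrite divr_gt0 // subr_gt0.
  exists ([set m | f m < g m], [set h | I h /\ forall l, g l <= h l]).
    split=> /=; last by exists g.
    have := near_continuousB (Ic _ Ig) fc l d0.
    by apply: filterS => m /=; rewrite ltr_norml => /andP[? ?]; lra.
  by move=> [m h] /= [fgm [Ih gh]]; apply: lt_le_trans (gh m).
have gg : [set h | I h /\ forall l, g l <= h l] g by split=> // l; exact: lexx.
exists g => // l; by have := gF g gg; apply.
Qed.

End SpectrumTopology.

Section StoneWeierstrass.
Variables (R : realType) (D : comCstarAlgType R) (S : context D).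
Implicit Types (x y z a b c p q : D) (r s t e : R) (l m : spectrum D).
Local Notation rsc := (rsc D).

Lemma sa_closed (A : cstarAlgType R) (x : A) :
  (forall e, 0 < e -> exists2 y, sa y & nrm (x - y) < e) -> sa x.
Proof.
move=> clx; apply/eqP; rewrite -subr_eq0; apply/eqP/nrm0_eq0/eqP.
rewrite eq_le nrm_ge0 andbT; apply/ler_addgt0Pl => e e0; rewrite addr0.
have [|y sy xy] := clx (e / 2); first by rewrite divr_gt0.
have -> : star x - x = star (x - y) - (x - y).
  by rewrite starB sy opprB addrA subrK.
by apply: le_trans (nrmB _ _) _; rewrite nrm_star; lra.
Qed.

Definition approximable (f : spectrum D -> R) := forall e, 0 < e ->
  exists2 a, context_set S a /\ sa a & forall l, `|rv l a - f l| < e.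

Lemma approximable_rv a : context_set S a -> sa a -> approximable (fun l => rv l a).
Proof. by move=> Sa sa_a e e0; exists a => // l; rewrite subrr normr0. Qed.

Lemma approximableD f g : approximable f -> approximable g ->
  approximable (fun l => f l + g l).
Proof.
move=> Lf Lg e e0; have e2 : 0 < e / 2 by rewrite divr_gt0.
have [a [Sa sa_a] fa] := Lf _ e2; have [b [Sb sa_b] gb] := Lg _ e2.
exists (a + b); first by split; [exact: contextD|exact: saD].
move=> l; rewrite rvD opprD addrACA.
by apply: le_lt_trans (ler_normD _ _) _; have := fa l; have := gb l; lra.
Qed.

Lemma approximableZ r f : approximable f -> approximable (fun l => r * f l).
Proof.
move=> Lf e e0; have r1 : 0 < `|r| + 1 by rewrite ltr_wpDl.
have [a [Sa sa_a] fa] := Lf _ (divr_gt0 e0 r1).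
exists (rsc r * a).
  by split; [apply: contextM => //; exact: context_rsc|exact: sa_rscM].
move=> l; rewrite rv_rscM -mulrBr normrM.
have := fa l; rewrite ltr_pdivlMr //; have := normr_ge0 (rv l a - f l).
by move: (`|_ - _|) => u u0; rewrite mulrDr mulr1; have := normr_ge0 r; nra.
Qed.

(** The root b of [a ^+ 2 + (e / 2) ^+ 2] satisfies [|a| < b <= |a| + e / 2] at each character. The
    norm condition on b selects the positive root. *)
Lemma approximable_abs f : approximable f -> approximable (fun l => `|f l|).
Proof.
move=> Lf e e0; have e2 : 0 < e / 2 by rewrite divr_gt0.
have [a [Sa sa_a] fa] := Lf _ e2.
have e4 : 0 < (e / 2) ^+ 2 by rewrite exprn_gt0.
have [b [Sb sb [t bt] bE]] := sqrt_sum_squares Sa sa_a (context0 S) (@sa0 _ D) e4.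
exists b => // l.
have b0 : 0 < rv l b.
  have := rv_le_nrm l (saB (sa_rsc D t) sb); rewrite rvB rv_rsc ler_norml => /andP[].
  by have := bt; lra.
have := congr1 (rv l) bE; rewrite expr0n addr0 rvD rv_rsc !rvX //.
rewrite -(real_normK (num_real (rv l a))) => E.
have := fa l; have := ler_dist_dist (rv l a) (f l).
have := normr_ge0 (rv l a); move: E; move: (`|rv l a|) => u E u0 H1 H2.
have ub : u < rv l b by rewrite ltNge; apply/negP => ?; nra.
have bu : rv l b <= u + e / 2.
  by rewrite leNgt; apply/negP => ?; nra.
move: (le_lt_trans H1 H2); rewrite !ltr_norml => /andP[? ?].
by apply/andP; split; lra.
Qed.

Lemma approximable_max f g : approximable f -> approximable g ->
  approximable (fun l => Num.max (f l) (g l)).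
Proof.
move=> Lf Lg; have LB := approximableD Lf (approximableZ (-1) Lg).
have := approximableZ 2^-1 (approximableD (approximableD Lf Lg) (approximable_abs LB)).
congr approximable; apply/funext => l; rewrite mulN1r maxr_absE mulrC //.
Qed.

Lemma approximable_continuous f : approximable f -> near_continuous f.
Proof.
move=> Lf l e e0; have e3 : 0 < e / 3 by rewrite divr_gt0.
have [a [Sa sa_a] fa] := Lf _ e3.
apply: filterS (rv_near_continuous sa_a l e3) => m; have := fa l; have := fa m.
by rewrite !ltr_norml => /andP[? ?] /andP[? ?] /andP[? ?]; apply/andP; split; lra.
Qed.

(** Characters compute the norm, so uniform approximants are Cauchy in norm, and the limit stays in
    the closed set S. *)
Lemma approximable_exact f : approximable f ->
  exists a, [/\ context_set S a, sa a & forall l, rv l a = f l].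
Proof.
move=> Lf.
have d0 n : 0 < (n.+1%:R^-1 : R) by rewrite invr_gt0.
have /choice[u uP] n : exists a, [/\ context_set S a, sa a &
    forall l, `|rv l a - f l| < n.+1%:R^-1].
  by have [a [Sa sa_a] fa] := Lf _ (d0 n); exists a.
have small e : 0 < e -> exists N, forall n, (N <= n)%N -> (n.+1%:R^-1 : R) < e.
  move=> e0; exists (Num.bound e^-1) => n Nn.
  rewrite invf_plt ?posrE //; apply: lt_le_trans (archi_boundP _) _.
    by rewrite invr_ge0 ltW.
  by rewrite ler_nat (leq_trans Nn).
have [e e0|a lim] := @nrm_complete _ _ u.
  have [|N HN] := small (e / 2); first by rewrite divr_gt0.
  exists N => m n Nm Nn; apply: (@le_lt_trans _ _ (m.+1%:R^-1 + n.+1%:R^-1)).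
    have [_ sm fm] := uP m; have [_ sn fn] := uP n.
    apply: nrm_le_characters; first exact: saB.
    move=> l; rewrite rvB; apply: le_trans (ler_distD (f l) _ _) _.
    by apply: lerD; [exact: ltW|rewrite distrC; exact: ltW].
  by rewrite [e]splitr; apply: ltrD; exact: HN.
have sa_a : sa a.
  apply: sa_closed => e /lim[N HN]; exists (u N); first by case: (uP N).
  by rewrite nrmBC HN.
exists a; split=> //.
  have /closed_nrmP := @context_closed _ _ S; apply => e /lim [N HN].
  by exists (u N); [case: (uP N)|rewrite nrmBC HN].
move=> l; apply/eqP; rewrite -subr_eq0 -normr_eq0 eq_le normr_ge0 andbT.
apply/ler_addgt0Pl => e e0; rewrite addr0.
have [|N HN] := small (e / 2); first by rewrite divr_gt0.
have [|N' HN'] := lim (e / 2); first by rewrite divr_gt0.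
pose n := maxn N N'; have [_ sn fn] := uP n.
have := HN _ (leq_maxl N N'); have := HN' _ (leq_maxr N N').
rewrite -/n => H2 /(lt_trans (fn l)) H1.
have := rv_le_nrm l (saB sn sa_a); rewrite rvB => H3.
have -> : rv l a - f l = (rv l (u n) - f l) - (rv l (u n) - rv l a) by ring.
apply: le_trans (ler_normB _ _) _; clear -H1 H2 H3.
by rewrite [e]splitr lerD // ltW // (le_lt_trans H3).
Qed.

Theorem stone_weierstrass (f : spectrum D -> R) : near_continuous f ->
  (forall l m, exists a, [/\ context_set S a, sa a, rv l a = f l & rv m a = f m]) ->
  exists a, [/\ context_set S a, sa a & forall l, rv l a = f l].
Proof.
move=> fc f2; apply: approximable_exact => e e0.
have e2 : 0 < e / 2 by rewrite divr_gt0.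
have constc r : near_continuous (fun _ : spectrum D => r).
  move=> l d d0; apply: filterS (rv_near_continuous (sa_rsc D r) l d0) => m.
  by rewrite !rv_rsc.
have fec : near_continuous (fun l => f l - e / 2) by exact: near_continuousB.
have step1 l : exists g, [/\ approximable g, g l < f l + e / 2 &
    forall m, f m - e / 2 < g m].
  pose I := [set g | approximable g /\ g l < f l + e / 2].
  have [||||g [Lg gl] gm] := @exists_uniform_upper _ _ I (fun l => f l - e / 2).
  - exact: fec.
  - by move=> g [/approximable_continuous].
  - move=> g h [Lg gl] [Lh hl]; split; first exact: approximable_max.
    by rewrite gt_max gl hl.
  - move=> m; have [a [Sa sa_a la ma]] := f2 l m; exists (fun l => rv l a).
      by split; [exact: approximable_rv|rewrite la ltrDl].
    by rewrite ma gtrDl oppr_lt0.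
  - by exists g.
(* The minimum over l is taken as a maximum of negated functions, so that [exists_uniform_upper]
   serves a second time. *)
pose I := [set h | approximable h /\ forall m, h m < e / 2 - f m].
have [||||h [Lh hm] hl] := @exists_uniform_upper _ _ I (fun l => - (e / 2) - f l).
- by apply: near_continuousB.
- by move=> g [/approximable_continuous].
- move=> g h [Lg gl] [Lh hl]; split=> [|m]; first exact: approximable_max.
  by rewrite gt_max gl hl.
- move=> l; have [g [Lg gl gm]] := step1 l; exists (fun l => -1 * g l).
    by split=> [|m]; [exact: approximableZ|have := gm m; lra].
  by lra.
have [a [Sa sa_a] ah] := Lh _ e2; exists (- a).
  by split; [exact: contextN|exact: saN].
move=> l; rewrite rvN; have := ah l; have := hl l; have := hm l.
by rewrite !ltr_norml => ? ? /andP[? ?]; apply/andP; split; lra.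
Qed.

End StoneWeierstrass.

(** * Order isomorphisms in the commutative case *)

Section ContextLe.
Variables (R : realType) (A : cstarAlgType R).
Implicit Types C D : context A.

Lemma context_leP C D : reflect (forall x, context_set C x -> context_set D x) (C <= D)%O.
Proof. exact: asboolP. Qed.

Lemma contextP C D : (forall x, context_set C x <-> context_set D x) -> C = D.
Proof.
move=> CD; apply: context_eq; apply/seteqP.
by split=> x; [move/(CD x).1|move/(CD x).2].
Qed.

Section Meet.
Variables C D : context A.
Definition meet_set : set A := context_set C `&` context_set D.
Fact meet1 : meet_set 1.
Proof. by split; exact: context1. Qed.
Fact meetL (a : R[i]) x y : meet_set x -> meet_set y -> meet_set (a *: x + y).
Proof. by move=> [? ?] [? ?]; split; exact: contextL. Qed.
Fact meetM x y : meet_set x -> meet_set y -> meet_set (x * y).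
Proof. by move=> [? ?] [? ?]; split; exact: contextM. Qed.
Fact meet_star x : meet_set x -> meet_set (star x).
Proof. by move=> [? ?]; split; exact: context_star. Qed.
Fact meet_comm x y : meet_set x -> meet_set y -> x * y = y * x.
Proof. by move=> [? ?] [? ?]; exact: (@context_comm _ _ C). Qed.
Fact meet_closed : closed (meet_set : set (normed_space A)).
Proof. by apply: closedI; exact: context_closed. Qed.
Definition context_meet : context A :=
  Context meet1 meetL meetM meet_star meet_comm meet_closed.
End Meet.

Lemma context_meet_lel C D : (context_meet C D <= C)%O.
Proof. by apply/context_leP => x []. Qed.
Lemma context_meet_ler C D : (context_meet C D <= D)%O.
Proof. by apply/context_leP => x []. Qed.

End ContextLe.

Lemma injective_surjective_bijective (S T : Type) (f : S -> T) :
  injective f -> (forall y, exists x, f x = y) -> bijective f.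
Proof. by move=> f_inj /choice[h hf]; exists h => // x; apply: f_inj. Qed.

Lemma order_iso_inverse d d' (P : porderType d) (Q : porderType d') (g : order_iso P Q) :
  exists h : order_iso Q P, cancel g h /\ cancel h g.
Proof.
have [h gh hg] := oiso_bij g.
have h_mono : {mono h : x y / (x <= y)%O} by move=> x y; rewrite -(oiso_mono g) !hg.
have h_bij : bijective h by exists g.
by exists (OrderIso h_bij h_mono).
Qed.

Section Coatoms.
Variables (R : realType) (D : comCstarAlgType R).
Implicit Types (x y z u s : D) (r : R) (l m n a b c d e : spectrum D) (S : context D).
Local Notation rsc := (rsc D).

Lemma spectrum_ev_eq l m : (forall x, ev l x = ev m x) -> l = m.
Proof. by move=> lm; apply: spectrum_eq => x; have := lm x; rewrite /ev. Qed.

Section ConstOn.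
Variable F : set (spectrum D).

Definition const_set : set D := [set x | forall l m, F l -> F m -> ev l x = ev m x].

Fact const1 : const_set 1.
Proof. by move=> l m _ _; rewrite !ev1. Qed.
Fact constL (a : R[i]) x y : const_set x -> const_set y -> const_set (a *: x + y).
Proof. by move=> Sx Sy l m Fl Fm; rewrite !evD !evZ (Sx l m) // (Sy l m). Qed.
Fact constM x y : const_set x -> const_set y -> const_set (x * y).
Proof. by move=> Sx Sy l m Fl Fm; rewrite !evM (Sx l m) // (Sy l m). Qed.
Fact const_star x : const_set x -> const_set (star x).
Proof. by move=> Sx l m Fl Fm; rewrite !ev_star (Sx l m). Qed.
Fact const_closed : closed (const_set : set (normed_space D)).
Proof.
apply/closed_nrmP => x clx l m Fl Fm; apply/eqP; rewrite -subr_eq0 -normr_eq0.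
rewrite normc_def; set t := Num.sqrt _; have -> : t = 0; last by [].
apply/eqP; rewrite eq_le sqrtr_ge0 andbT; apply/ler_addgt0Pl => e e0; rewrite addr0.
rewrite -lecR -normc_def.
have [|y Sy xy] := clx (e / 2); first by rewrite divr_gt0.
have -> : ev l x - ev m x = ev l (x - y) - ev m (x - y).
  by rewrite !evB (Sy l m Fl Fm); ring.
apply: le_trans (ler_normB _ _) _.
apply: le_trans (lerD (ev_le_nrm _ _) (ev_le_nrm _ _)) _.
by rewrite -rmorphD lecR /= [e]splitr lerD // ltW.
Qed.

Definition const_on : context D := Context const1 constL constM const_star
  (fun x y _ _ => mulrC x y) const_closed.

End ConstOn.

(** For [l = m] this is the whole algebra, which is why genuine coatoms always come with
    [l != m]. *)
Definition coatom l m : context D := const_on [set l; m].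

Lemma coatomP l m x : context_set (coatom l m) x <-> ev l x = ev m x.
Proof.
split=> [H|lm k k' [->|->] [->|->]] //.
by apply: H; [left|right].
Qed.

Lemma coatomC l m : coatom l m = coatom m l.
Proof. by apply: contextP => x; rewrite !coatomP. Qed.

Lemma coatom_diag S l : (S <= coatom l l)%O.
Proof. by apply/context_leP => x _; apply/coatomP. Qed.

Lemma character_separation l m : l != m -> exists2 u, ev l u = 1 & ev m u = 0.
Proof.
move=> lm; have [x xlm] : exists x, ev l x != ev m x.
  apply: contrapT => H; move/eqP: lm; apply; apply: spectrum_ev_eq => x.
  by apply: contrapT => /eqP xlm; apply: H; exists x.
have d0 : ev l x - ev m x != 0 by rewrite subr_eq0.
exists ((ev l x - ev m x)^-1 *: (x - (ev m x)%:A)).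
  by rewrite evZ evB evZ ev1 mulr1 mulVf.
by rewrite evZ evB evZ ev1 mulr1 subrr mulr0.
Qed.

Lemma character_interpolation l (s : seq (spectrum D)) : l \notin s ->
  exists2 u, ev l u = 1 & forall m, m \in s -> ev m u = 0.
Proof.
elim: s => [_|m s IH]; first by exists 1; rewrite ?ev1.
rewrite inE negb_or => /andP[/character_separation[e le me] /IH[e' le' se']].
exists (e * e') => [|k]; first by rewrite evM le le' mulr1.
by rewrite inE evM => /predU1P[->|/se' ->]; rewrite ?me ?mul0r ?mulr0.
Qed.

Lemma coatom_neq_full l m : l != m -> exists x, ~ context_set (coatom l m) x.
Proof.
move=> /character_separation[x lx mx]; exists x; rewrite coatomP lx mx.
by apply/eqP; rewrite oner_eq0.
Qed.

(** A character outside [{l, m}] can be isolated from l, m and its partner by an element vanishing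
    at all three; that element is in the smaller coatom and not in the larger one. *)
Lemma coatom_le l m l' m' : (coatom l m <= coatom l' m')%O -> l' != m' ->
  (l' = l /\ m' = m) \/ (l' = m /\ m' = l).
Proof.
move=> le_c lm'.
have mem a b : (coatom l m <= coatom a b)%O -> a != b -> a \in [:: l; m].
  move=> /context_leP le_ab ab; apply/negPn/negP => alm.
  have [|e ae ze] := @character_interpolation a [:: b; l; m].
    by rewrite inE negb_or ab.
  have /le_ab/coatomP : context_set (coatom l m) e.
    by apply/coatomP; rewrite !ze // !inE eqxx !orbT.
  by rewrite ae ze ?inE ?eqxx // => /eqP; rewrite oner_eq0.
have := mem _ _ le_c lm'; have := mem m' l'.
rewrite [coatom m' l']coatomC eq_sym => /(_ le_c lm').
rewrite !inE => /orP[]/eqP mE /orP[]/eqP lE; [|by right|by left|].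
- by rewrite lE mE eqxx in lm'.
- by rewrite lE mE eqxx in lm'.
Qed.

(** The coatom is the kernel of the single functional [ev l - ev m], so one element outside it
    already generates everything linearly. *)
Lemma coatom_maximal l m S : (coatom l m <= S)%O -> ~ (S <= coatom l m)%O ->
  S = full_context D.
Proof.
move=> /context_leP cS nSc; apply: contextP => x; split=> // _.
have [s [Ss slm]] : exists s : D, context_set S s /\ ev l s != ev m s.
  apply: contrapT => H; apply: nSc; apply/context_leP => s Ss; apply/coatomP.
  by apply: contrapT => /eqP ?; apply: H; exists s.
have d0 : ev l s - ev m s != 0 by rewrite subr_eq0.
pose k := (ev l x - ev m x) / (ev l s - ev m s).
rewrite -(subrK (k *: s) x); apply: contextD; last exact: contextZ.
apply: cS; apply/coatomP; rewrite !evB !evZ; apply/eqP; rewrite -subr_eq0; apply/eqP.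
have -> : ev l x - k * ev l s - (ev m x - k * ev m s) =
  (ev l x - ev m x) - k * (ev l s - ev m s) by ring.
by rewrite /k divfK ?subrr.
Qed.

(** For the two-point condition of [stone_weierstrass], a constant serves when S does not separate l
    and m, and an affine function of a separating self-adjoint element when it does. *)
Lemma gelfand_context S (f : spectrum D -> R) : near_continuous f ->
  (forall l m, (S <= coatom l m)%O -> f l = f m) ->
  exists x, [/\ context_set S x, sa x & forall l, rv l x = f l].
Proof.
move=> fc fS; apply: stone_weierstrass => // l m.
have [/fS flm|nS] := pselect (S <= coatom l m)%O.
  exists (rsc (f l)); rewrite !rv_rsc flm.
  by split=> //; [exact: context_rsc|exact: sa_rsc].
have [s [Ss ss slm]] : exists s, [/\ context_set S s, sa s & rv l s != rv m s].
  apply: contrapT => H; apply: nS; apply/context_leP => s Ss; apply/coatomP.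
  have Sr := context_repart Ss; have Si := context_impart Ss.
  have rE : rv l (repart s) = rv m (repart s).
    by apply: contrapT => /eqP ?; apply: H; exists (repart s); split=> //; exact: sa_repart.
  have iE : rv l (impart s) = rv m (impart s).
    by apply: contrapT => /eqP ?; apply: H; exists (impart s); split=> //; exact: sa_impart.
  by rewrite !ev_parts rE iE.
have d0 : rv l s - rv m s != 0 by rewrite subr_eq0.
pose k := (f l - f m) / (rv l s - rv m s).
exists (rsc (f l - k * rv l s) + rsc k * s).
have -> : f l - k * rv l s = f m - k * rv m s.
  apply/eqP; rewrite -subr_eq0; apply/eqP.
  have -> : f l - k * rv l s - (f m - k * rv m s) =
    (f l - f m) - k * (rv l s - rv m s) by ring.
  by rewrite /k divfK ?subrr.
split.
- by apply: contextD; [exact: context_rsc|apply: contextM => //; exact: context_rsc].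
- by apply: saD; [exact: sa_rsc|exact: sa_rscM].
- rewrite rvD rv_rsc rv_rscM.
  have -> : f m - k * rv m s = f l - k * rv l s.
    apply/eqP; rewrite -subr_eq0; apply/eqP.
    have -> : f m - k * rv m s - (f l - k * rv l s) =
      k * (rv l s - rv m s) - (f l - f m) by ring.
    by rewrite /k divfK ?subrr.
  by rewrite subrK.
- by rewrite rvD rv_rsc rv_rscM subrK.
Qed.

Lemma mem_context S x :
  (forall l m, (S <= coatom l m)%O -> ev l x = ev m x) -> context_set S x.
Proof.
move=> xS.
have part p : sa p -> (forall l m, (S <= coatom l m)%O -> rv l p = rv m p) -> context_set S p.
  move=> sp pS; have [a [Sa sa_a aE]] := gelfand_context (rv_near_continuous sp) pS.
  suff -> : p = a by [].
  by apply: ev_inj => l; rewrite !ev_sa // aE.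
rewrite (repart_impart x); apply: contextD; last apply: contextZ.
  apply: part; first exact: sa_repart.
  by move=> l m /xS; rewrite !ev_parts => -[].
apply: part; first exact: sa_impart.
by move=> l m /xS; rewrite !ev_parts => -[].
Qed.

Lemma full_le_coatom l m : (full_context D <= coatom l m)%O -> l = m.
Proof.
move=> /context_leP H; apply/eqP/negPn/negP => /coatom_neq_full[x]; apply.
exact: H.
Qed.

(* Order-theoretically, [triangle c1 c2 c3] says that the meet of [c1] and [c2] is
   below [c3]; it detects when three coatoms are the sides of a triangle. *)
Definition triangle (c1 c2 c3 : context D) :=
  forall S, (S <= c1)%O -> (S <= c2)%O -> (S <= c3)%O.

Lemma triangleP a b c d e (f : spectrum D) x : triangle (coatom a b) (coatom c d) (coatom e f) ->
  ev a x = ev b x -> ev c x = ev d x -> ev e x = ev f x.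
Proof.
move=> /(_ _ (context_meet_lel _ _) (context_meet_ler _ _))/context_leP tri xab xcd.
by apply/coatomP/tri; split; apply/coatomP.
Qed.

Lemma triangle_mem a b c d e (f : spectrum D) : e != f ->
  triangle (coatom a b) (coatom c d) (coatom e f) -> e \in [:: a; b; c; d].
Proof.
move=> ef tri; apply/negPn/negP => eabcd.
have [|x ex zx] := @character_interpolation e [:: f; a; b; c; d].
  by rewrite inE negb_or ef.
have := triangleP (x := x) tri; rewrite ex !zx ?inE ?eqxx ?orbT // => /(_ erefl erefl).
by move/eqP; rewrite oner_eq0.
Qed.

(** An element equal to 1 on [{a, b}] and to 0 on [{c, d}] lies in both coatoms, so e and f must
    belong to the same pair. *)
Lemma triangle_disjoint a b c d e (f : spectrum D) :
  a != c -> a != d -> b != c -> b != d ->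
  triangle (coatom a b) (coatom c d) (coatom e f) -> e != f ->
  coatom e f = coatom a b \/ coatom e f = coatom c d.
Proof.
move=> ac ad bc bd tri ef; have emem := triangle_mem ef tri.
have fmem : f \in [:: a; b; c; d].
  by rewrite eq_sym in ef; apply: (triangle_mem ef); rewrite [coatom f e]coatomC.
have [x [xa xb xc xd]] : exists x, [/\ ev a x = 1, ev b x = 1, ev c x = 0 & ev d x = 0].
  have sep k : k != c -> k != d -> exists y, [/\ ev k y = 1, ev c y = 0 & ev d y = 0].
    move=> /character_separation[y ky cy] /character_separation[z kz dz].
    by exists (y * z); rewrite !evM ky kz cy dz mul0r mulr0 mulr1.
  have [y [ya yc yd]] := sep _ ac ad; have [z [zb zc zd]] := sep _ bc bd.
  exists (1 - (1 - y) * (1 - z)).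
  by rewrite !evB !ev1 !evM !evB !ev1 ya yc yd zb zc zd; split; ring.
have efx : ev e x = ev f x by apply: triangleP tri _ _; rewrite ?xa ?xb ?xc ?xd.
have n10 : (1 : R[i]) <> 0 by apply/eqP; rewrite oner_eq0.
move: emem fmem ef efx.
rewrite !inE => /or4P[]/eqP -> /or4P[]/eqP -> ef; rewrite ?xa ?xb ?xc ?xd => efx;
  first [by rewrite eqxx in ef | by left | by right | by left; rewrite coatomC
        | by right; rewrite coatomC | by case: (n10 efx) | by case: (n10 (esym efx))].
Qed.

End Coatoms.

(** * Recovering a map of characters from its action on pairs *)

Section PairMap.
Variables (R : realType) (D E : comCstarAlgType R).
Variable g : order_iso (context D) (context E).
Implicit Types (l m n k : spectrum D) (a b c d e p q : spectrum E).

Lemma coatom_eq (F : comCstarAlgType R) (l m l' m' : spectrum F) :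
  coatom l m = coatom l' m' -> l' != m' -> (l' = l /\ m' = m) \/ (l' = m /\ m' = l).
Proof. by move=> E1; apply: coatom_le; rewrite E1. Qed.

Let g_inj := bij_inj (oiso_bij g).

(** The image is a proper context, so it lies below some coatom. If it were strictly below, pulling
    back would give a context strictly above [coatom l m], hence the full one, and the coatom in E
    would be full. *)
Lemma iso_coatom l m : l != m -> exists p q, p != q /\ g (coatom l m) = coatom p q.
Proof.
move=> lm; have [h [gh hg]] := order_iso_inverse g.
have [y ny] : exists y, ~ context_set (g (coatom l m)) y.
  apply: contrapT => all_y.
  have : (g (full_context D) <= g (coatom l m))%O.
    by apply/context_leP => y _; apply: contrapT => ?; apply: all_y; exists y.
  by rewrite oiso_mono => /full_le_coatom/eqP; apply/negP.
have [p [q [gpq ypq]]] : exists p q, (g (coatom l m) <= coatom p q)%O /\ ev p y <> ev q y.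
  apply: contrapT => H; apply: ny; apply: mem_context => p q gpq.
  by apply: contrapT => ypq; apply: H; exists p, q.
have pq : p != q by apply/eqP => E1; rewrite E1 in ypq.
exists p, q; split=> //; apply/eqP; rewrite eq_le gpq /=.
apply: contrapT => /negP ngpq.
have le_h : (coatom l m <= h (coatom p q))%O by rewrite -(oiso_mono g) hg.
have nle_h : ~ (h (coatom p q) <= coatom l m)%O.
  by rewrite -(oiso_mono g) hg; apply/negP.
have hE := coatom_maximal le_h nle_h.
have /full_le_coatom/eqP : (full_context E <= coatom p q)%O.
  rewrite -[coatom p q]hg hE; have -> : full_context E = g (h (full_context E)) by rewrite hg.
  by rewrite oiso_mono; apply/context_leP.
by apply/negP.
Qed.

Lemma iso_triangle l m n k s t : triangle (coatom l m) (coatom n k) (coatom s t) ->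
  triangle (g (coatom l m)) (g (coatom n k)) (g (coatom s t)).
Proof.
move=> tri S; have [h [gh hg]] := order_iso_inverse g.
by rewrite -[S]hg !oiso_mono; exact: tri.
Qed.

(** Distinct pairs meeting pairwise form a triangle or a star, and only in a triangle is the meet of
    two sides below the third. Disjoint images are excluded by [triangle_disjoint]. *)
Lemma iso_sides l m n : l != m -> l != n -> m != n ->
  exists a b c, [/\ a != b, a != c & b != c] /\
    [/\ g (coatom l m) = coatom a b, g (coatom l n) = coatom a c &
        g (coatom m n) = coatom b c].
Proof.
move=> lm ln mn.
have E12 : coatom l m <> coatom l n.
  by move=> /coatom_eq /(_ ln) []-[? ?]; subst; move: lm ln mn; rewrite ?eqxx.
have E13 : coatom l m <> coatom m n.
  by move=> /coatom_eq /(_ mn) []-[? ?]; subst; move: lm ln mn; rewrite ?eqxx.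
have E23 : coatom l n <> coatom m n.
  by move=> /coatom_eq /(_ mn) []-[? ?]; subst; move: lm ln mn; rewrite ?eqxx.
have [p [q [pq gpq]]] := iso_coatom lm; have [r [s [rs grs]]] := iso_coatom ln.
have [t [u [tu gtu]]] := iso_coatom mn.
have N12 : coatom p q <> coatom r s by rewrite -gpq -grs => /g_inj.
have N13 : coatom p q <> coatom t u by rewrite -gpq -gtu => /g_inj.
have N23 : coatom r s <> coatom t u by rewrite -grs -gtu => /g_inj.
have tri : triangle (coatom p q) (coatom r s) (coatom t u).
  rewrite -gpq -grs -gtu; apply: iso_triangle => S /context_leP Sm /context_leP Sn.
  by apply/context_leP => x Sx; apply/coatomP; rewrite -((coatomP _ _ _).1 (Sm _ Sx));
    exact: (coatomP _ _ _).1 (Sn _ Sx).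
have main a b c : a != b -> a != c -> g (coatom l m) = coatom a b ->
    g (coatom l n) = coatom a c -> coatom p q = coatom a b -> coatom r s = coatom a c ->
    exists a b c, [/\ a != b, a != c & b != c] /\
    [/\ g (coatom l m) = coatom a b, g (coatom l n) = coatom a c &
        g (coatom m n) = coatom b c].
  move=> ab ac gab gac pqab rsac.
  have bc : b != c by apply/eqP => bc; apply: N12; rewrite pqab rsac bc.
  exists a, b, c; split=> //; split=> //; rewrite gtu.
  rewrite pqab rsac in tri N13 N23.
  have ut : u != t by rewrite eq_sym.
  have := triangle_mem tu tri; have : u \in [:: a; b; a; c].
    by apply: (triangle_mem ut); rewrite [coatom u t]coatomC.
  have tu' : t <> u by apply/eqP.
  rewrite !inE => /or4P[]/eqP uE /or4P[]/eqP tE; subst u t => //;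
    first [by case: tu' | by case: N13; rewrite // coatomC | by case: N13
          | by case: N23 | by case: N23; rewrite coatomC | by [] | by rewrite coatomC].
have [pr|pr] := eqVneq p r; first by subst r; exact: (main p q s).
have [ps|ps] := eqVneq p s.
  by subst s; apply: (main p q r) => //; rewrite 1?eq_sym // 1?grs coatomC.
have [qr|qr] := eqVneq q r.
  by subst r; apply: (main q p s) => //; rewrite 1?eq_sym // 1?gpq coatomC.
have [qs|qs] := eqVneq q s.
  subst s; apply: (main q p r); rewrite 1?eq_sym //;
    by [rewrite gpq coatomC|rewrite grs coatomC|rewrite coatomC].
by case: (triangle_disjoint pr ps qr qs tri tu) => E1; [case: N13|case: N23].
Qed.

Definition vertex l a := forall m, m != l -> exists2 b, a != b & g (coatom l m) = coatom a b.

(** The images of [{l, m}] and [{l, n}] share a. If the image of some [{l, k}] missed a, the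
    triangles l m k and l n k would force it to be [{b, c}], already the image of [{m, n}]. *)
Lemma vertex_exists l m n : l != m -> l != n -> m != n -> exists a, vertex l a.
Proof.
move=> lm ln mn.
have [a [b [c [[ab ac bc] [gab gac gbc]]]]] := iso_sides lm ln mn.
exists a => k kl.
have [->|km] := eqVneq k m; first by exists b.
have [->|kn] := eqVneq k n; first by exists c.
rewrite eq_sym in kl; rewrite eq_sym in km; rewrite eq_sym in kn.
have [a1 [b1 [c1 [[ab1 ac1 bc1] [gab1 gac1 gbc1]]]]] := iso_sides lm kl km.
case: (coatom_eq (etrans (esym gab) gab1) ab1) => -[? ?]; subst a1 b1; first by exists c1.
have [a2 [b2 [c2 [[ab2 ac2 bc2] [gab2 gac2 gbc2]]]]] := iso_sides ln kl kn.
have c1c : c1 = c.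
  case: (coatom_eq (etrans (esym gac) gab2) ab2) => -[? ?]; subst a2 b2.
    case: (coatom_eq (etrans (esym gac1) gac2) ac2) => -[? ?]; subst.
      by rewrite eqxx in ab.
    by rewrite eqxx in bc1.
  by case: (coatom_eq (etrans (esym gac1) gac2) ac2) => -[? ?]; subst; rewrite ?eqxx in ab bc *.
subst c1; have := g_inj (etrans gac1 (esym gbc)).
move=> /coatom_eq /(_ mn) [[? ?]|[? ?]]; subst.
  by rewrite eqxx in lm.
by rewrite eqxx in ln.
Qed.

End PairMap.

Lemma vertex_map (R : realType) (D E : comCstarAlgType R)
    (g : order_iso (context D) (context E)) :
  (exists l m n : spectrum D, [/\ l != m, l != n & m != n]) ->
  exists f : spectrum D -> spectrum E, bijective f /\
    forall l m, l != m -> f l != f m /\ g (coatom l m) = coatom (f l) (f m).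
Proof.
move=> three; have other l m : exists n : spectrum D, l != n /\ m != n.
  have [x [y [z [xy xz yz]]]] := three.
  have [lx|lx] := eqVneq l x; last first.
    have [mx|mx] := eqVneq m x; last by exists x.
    subst m; have [ly|ly] := eqVneq l y; last by exists y.
    by subst l; exists z.
  subst l; have [my|my] := eqVneq m y; last by exists y.
  by subst m; exists z.
have /choice[f fP] l : exists a, vertex g l a.
  have [m [lm _]] := other l l; have [n [ln mn]] := other l m.
  exact: (vertex_exists g lm ln mn).
have fE l m : l != m -> f l != f m /\ g (coatom l m) = coatom (f l) (f m).
  move=> lm; have ml : m != l by rewrite eq_sym.
  have [b flb gb] := fP l m ml; have [b' fmb' gb'] := fP m l lm.
  (* If the vertices coincided, the images of the three sides of a triangle would all contain that
     vertex, contrary to [iso_sides]. *)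
  have [fE|fE] := eqVneq (f l) (f m).
    exfalso; have [n [ln mn]] := other l m.
    have nl : n != l by rewrite eq_sym.
    have nm : n != m by rewrite eq_sym.
    have [c flc gc] := fP l n nl; have [c' fmc' gc'] := fP m n nm.
    have [a1 [b1 [c1 [[ab1 ac1 bc1] [gab1 gac1 gbc1]]]]] := iso_sides g lm ln mn.
    have := coatom_eq (etrans (esym gab1) gb) flb.
    have := coatom_eq (etrans (esym gac1) gc) flc.
    have := coatom_eq (etrans (esym gbc1) gc') fmc'; rewrite -fE.
    by move=> [[E1 _]|[E1 _]] [[E2 _]|[E2 _]] [[E3 _]|[E3 _]]; move: ab1 ac1 bc1;
      rewrite -?E1 -?E2 -?E3 ?eqxx // -?E1 -?E2 -?E3 ?eqxx.
  split=> //; rewrite gb.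
  have := coatom_eq (etrans (esym gb') (etrans (congr1 g (coatomC m l)) gb)) flb.
  by move=> [[E1 _]|[E1 ->]] //; rewrite E1 eqxx in fE.
have f_inj : injective f.
  move=> l m flm; apply/eqP/negPn/negP => /fE[/eqP + _]; exact.
exists f; split=> //; apply: injective_surjective_bijective => // y.
have [h [gh hg]] := order_iso_inverse g; have [l [m [_ [lm _ _]]]] := three.
have [y' yy'] : exists y', y != y'.
  have [yl|?] := eqVneq y (f l); last by exists (f l).
  by exists (f m); rewrite yl; case: (fE _ _ lm).
have [p [q [pq hpq]]] := iso_coatom h yy'.
have [_ gpq] := fE _ _ pq; have : coatom (f p) (f q) = coatom y y'.
  by rewrite -gpq -hpq hg.
by move=> /coatom_eq /(_ yy') []-[-> _]; [exists p|exists q].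
Qed.

Lemma dual_map_exists (R : realType) (D E : comCstarAlgType R)
    (h : spectrum E -> spectrum D) :
  (forall x, sa x -> near_continuous (fun l => rv (h l) x)) ->
  exists T : D -> E, forall l x, ev l (T x) = ev (h l) x.
Proof.
move=> hc; have part x : sa x -> exists y, sa y /\ forall l, rv l y = rv (h l) x.
  move=> sx; have [||y [_ sy yE]] := @gelfand_context _ _ (full_context E) (fun l => rv (h l) x).
  - exact: hc.
  - by move=> l m /full_le_coatom ->.
  - by exists y.
suff /choice[T TE] x : exists y, forall l, ev l y = ev (h l) x by exists T => l x; exact: TE.
have [y [sy yE]] := part _ (sa_repart x); have [z [sz zE]] := part _ (sa_impart x).
exists (y + 'i *: z) => l; rewrite (ev_parts (h l) x) evD evZ !ev_sa // yE zE.
by apply/eqP; rewrite eq_complex /= !(mul0r, mul1r, mulr0, subr0, addr0, add0r) !eqxx.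
Qed.

Lemma dual_map_star_isomorphism (R : realType) (D E : comCstarAlgType R)
    (f : spectrum D -> spectrum E) (h : spectrum E -> spectrum D) (T : D -> E) (U : E -> D) :
  cancel f h -> cancel h f -> (forall l x, ev l (T x) = ev (h l) x) ->
  (forall l y, ev l (U y) = ev (f l) y) ->
  [/\ cancel T U, cancel U T & star_isomorphism T].
Proof.
move=> fh hf TE UE.
have TU : cancel T U by move=> x; apply: ev_inj => l; rewrite UE TE fh.
have UT : cancel U T by move=> y; apply: ev_inj => l; rewrite TE UE hf.
split=> //; split; first by exists U.
split=> [a x y||x].
- by apply: ev_inj => l; rewrite TE !evD !evZ !TE.
- by split=> [|x y]; apply: ev_inj => l; rewrite TE ?ev1 // !evM !TE.
- by apply: ev_inj => l; rewrite TE !ev_star TE.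
Qed.

Section Transport.
Variables (R : realType) (D E : comCstarAlgType R).
Variable g : order_iso (context D) (context E).
Variables (f : spectrum D -> spectrum E) (k : spectrum E -> spectrum D).
Hypothesis kf : cancel k f.
Hypothesis fE : forall l m, l != m -> g (coatom l m) = coatom (f l) (f m).
Implicit Types (x : D) (y : E) (l m : spectrum D) (p q : spectrum E).

Lemma iso_le_coatom (S : context D) l m :
  (S <= coatom l m)%O -> (g S <= coatom (f l) (f m))%O.
Proof.
have [->|lm] := eqVneq l m; first by move=> _; exact: coatom_diag.
by rewrite -(fE lm) oiso_mono.
Qed.

(* The functions constant on [F := {l | e <= |l x - k p x|}] form a context, and
   [z := max (e - |x - k p x|) 0] belongs to it but takes another value at [k p].
   As [g] preserves this configuration, some [w] is constant on the image of [F]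
   with another value at [p]; it isolates [p] from the image of [F]. *)
Lemma transport_continuous x : sa x -> near_continuous (fun p => rv (k p) x).
Proof.
move=> sx p e e0; pose F := [set l | e <= `|rv (k p) x - rv l x|].
have [[l1 Fl1]|F0] := pselect (exists l, F l); last first.
  (* With F empty every q satisfies the bound; [ev_near p 0] merely supplies some neighbourhood of
     p. *)
  apply: filterS (ev_near p 0 ltr01) => q _ /=.
  by rewrite ltNge; apply/negP => Fq; apply: F0; exists (k q).
have Iconst (r : R) : approximable (full_context D) (fun=> r).
  have := approximable_rv (I : context_set (full_context D) (rsc D r)) (sa_rsc D r).
  by congr approximable; apply/funext => l; rewrite rv_rsc.
have [z [_ sz zE]] : exists z, [/\ context_set (full_context D) z, sa z &
    forall l, rv l z = Num.max (e + -1 * `|rv (k p) x + -1 * rv l x|) 0].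
  apply: approximable_exact; apply: approximable_max; last exact: Iconst.
  apply: approximableD; first exact: Iconst.
  apply: approximableZ; apply: approximable_abs; apply: approximableD; first exact: Iconst.
  by apply: approximableZ; exact: approximable_rv.
have zF l : F l -> rv l z = 0.
  by move=> Fl; rewrite zE !mulN1r max_r // subr_le0.
have Cz : context_set (const_on F) z.
  by move=> l m Fl Fm; rewrite !ev_sa // !zF.
have kpz : rv (k p) z = e.
  by rewrite zE !mulN1r subrr normr0 oppr0 addr0 max_l // ltW.
have kpl1 : k p != l1.
  by apply/eqP => E1; move: e0; rewrite -kpz E1 zF // ltxx.
have nle : ~ (g (const_on F) <= coatom p (f l1))%O.
  rewrite -{1}(kf p) -(fE kpl1) oiso_mono => /context_leP/(_ _ Cz)/coatomP.
  rewrite !ev_sa // kpz zF // => /complexI E1; by rewrite E1 ltxx in e0.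
have [w [gw pw]] : exists w, context_set (g (const_on F)) w /\ ev p w != ev (f l1) w.
  apply: contrapT => H; apply: nle; apply/context_leP => w gw; apply/coatomP.
  by apply: contrapT => /eqP ?; apply: H; exists w.
have const_w l : F l -> ev (f l) w = ev (f l1) w.
  move=> Fl; have /iso_le_coatom/context_leP/(_ _ gw)/coatomP // : (const_on F <= coatom l l1)%O.
  by apply/context_leP => v Fv; apply/coatomP; exact: Fv.
have dr := RRe_real (normr_real (ev p w - ev (f l1) w)).
have d0 : 0 < complex.Re `|ev p w - ev (f l1) w|.
  by rewrite -ltcR dr normr_gt0 subr_eq0.
apply: filterS (ev_near p w d0) => q; rewrite dr => pq.
rewrite ltNge; apply/negP => Fq.
have := const_w (k q) Fq; rewrite kf => E1.
by rewrite E1 ltxx in pq.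
Qed.

End Transport.

Definition three_characters (R : realType) (D : comCstarAlgType R) : Prop :=
  exists l m n : spectrum D, [/\ l != m, l != n & m != n].

(** T is dual to k, the inverse of the map of characters. By [mem_context] its effect on contexts
    can be tested on coatoms; [iso_le_coatom] gives one inclusion through h and the other through
    g. *)
Theorem commutative_order_iso (R : realType) (D E : comCstarAlgType R)
    (g : order_iso (context D) (context E)) : three_characters D ->
  exists T : D -> E, star_isomorphism T /\ forall S, T @` context_set S = context_set (g S).
Proof.
move=> /(vertex_map g)[f [[k fk kf] fP]].
have fE l m : l != m -> g (coatom l m) = coatom (f l) (f m) by move=> /fP[].
have [h [gh hg]] := order_iso_inverse g.
have hE p q : p != q -> h (coatom p q) = coatom (k p) (k q).
  move=> pq; have kpq : k p != k q by apply: contra_neq pq => /(can_inj kf).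
  by rewrite -{1}(kf p) -{1}(kf q) -fE.
have [T TE] := dual_map_exists (transport_continuous kf fE).
have [U UE] := dual_map_exists (transport_continuous fk hE).
have [TU UT T_iso] := dual_map_star_isomorphism fk kf TE UE.
exists T; split=> // S; apply/seteqP; split=> [_ [x Sx <-]|y gSy].
  apply: mem_context => p q; rewrite !TE -[g S]/(g S) -{1}(kf p) -{1}(kf q) => le_pq.
  apply/coatomP; move: x Sx; apply/context_leP.
  by have := iso_le_coatom hE le_pq; rewrite gh !fk.
exists (U y) => //; apply: mem_context => l m le_lm; rewrite !UE.
by apply/coatomP; move: y gSy; apply/context_leP; exact: iso_le_coatom.
Qed.

Section Uniqueness.
Variables (R : realType) (D E : comCstarAlgType R).

Definition pullback (T : D -> E) (Tm : star_morphism T) (p : spectrum E) : spectrum D.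
Proof.
apply: (@make_character R D (fun x => ev p (T x))).
- by move=> a x y; rewrite (star_morph_linear Tm) evD evZ.
- split=> [|x y]; first by rewrite (star_morph_mul Tm).1 ev1.
  by rewrite (star_morph_mul Tm).2 evM.
Defined.

Lemma ev_pullback T (Tm : star_morphism T) p x : ev (pullback Tm p) x = ev p (T x).
Proof. by []. Qed.

End Uniqueness.

Lemma star_isomorphism_inverse (K : numClosedFieldType) (A B : starAlgType K) (T : A -> B)
    (U : B -> A) :
  star_morphism T -> cancel T U -> cancel U T -> star_isomorphism U.
Proof.
move=> [Tl [T1 TM] Ts] TU UT; have T_inj := can_inj TU.
split; first by exists T.
split=> [a x y||x].
- by apply: T_inj; rewrite Tl !UT.
- by split=> [|x y]; apply: T_inj; rewrite ?T1 ?TM !UT.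
- by apply: T_inj; rewrite Ts !UT.
Qed.

(** Comparing coatoms, U pulls p back to [f p] or [f q] for every other q. Two different choices of
    q leave only [f p]. *)
Lemma star_isomorphism_unique (R : realType) (D E : comCstarAlgType R) (T U : D -> E) :
  three_characters D -> star_isomorphism T -> star_morphism U ->
  (forall S : context D, T @` context_set S = U @` context_set S) -> T = U.
Proof.
move=> three [[V TV VT] Tm] Um TUS.
have [_ Vm] := star_isomorphism_inverse Tm TV VT.
pose f := pullback Tm; pose k := pullback Vm.
have fk l : f (k l) = l by apply: spectrum_ev_eq => x; rewrite !ev_pullback TV.
have kf p : k (f p) = p by apply: spectrum_ev_eq => x; rewrite !ev_pullback VT.
have key p q : p != q -> pullback Um p = f p \/ pullback Um p = f q.
  move=> pq; have pqU : pullback Um p != pullback Um q.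
    apply: contra_neq pq => pqU; apply: spectrum_ev_eq => y.
    have [x _ <-] : (U @` context_set (full_context D)) y.
      by rewrite -TUS; exists (V y) => //; exact: VT.
    by rewrite -!(ev_pullback Um) pqU.
  have le_c : (coatom (f p) (f q) <= coatom (pullback Um p) (pullback Um q))%O.
    apply/context_leP => x xS; apply/coatomP; rewrite !ev_pullback.
    have [x' x'S <-] : (T @` context_set (coatom (f p) (f q))) (U x).
      by rewrite TUS; exists x.
    by rewrite -!(ev_pullback Tm); apply/coatomP.
  by case: (coatom_le le_c pqU) => -[-> _]; [left|right].
have UT p : pullback Um p = f p.
  have [q [r [pq pr qr]]] : exists q r, [/\ p != q, p != r & q != r].
    have kn l m : l != m -> k l != k m by move=> lm; apply: contra_neq lm => /(can_inj fk).
    have [l [m [n [/kn lm /kn ln /kn mn]]]] := three.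
    have [pl|pl] := eqVneq p (k l); first by exists (k m), (k n); rewrite pl.
    have [pm|pm] := eqVneq p (k m); first by exists (k l), (k n); rewrite pm eq_sym.
    by exists (k l), (k m).
  have [//|Uq] := key _ _ pq; have [//|Ur] := key _ _ pr.
  by case/eqP: qr; apply: (can_inj kf); rewrite -Uq -Ur.
by apply/funext => x; apply: ev_inj => p; rewrite -(ev_pullback Tm) -(ev_pullback Um) UT.
Qed.

(** * Order isomorphisms in the noncommutative case *)

Section Subcontext.
Variables (R : realType) (A : cstarAlgType R) (C : context A).

Lemma nrm_val (x : context_alg C) : nrm x = nrm (val x).
Proof. by []. Qed.

Section In.
Variable C' : context A.
(** Intersection with C; with [supcontext] as inverse it identifies the contexts of the algebra C
    with the contexts of A below C. *)
Definition subcontext_set : set (context_alg C) := [set x | context_set C' (val x)].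
Fact subcontext1 : subcontext_set 1.
Proof. exact: context1. Qed.
Fact subcontextL (a : R[i]) x y :
  subcontext_set x -> subcontext_set y -> subcontext_set (a *: x + y).
Proof. exact: contextL. Qed.
Fact subcontextM x y : subcontext_set x -> subcontext_set y -> subcontext_set (x * y).
Proof. exact: contextM. Qed.
Fact subcontext_star x : subcontext_set x -> subcontext_set (star x).
Proof. exact: context_star. Qed.
Fact subcontext_closed : closed (subcontext_set : set (normed_space (context_alg C))).
Proof.
apply/closed_nrmP => x clx.
have /closed_nrmP := @context_closed _ _ C'; apply => e /clx[y Sy xy].
by exists (val y).
Qed.
Definition subcontext : context (context_alg C) := Context subcontext1 subcontextL
  subcontextM subcontext_star (fun x y _ _ => mulrC x y) subcontext_closed.
End In.

Section Out.
Variable S : context (context_alg C).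
Definition supcontext_set : set A := [set val x | x in context_set S].
Fact supcontext1 : supcontext_set 1.
Proof. by exists 1 => //; exact: context1. Qed.
Fact supcontextL (a : R[i]) x y :
  supcontext_set x -> supcontext_set y -> supcontext_set (a *: x + y).
Proof. by move=> [u Su <-] [v Sv <-]; exists (a *: u + v) => //; exact: contextL. Qed.
Fact supcontextM x y : supcontext_set x -> supcontext_set y -> supcontext_set (x * y).
Proof. by move=> [u Su <-] [v Sv <-]; exists (u * v) => //; exact: contextM. Qed.
Fact supcontext_star x : supcontext_set x -> supcontext_set (star x).
Proof. by move=> [u Su <-]; exists (star u) => //; exact: context_star. Qed.
Fact supcontext_comm x y : supcontext_set x -> supcontext_set y -> x * y = y * x.
Proof. by move=> [u Su <-] [v Sv <-]; apply: (@context_comm _ _ C); exact: context_algP. Qed.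
Fact supcontext_closed : closed (supcontext_set : set (normed_space A)).
Proof.
apply/closed_nrmP => x clx.
have Cx : context_set C x.
  have /closed_nrmP := @context_closed _ _ C; apply => e /clx[_ [y Sy <-] xy].
  by exists (val y) => //; exact: context_algP.
pose u : context_alg C := exist _ x (mem_set Cx); exists u => //.
have /closed_nrmP := @context_closed _ _ S; apply => e /clx[_ [y Sy <-] xy].
by exists y.
Qed.
Definition supcontext : context A := Context supcontext1 supcontextL
  supcontextM supcontext_star supcontext_comm supcontext_closed.
End Out.

Lemma supcontext_le S : (supcontext S <= C)%O.
Proof. by apply/context_leP => _ [y _ <-]; exact: context_algP. Qed.

Lemma supcontextK S : subcontext (supcontext S) = S.
Proof.
apply: contextP => x; split=> [[y Sy /val_inj <-]//|Sx].
by exists x.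
Qed.

Lemma subcontextK C' : (C' <= C)%O -> supcontext (subcontext C') = C'.
Proof.
move=> /context_leP le_C; apply: contextP => x; split=> [[y Sy <-]//|C'x].
by exists (exist _ x (mem_set (le_C _ C'x))).
Qed.

Lemma le_supcontext S S' : (supcontext S <= supcontext S')%O = (S <= S')%O.
Proof.
apply/context_leP/context_leP => le_S x.
  move=> Sx; have [|y S'y /val_inj <- //] := le_S (val x).
  by exists x.
by move=> [y Sy <-]; exists y => //; exact: le_S.
Qed.

Lemma le_subcontext C1 C2 : (C1 <= C)%O -> (C2 <= C)%O ->
  (subcontext C1 <= subcontext C2)%O = (C1 <= C2)%O.
Proof. by move=> le1 le2; rewrite -le_supcontext !subcontextK. Qed.

End Subcontext.

Lemma restrict_order_iso (R : realType) (A B : cstarAlgType R)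
    (g : order_iso (context A) (context B)) (C : context A) :
  exists gC : order_iso (context (context_alg C)) (context (context_alg (g C))),
    forall S, gC S = subcontext (g C) (g (supcontext S)).
Proof.
have [h [gh hg]] := order_iso_inverse g.
pose f (S : context (context_alg C)) := subcontext (g C) (g (supcontext S)).
pose k (S : context (context_alg (g C))) := subcontext C (h (supcontext S)).
have le_g S : (g (@supcontext _ _ C S) <= g C)%O by rewrite oiso_mono supcontext_le.
have le_h S : (h (@supcontext _ _ (g C) S) <= C)%O.
  by rewrite -(oiso_mono g) hg supcontext_le.
have fk : cancel f k by move=> S; rewrite /k /f subcontextK // gh supcontextK.
have kf : cancel k f by move=> S; rewrite /k /f subcontextK // hg supcontextK.
have f_mono : {mono f : S S' / (S <= S')%O}.
  move=> S S'; rewrite /f le_subcontext; [|exact: le_g|exact: le_g].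
  by rewrite oiso_mono le_supcontext.
have f_bij : bijective f by exists k.
by exists (OrderIso f_bij f_mono).
Qed.

Section Implements.
Variables (R : realType) (A B : cstarAlgType R).
Implicit Types (C : context A) (F : A -> B).

(** F is a total function constrained on C only, so that maps on different contexts are compared
    without casts between subtypes. *)
Record star_hom_on C F : Prop := StarHomOn {
  hom_on1 : F 1 = 1;
  hom_onL : forall (a : R[i]) x y, context_set C x -> context_set C y ->
    F (a *: x + y) = a *: F x + F y;
  hom_onM : forall x y, context_set C x -> context_set C y -> F (x * y) = F x * F y;
  hom_on_star : forall x, context_set C x -> F (star x) = star (F x)
}.

Lemma hom_on0 C F : star_hom_on C F -> F 0 = 0.
Proof.
move=> hF; have := hom_onL hF (-1) (context1 C) (context1 C).
by rewrite !scaleN1r addNr => ->; rewrite addNr.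
Qed.

Lemma hom_onZ C F (a : R[i]) x : star_hom_on C F -> context_set C x ->
  F (a *: x) = a *: F x.
Proof.
move=> hF Cx; rewrite -[a *: x]addr0 (hom_onL hF) //; last exact: context0.
by rewrite (hom_on0 hF) addr0.
Qed.

Lemma hom_onD C F x y : star_hom_on C F -> context_set C x -> context_set C y ->
  F (x + y) = F x + F y.
Proof. by move=> hF Cx Cy; rewrite -{1}[x]scale1r (hom_onL hF) // scale1r. Qed.

Lemma hom_onB C F x y : star_hom_on C F -> context_set C x -> context_set C y ->
  F (x - y) = F x - F y.
Proof.
move=> hF Cx Cy; rewrite (hom_onD hF) //; last exact: contextN.
by rewrite -scaleN1r (hom_onZ _ hF) // scaleN1r.
Qed.

Lemma hom_on_scalar C F (a : R[i]) : star_hom_on C F -> F (a%:A) = a%:A.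
Proof. by move=> hF; rewrite (hom_onZ _ hF) ?(hom_on1 hF) //; exact: context1. Qed.

Variable g : order_iso (context A) (context B).

(** Images are prescribed for all subcontexts, since [star_isomorphism_unique] compares two maps
    through their effect on every context. *)
Record implements C F : Prop := Implements {
  impl_hom : star_hom_on C F;
  impl_inj : forall x y, context_set C x -> context_set C y -> F x = F y -> x = y;
  impl_image : forall C', (C' <= C)%O -> F @` context_set C' = context_set (g C')
}.

Lemma impl_mem C F x : implements C F -> context_set C x -> context_set (g C) (F x).
Proof. by move=> iF Cx; rewrite -(impl_image iF) //; exists x. Qed.

Lemma impl_sub C C' F : (C' <= C)%O -> implements C F -> implements C' F.
Proof.
move=> le_C [[h1 hL hM hs] hi him]; have /context_leP sC := le_C.
split=> [|x y /sC ? /sC|C'' le_C'']; last by apply: him; exact: le_trans le_C.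
- split=> // [a x y /sC ? /sC ?|x y /sC ? /sC ?|x /sC ?]; [exact: hL|exact: hM|exact: hs].
- exact: hi.
Qed.

Lemma impl_ext C F F' : (forall x, context_set C x -> F x = F' x) ->
  implements C F -> implements C F'.
Proof.
move=> FF' [[h1 hL hM hs] hi him].
split=> [|x y Cx Cy|C' /[dup] le_C /context_leP sC].
- split=> [|a x y Cx Cy|x y Cx Cy|x Cx].
  + by rewrite -FF' //; exact: context1.
  + by rewrite -!FF' //; [exact: hL|exact: contextL].
  + by rewrite -!FF' //; [exact: hM|exact: contextM].
  + by rewrite -!FF' //; [exact: hs|exact: context_star].
- by rewrite -!FF' //; exact: hi.
- rewrite -him //; apply/seteqP; split=> _ [x C'x <-]; exists x => //.
    by rewrite FF' //; exact: sC.
  by rewrite FF' //; exact: sC.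
Qed.

Lemma impl_of_iso C (T : context_alg C -> context_alg (g C)) (F : A -> B) :
  star_isomorphism T ->
  (forall S, T @` context_set S = context_set (subcontext (g C) (g (supcontext S)))) ->
  (forall x, F (val x) = val (T x)) -> implements C F.
Proof.
move=> [[U TU UT] [Tl [T1 TM] Ts]] TS FT.
have up x (Cx : context_set C x) : exists u : context_alg C, x = val u.
  by exists (exist _ x (mem_set Cx)).
split.
- split.
  + by rewrite -[1]/(val (1 : context_alg C)) FT T1.
  + by move=> a _ _ /up[u ->] /up[v ->]; rewrite -[_ + _]/(val (a *: u + v)) !FT Tl.
  + by move=> _ _ /up[u ->] /up[v ->]; rewrite -[_ * _]/(val (u * v)) !FT TM.
  + by move=> _ /up[u ->]; rewrite -[star _]/(val (star u)) !FT Ts.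
- by move=> _ _ /up[u ->] /up[v ->]; rewrite !FT => /val_inj/(can_inj TU) ->.
- move=> C' le_C; have le_gC : (g C' <= g C)%O by rewrite oiso_mono.
  rewrite -(subcontextK le_gC) -{2}(subcontextK le_C).
  rewrite -[context_set (supcontext _)]/[set val x | x in _] -TS.
  rewrite -{1}(subcontextK le_C); apply/seteqP; split.
    by move=> _ [_ [u Su <-] <-]; exists (T u); [exists u|rewrite FT].
  move=> _ [_ [u Su <-] <-]; exists (val u); last exact: FT.
  by exists u.
Qed.

Lemma iso_of_impl C F : implements C F ->
  exists T : context_alg C -> context_alg (g C), [/\ star_isomorphism T,
    forall S, T @` context_set S = context_set (subcontext (g C) (g (supcontext S))) &
    forall x, val (T x) = F (val x)].
Proof.
move=> iF; have hF := impl_hom iF.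
have gCF (x : context_alg C) : context_set (g C) (F (val x)).
  by apply: (impl_mem iF); exact: context_algP.
pose T (x : context_alg C) : context_alg (g C) := exist _ (F (val x)) (mem_set (gCF x)).
have T_inj : injective T.
  move=> x y /(congr1 val) /= Fxy; apply: val_inj.
  by apply: (impl_inj iF) Fxy; exact: context_algP.
have T_surj y : exists x, T x = y.
  have [x Cx Fx] : (F @` context_set C) (val y).
    by rewrite (impl_image iF (lexx _)); exact: context_algP.
  by exists (exist _ x (mem_set Cx)); exact: val_inj.
exists T; split=> //.
  split; first exact: injective_surjective_bijective.
  split=> [a x y||x]; first by apply: val_inj; apply: (hom_onL hF); exact: context_algP.
    split=> [|x y]; apply: val_inj; first exact: (hom_on1 hF).
    by apply: (hom_onM hF); exact: context_algP.
  by apply: val_inj; apply: (hom_on_star hF); exact: context_algP.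
move=> S; apply/seteqP; split=> [_ [x Sx <-]|y].
  rewrite /= /subcontext_set /= -(impl_image iF (supcontext_le S)).
  by exists (val x) => //; exists x.
rewrite /= /subcontext_set /= -(impl_image iF (supcontext_le S)).
by move=> [_ [x Sx <-] Fx]; exists x => //; exact: val_inj.
Qed.

End Implements.

Lemma few_characters (R : realType) (D : comCstarAlgType R) : ~ three_characters D ->
  exists l m : spectrum D, forall n, n = l \/ n = m.
Proof.
move=> few; have [l _] := spectrum_nonempty D.
have [[m /eqP ml]|none] := pselect (exists m, m <> l); last first.
  by exists l, l => n; left; apply: contrapT => nl; apply: none; exists n.
exists l, m => n; have [->|/eqP nl] := eqVneq n l; first by left.
have [->|/eqP nm] := eqVneq n m; first by right.
exfalso; apply: few; exists l, m, n.
by split; rewrite eq_sym //; apply/eqP.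
Qed.

Lemma two_characters_projection (R : realType) (D : comCstarAlgType R) (l m : spectrum D) :
  l != m -> (forall n, n = l \/ n = m) -> exists p : D, [/\ p * p = p, star p = p,
    ev l p = 1, ev m p = 0 & forall x, x = ev l x *: p + ev m x *: (1 - p)].
Proof.
move=> /character_separation[p lp mp] lm; exists p; split=> //.
- by apply: ev_inj => n; rewrite evM; case: (lm n) => ->; rewrite ?lp ?mp ?mulr1 ?mulr0.
- apply: ev_inj => n; rewrite ev_star; case: (lm n) => ->; rewrite ?lp ?mp.
    by rewrite -[1]/(1%:C) conjc_real.
  by rewrite conjc0.
- move=> x; apply: ev_inj => n; rewrite evD !evZ evB ev1.
  by case: (lm n) => ->; rewrite ?lp ?mp !(subrr, subr0, mulr0, mulr1, addr0, add0r).
Qed.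

Section Big.
Variables (R : realType) (A : cstarAlgType R).
Implicit Types (C : context A) (x y e p : A).

Definition spanned C e := forall x, context_set C x ->
  exists a b : R[i], x = a%:A + b *: e.

(** As C contains 1, this says that its dimension is at least three. *)
Definition big C := ~ exists e, spanned C e.

Definition projection p := p * p = p /\ star p = p.

Lemma projectionC p : projection p -> projection (1 - p).
Proof.
move=> [pp sp]; split; last by rewrite starB star1 sp.
by rewrite mulrBr mulr1 mulrBl mul1r pp subrr subr0.
Qed.

Lemma big_le C C' : (C <= C')%O -> big C -> big C'.
Proof. by move=> /context_leP CC' bC [e sC']; apply: bC; exists e => x /CC' /sC'. Qed.

Lemma big_three C : big C -> three_characters (context_alg C).
Proof.
move=> bC; apply: contrapT => /few_characters[l [m lm]]; apply: bC.
have up x (Cx : context_set C x) : exists u : context_alg C, x = val u.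
  by exists (exist _ x (mem_set Cx)).
have [El|nlm] := eqVneq l m.
  subst m; exists 1 => _ /up[u ->]; exists (ev l u), 0.
  have -> : u = (ev l u)%:A.
    by apply: ev_inj => n; rewrite evZ ev1 mulr1; case: (lm n) => ->.
  by rewrite evZ ev1 mulr1 scale0r addr0.
have [p [pp sp lp mp dec]] := two_characters_projection nlm lm.
exists (val p) => _ /up[u ->]; exists (ev m u), (ev l u - ev m u).
rewrite {1}(dec u) -[RHS]/(val ((ev m u)%:A + (ev l u - ev m u) *: p)); congr val.
by rewrite scalerBr scalerBl addrCA.
Qed.

(** Take u and v with values (1, 0, 0) and (0, 1, 0) at three characters. Eliminating e gives a
    scalar combination of u and v; evaluation kills its coefficients and makes u scalar, which is
    absurd. *)
Lemma spanned_characters C e : spanned C e -> ~ three_characters (context_alg C).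
Proof.
move=> sC [l [m [n [lm ln mn]]]].
have [u1 lu1 mu1] := character_separation lm; have [u2 lu2 nu2] := character_separation ln.
have ml : m != l by rewrite eq_sym.
have [v1 mv1 lv1] := character_separation ml; have [v2 mv2 nv2] := character_separation mn.
pose u := u1 * u2; pose v := v1 * v2.
have [lu mu nu] : [/\ ev l u = 1, ev m u = 0 & ev n u = 0].
  by rewrite !evM lu1 lu2 mu1 nu2 mulr1 mul0r mulr0.
have [lv mv nv] : [/\ ev l v = 0, ev m v = 1 & ev n v = 0].
  by rewrite !evM mv1 mv2 lv1 nv2 mulr1 mul0r mulr0.
have [a [b uE]] := sC _ (context_algP u); have [c [d vE]] := sC _ (context_algP v).
have E1 : d *: u - b *: v = (d * a - b * c)%:A.
  apply: val_inj; rewrite -[LHS]/(d *: val u - b *: val v) -[RHS]/((d * a - b * c)%:A).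
  rewrite uE vE !scalerDr !scalerA [b * d]mulrC opprD addrACA subrr addr0.
  by rewrite -scalerBl.
have En := congr1 (ev n) E1; have El := congr1 (ev l) E1; have Em := congr1 (ev m) E1.
move: En El Em; rewrite !evB !evZ !ev1 lu mu nu lv mv nv !mulr0 !mulr1 subrr => <-.
rewrite subr0 sub0r => d0 /eqP; rewrite oppr_eq0 => /eqP b0.
have uE' : u = a%:A by apply: val_inj; rewrite uE b0 scale0r addr0.
move: lu nu; rewrite uE' evZ ev1 mulr1 => a1; rewrite evZ ev1 mulr1 a1 => /eqP.
by rewrite oner_eq0.
Qed.

Lemma not_big_cases C : ~ big C ->
  (forall x, context_set C x -> exists a : R[i], x = a%:A) \/
  exists p, [/\ projection p, context_set C p, p <> 0, 1 - p <> 0 &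
    forall x, context_set C x -> exists a b : R[i], x = a *: p + b *: (1 - p)].
Proof.
move=> /contrapT[e /spanned_characters/few_characters[l [m lm]]].
have up x (Cx : context_set C x) : exists u : context_alg C, x = val u.
  by exists (exist _ x (mem_set Cx)).
have [El|nlm] := eqVneq l m.
  subst m; left => _ /up[u ->]; exists (ev l u).
  rewrite -[RHS]/(val ((ev l u)%:A : context_alg C)); congr val.
  by apply: ev_inj => n; rewrite evZ ev1 mulr1; case: (lm n) => ->.
have [p [pp sp lp mp dec]] := two_characters_projection nlm lm.
have n10 : (1 : R[i]) <> 0 by apply/eqP; rewrite oner_eq0.
right; exists (val p); split.
- by split; [rewrite -[LHS]/(val (p * p)) pp|rewrite -[LHS]/(val (star p)) sp].
- exact: context_algP.
- rewrite -[RHS]/(val (0 : context_alg C)) => /val_inj E1.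
  by apply: n10; rewrite -lp E1 ev0.
- rewrite -[LHS]/(val (1 - p)) -[RHS]/(val (0 : context_alg C)) => /val_inj E1.
  by apply: n10; rewrite -(ev0 m) -E1 evB ev1 mp subr0.
- move=> _ /up[u ->]; exists (ev l u), (ev m u).
  by rewrite {1}(dec u).
Qed.

(** If 1 and e spanned C, the non-scalar p could replace e, giving [p x = k + c p]; multiplication
    by [1 - p] kills k, so [p x] would be a multiple of p. *)
Lemma rich_big C p x : projection p -> p <> 0 -> 1 - p <> 0 ->
  context_set C p -> context_set C (p * x) -> ~ (exists a : R[i], p * x = a *: p) -> big C.
Proof.
move=> [pp _] p0 p1 Cp Cpx npx [e sC].
have [a [b pE]] := sC _ Cp; have [c [d pxE]] := sC _ Cpx.
have b0 : b != 0.
  apply/eqP => b0; move: pE; rewrite b0 scale0r addr0 => pE.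
  move: pp; rewrite pE -scalerAl mul1r scalerA => /eqP; rewrite -subr_eq0 -scalerBl.
  rewrite scaler_eq0 oner_eq0 orbF -{3}[a]mulr1 -mulrBr mulf_eq0 subr_eq0.
  move=> /orP[]/eqP aE; first by apply: p0; rewrite pE aE scale0r.
  by apply: p1; rewrite pE aE scale1r subrr.
have eE : e = b^-1 *: (p - a%:A).
  by rewrite {1}pE addrC addKr scalerA mulVf ?scale1r.
pose k := c - d * b^-1 * a.
have pxE' : p * x = k%:A + (d * b^-1) *: p.
  rewrite pxE eE scalerA scalerBr scalerA /k scalerBl.
  by rewrite [RHS]addrAC addrA.
have k0 : k = 0.
  have := congr1 (fun z => (1 - p) * z) pxE'.
  rewrite /= mulrA mulrBl mul1r pp subrr mul0r mulrDr -!scalerAr mulr1 mulrBl mul1r pp.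
  rewrite subrr scaler0 addr0 => /esym/eqP; rewrite scaler_eq0 => /orP[/eqP //|/eqP E1].
  by case: p1.
by apply: npx; exists (d * b^-1); rewrite pxE' k0 scale0r add0r.
Qed.

(* [p] is not minimal in [C]. *)
Definition rich C p := exists2 x, context_set C x & ~ exists a : R[i], p * x = a *: p.

Lemma big_rich C p : big C -> context_set C p -> rich C p \/ rich C (1 - p).
Proof.
move=> bC Cp; apply: contrapT => nr; apply: bC; exists p => x Cx.
have [a pxE] : exists a : R[i], p * x = a *: p.
  by apply: contrapT => ?; apply: nr; left; exists x.
have [b qxE] : exists b : R[i], (1 - p) * x = b *: (1 - p).
  by apply: contrapT => ?; apply: nr; right; exists x.
have xE : x = b *: (1 - p) + a *: p by rewrite -pxE -qxE -mulrDl subrK mul1r.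
by exists b, (a - b); rewrite {1}xE scalerBr scalerBl addrAC addrA.
Qed.

End Big.

Section Commutant.
Variables (R : realType) (A : cstarAlgType R).

Definition commutant (M : set A) : set A := [set x | forall m, M m -> x * m = m * x].

Lemma commutant_closed M : closed (commutant M : set (normed_space A)).
Proof.
apply/closed_nrmP => x clx m Mm; apply/eqP; rewrite -subr_eq0; apply/eqP/nrm0_eq0/eqP.
rewrite eq_le nrm_ge0 andbT; apply/ler_addgt0Pl => e e0; rewrite addr0.
have K0 : 0 < 2 * (nrm m + 1) by rewrite mulr_gt0 // ltr_wpDl // nrm_ge0.
have [|y Sy xy] := clx (e / (2 * (nrm m + 1))); first by rewrite divr_gt0.
have -> : x * m - m * x = (x - y) * m - m * (x - y).
  by rewrite mulrBl mulrBr (Sy m) // opprB addrA subrK.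
apply: le_trans (nrmB _ _) _.
have := nrmM (x - y) m; have := nrmM m (x - y).
rewrite ltr_pdivlMr // in xy; have := nrm_ge0 m; have := nrm_ge0 (x - y).
by move: xy; move: (nrm (x - y)) (nrm m) (nrm _) (nrm _) => u v s t; nra.
Qed.

Lemma commutant_star M : (forall x, M x -> M (star x)) ->
  forall x, commutant M x -> commutant M (star x).
Proof.
by move=> Ms x Mx m /Ms Mm; rewrite -[m]starK -!starM Mx.
Qed.

(** The double commutant works: M lies in its commutant, so the double commutant does too, which
    makes it commutative. *)
Lemma commuting_context M : (forall x, M x -> M (star x)) ->
  (forall x y, M x -> M y -> x * y = y * x) -> exists E : context A, M `<=` context_set E.
Proof.
move=> Ms Mc; pose E := commutant (commutant M).
have MM : M `<=` commutant M by move=> x Mx m; exact: Mc.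
have E1 : E 1 by move=> m _; rewrite mul1r mulr1.
have EL (a : R[i]) x y : E x -> E y -> E (a *: x + y).
  by move=> Ex Ey m Mm; rewrite mulrDl mulrDr -scalerAl -scalerAr Ex // Ey.
have EM x y : E x -> E y -> E (x * y).
  by move=> Ex Ey m Mm; rewrite -mulrA Ey // mulrA Ex // mulrA.
have Es x : E x -> E (star x) by apply: commutant_star; exact: commutant_star.
have Ec x y : E x -> E y -> x * y = y * x.
  by move=> Ex Ey; apply: Ex => m Mm; apply: Ey; exact: MM.
exists (Context E1 EL EM Es Ec (@commutant_closed _)) => x Mx m Mm.
by rewrite Mm.
Qed.

Lemma normal_context x : star x * x = x * star x -> exists C : context A, context_set C x.
Proof.
move=> nx; have [||C MC] := @commuting_context [set y | y = x \/ y = star x].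
- by move=> _ [->|->]; [right|left; rewrite starK].
- by move=> _ _ [->|->] [->|->].
by exists C; apply: MC; left.
Qed.

End Commutant.

Section BigContexts.
Variables (R : realType) (A B : cstarAlgType R).
Variable g : order_iso (context A) (context B).
Implicit Types (C : context A) (F : A -> B).

Lemma impl_exists C : big C -> exists F, implements g C F.
Proof.
move=> bC; have [gC gCE] := restrict_order_iso g C.
have [T [isoT TS]] := commutative_order_iso gC (big_three bC).
pose F x := if insub x is Some u then val (T u) else 0.
exists F; apply: (impl_of_iso isoT) => [S|x]; first by rewrite TS gCE.
by rewrite /F valK.
Qed.

Lemma impl_unique C F F' : big C -> implements g C F -> implements g C F' ->
  forall x, context_set C x -> F x = F' x.
Proof.
move=> bC /iso_of_impl[T [isoT TS TF]] /iso_of_impl[T' [isoT' TS' TF']] x Cx.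
have TT' : T = T'.
  apply: star_isomorphism_unique isoT isoT'.2 _; first exact: big_three.
  by move=> S; rewrite TS TS'.
pose u : context_alg C := exist _ x (mem_set Cx).
by rewrite -[x]/(val u) -TF -TF' TT'.
Qed.

Lemma impl_inverse (h : order_iso (context B) (context A)) C F :
  cancel g h -> cancel h g -> implements g C F ->
  exists G : B -> A, implements h (g C) G /\ forall x, context_set C x -> G (F x) = x.
Proof.
move=> gh hg iF; pose G y := xget 0 [set x | context_set C x /\ F x = y].
have GF x : context_set C x -> G (F x) = x.
  move=> Cx; rewrite /G; case: xgetP => [z _ [Cz Fz]|/(_ x)]; first exact: (impl_inj iF).
  by move=> H; exfalso; apply: H.
have up y : context_set (g C) y -> exists2 x, context_set C x & y = F x.
  by rewrite -(impl_image iF (lexx _)) => -[x Cx <-]; exists x.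
have hF := impl_hom iF.
exists G; split=> //; split.
- split.
  + by rewrite -(hom_on1 hF) GF //; exact: context1.
  + move=> a _ _ /up[x Cx ->] /up[y Cy ->].
    by rewrite -(hom_onL hF) // !GF //; exact: contextL.
  + move=> _ _ /up[x Cx ->] /up[y Cy ->].
    by rewrite -(hom_onM hF) // !GF //; exact: contextM.
  + move=> _ /up[x Cx ->].
    by rewrite -(hom_on_star hF) // !GF //; exact: context_star.
- by move=> _ _ /up[x Cx ->] /up[y Cy ->]; rewrite !GF // => ->.
- move=> D le_D; have le_C : (h D <= C)%O by rewrite -(oiso_mono g) hg.
  have hDC x : context_set (h D) x -> context_set C x by move: le_C => /context_leP; exact.
  rewrite -{1}(hg D) -(impl_image iF le_C); apply/seteqP; split.
    by move=> _ [_ [x Dx <-] <-]; rewrite GF //; exact: hDC.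
  by move=> x Dx; exists (F x); [exists x|rewrite GF //; exact: hDC].
Qed.

(* [C1 p] and [C2 (1 - p)] commute, so they lie in a common context. *)
Lemma impl_agree_split C1 C2 F1 F2 p : projection p -> p <> 0 -> 1 - p <> 0 ->
  context_set C1 p -> context_set C2 p -> rich C1 p -> rich C2 (1 - p) ->
  implements g C1 F1 -> implements g C2 F2 -> F1 p = F2 p.
Proof.
move=> pp p0 q0 C1p C2p [x C1x nx] [y C2y ny] i1 i2.
have [ppp ps] := pp; pose q := 1 - p.
have pq : p * q = 0 by rewrite /q mulrBr mulr1 ppp subrr.
have qp : q * p = 0 by rewrite /q mulrBl mul1r ppp subrr.
have [qq qs] := projectionC pp; rewrite -/q in qq qs.
have C1q : context_set C1 q by apply: contextB => //; exact: context1.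
have C2q : context_set C2 q by apply: contextB => //; exact: context1.
pose M := [set z | exists u v, [/\ context_set C1 u, context_set C2 v & z = p * u + q * v]].
have comm1 u : context_set C1 u -> u * p = p * u /\ u * q = q * u.
  by move=> C1u; split; apply: (@context_comm _ _ C1).
have comm2 u : context_set C2 u -> u * p = p * u /\ u * q = q * u.
  by move=> C2u; split; apply: (@context_comm _ _ C2).
have mulM u v u' v' : context_set C1 u -> context_set C2 v ->
    context_set C1 u' -> context_set C2 v' ->
    (p * u + q * v) * (p * u' + q * v') = p * (u * u') + q * (v * v').
  move=> C1u C2v C1u' C2v'; rewrite mulrDl !mulrDr -!mulrA.
  rewrite [u * (p * u')]mulrA (comm1 u C1u).1 -[p * u * u']mulrA mulrA ppp.
  rewrite [u * (q * v')]mulrA (comm1 u C1u).2 -[q * u * v']mulrA.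
  rewrite [p * (q * (u * v'))]mulrA pq mul0r addr0.
  rewrite [v * (p * u')]mulrA (comm2 v C2v).1 -[p * v * u']mulrA.
  rewrite [q * (p * (v * u'))]mulrA qp mul0r add0r.
  rewrite [v * (q * v')]mulrA (comm2 v C2v).2 -[q * v * v']mulrA.
  by rewrite [q * (q * (v * v'))]mulrA qq.
have [||E ME] := @commuting_context _ _ M.
- move=> _ [u [v [C1u C2v ->]]]; exists (star u), (star v).
  split; [exact: context_star|exact: context_star|].
  rewrite starD !starM ps qs.
  by rewrite (comm1 _ (context_star C1u)).1 (comm2 _ (context_star C2v)).2.
- move=> _ _ [u [v [C1u C2v ->]]] [u' [v' [C1u' C2v' ->]]]; rewrite !mulM //.
  by rewrite (context_comm C1u C1u') (context_comm C2v C2v').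
have Ep : context_set E p.
  apply: ME; exists 1, 0; rewrite mulr1 mulr0 addr0.
  by split=> //; [exact: context1|exact: context0].
have Epx : context_set E (p * x).
  by apply: ME; exists x, 0; rewrite mulr0 addr0; split=> //; exact: context0.
have Eqy : context_set E (q * y).
  by apply: ME; exists 0, y; rewrite mulr0 add0r; split=> //; exact: context0.
(* Both meets contain p and are big, by [p * x] and [q * y] respectively. Uniqueness on each
   compares [F1] and [F2] with one map on E. *)
pose K1 := context_meet E C1; pose K2 := context_meet E C2.
have bK1 : big K1.
  by apply: (rich_big pp p0 q0 _ _ nx); split=> //; exact: contextM.
have bK2 : big K2.
  apply: (rich_big (projectionC pp) q0 _ _ _ ny).
  - by rewrite subKr.
  - by split=> //; apply: contextB => //; exact: context1.
  - by split=> //; exact: contextM.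
have [FE iE] := impl_exists (big_le (context_meet_lel _ _) bK1).
transitivity (FE p); last first.
  apply: (impl_unique bK2); last by split.
    by apply: impl_sub iE; exact: context_meet_lel.
  by apply: impl_sub i2; exact: context_meet_ler.
apply: (impl_unique bK1); last by split.
  by apply: impl_sub i1; exact: context_meet_ler.
by apply: impl_sub iE; exact: context_meet_lel.
Qed.

End BigContexts.

(** * Agreement of the local maps on overlaps *)

Section Gluing.
Variables (R : realType) (A B : cstarAlgType R).
Variable g : order_iso (context A) (context B).
Implicit Types (C : context A) (F : A -> B).

Lemma impl_projection C F p : implements g C F -> context_set C p -> projection p ->
  projection (F p).
Proof.
move=> iF Cp [pp ps]; have hF := impl_hom iF.
by split; rewrite -?(hom_onM hF) -?(hom_on_star hF) // ?pp ?ps.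
Qed.

Lemma impl_compl C F p : implements g C F -> context_set C p -> F (1 - p) = 1 - F p.
Proof.
by move=> iF Cp; have hF := impl_hom iF; rewrite (hom_onB hF) ?(hom_on1 hF) //; exact: context1.
Qed.

Lemma impl_neq0 C F p : implements g C F -> context_set C p -> p <> 0 -> F p <> 0.
Proof.
move=> iF Cp p0; rewrite -(hom_on0 (impl_hom iF)) => /(impl_inj iF) E1.
by apply/p0/E1 => //; exact: context0.
Qed.

Lemma impl_rich C F p : implements g C F -> context_set C p -> rich C p ->
  rich (g C) (F p).
Proof.
move=> iF Cp [x Cx nx]; have hF := impl_hom iF; exists (F x); first exact: (impl_mem iF).
move=> [a]; rewrite -(hom_onM hF) // -(hom_onZ a hF) // => /(impl_inj iF) E1.
by apply: nx; exists a; apply: E1; [exact: contextM|exact: contextZ].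
Qed.

(* Transported to [B], this is the situation of [impl_agree_split] for the inverse. *)
Lemma impl_not_swapped C1 C2 F1 F2 p : projection p -> p <> 0 -> 1 - p <> 0 ->
  context_set C1 p -> context_set C2 p -> rich C1 p -> rich C2 p ->
  implements g C1 F1 -> implements g C2 F2 -> F2 p <> 1 - F1 p.
Proof.
move=> pp p0 q0 C1p C2p r1 r2 i1 i2 F12; pose q := F1 p.
have [h [gh hg]] := order_iso_inverse g.
have [G1 [j1 GF1]] := impl_inverse gh hg i1; have [G2 [j2 GF2]] := impl_inverse gh hg i2.
have q2 : q = 1 - F2 p by rewrite F12 subKr.
have C1q : context_set (g C1) q by exact: (impl_mem i1).
have C2q : context_set (g C2) q.
  by rewrite q2; apply: contextB; [exact: context1|exact: (impl_mem i2)].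
have Gq : G1 q = G2 q.
  apply: (impl_agree_split _ _ _ _ _ _ _ j1 j2) => //.
  - exact: impl_projection i1 C1p pp.
  - exact: impl_neq0 i1 C1p p0.
  - rewrite -(impl_compl i1) //; apply: (impl_neq0 i1) q0.
    by apply: contextB => //; exact: context1.
  - exact: impl_rich.
  - by rewrite q2 subKr; exact: impl_rich.
(* Agreement of the inverses at q reads [p = 1 - p], so [p = p * p = p * (1 - p) = 0]. *)
move: Gq; rewrite GF1 // q2 -(impl_compl i2) // GF2; last first.
  by apply: contextB => //; exact: context1.
move=> E1; apply: p0; have [ppp _] := pp.
by rewrite -ppp {2}E1 mulrBr mulr1 ppp subrr.
Qed.

(** [F2 p] is a projection in the span of [F1 p] and its complement, so both coefficients are 0 or
    1; equal coefficients would make [F2 p] trivial. *)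
Lemma impl_same_or_swapped C1 C2 C F1 F2 p : projection p -> p <> 0 -> 1 - p <> 0 ->
  (C <= C1)%O -> (C <= C2)%O -> context_set C p ->
  (forall x, context_set C x -> exists a b : R[i], x = a *: p + b *: (1 - p)) ->
  implements g C1 F1 -> implements g C2 F2 -> F2 p = F1 p \/ F2 p = 1 - F1 p.
Proof.
move=> pp p0 q0 le1 le2 Cp dec /(impl_sub le1) i1 /(impl_sub le2) i2.
have Cq : context_set C (1 - p) by apply: contextB => //; exact: context1.
have [x Cx F12] : (F1 @` context_set C) (F2 p).
  by rewrite (impl_image i1 (lexx _)); exact: (impl_mem i2).
have [a [b xE]] := dec _ Cx; have h1 := impl_hom i1.
have F2E : F2 p = a *: F1 p + b *: (1 - F1 p).
  rewrite -F12 xE (hom_onL h1) //; last exact: contextZ.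
  by rewrite (hom_onZ _ h1) // (impl_compl i1).
have [qq _] := impl_projection i1 Cp pp; have q1 := impl_neq0 i1 Cp p0.
have q2 := impl_neq0 i1 Cq q0; rewrite (impl_compl i1) // in q2.
have [F2F2 _] := impl_projection i2 Cp pp.
have n2 := impl_neq0 i2 Cp p0.
have n2' := impl_neq0 i2 Cq q0; rewrite (impl_compl i2) // in n2'.
move: F2E F2F2 n2 n2' qq q1 q2; move: (F1 p) (F2 p) => q r -> rr r0 r1 qq q1 q2.
have qq' : q * (1 - q) = 0 by rewrite mulrBr mulr1 qq subrr.
have qq'' : (1 - q) * (1 - q) = 1 - q by rewrite mulrBl mul1r qq' subr0.
have q'q : (1 - q) * q = 0 by rewrite mulrBl mul1r qq subrr.
have mulq (c d : R[i]) : q * (c *: q + d *: (1 - q)) = c *: q.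
  by rewrite mulrDr -!scalerAr qq qq' scaler0 addr0.
have mulq' (c d : R[i]) : (1 - q) * (c *: q + d *: (1 - q)) = d *: (1 - q).
  by rewrite mulrDr -!scalerAr q'q qq'' scaler0 add0r.
have aa : a * a = a.
  have := congr1 (fun z => q * z) rr; rewrite /= mulrA !mulq -scalerAl mulq scalerA.
  move=> /eqP; rewrite -subr_eq0 -scalerBl scaler_eq0 subr_eq0.
  by move=> /orP[/eqP //|/eqP].
have bb : b * b = b.
  have := congr1 (fun z => (1 - q) * z) rr.
  rewrite /= mulrA !mulq' -scalerAl mulq' scalerA.
  move=> /eqP; rewrite -subr_eq0 -scalerBl scaler_eq0 subr_eq0.
  by move=> /orP[/eqP //|/eqP].
have idem (c : R[i]) : c * c = c -> c = 0 \/ c = 1.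
  move=> /eqP; rewrite -subr_eq0 -{3}[c]mulr1 -mulrBr mulf_eq0 subr_eq0.
  by move=> /orP[]/eqP; [left|right].
case: (idem _ aa) => aE; case: (idem _ bb) => bE; subst a b.
- by exfalso; apply: r0; rewrite !scale0r addr0.
- by right; rewrite scale0r add0r scale1r.
- by left; rewrite scale0r addr0 scale1r.
- by exfalso; apply: r1; rewrite !scale1r subrKC subrr.
Qed.

(** On a two-dimensional overlap, four cases: if the same one of p and 1 - p is rich in both
    contexts, [impl_not_swapped] refutes the swap; if opposite ones are, [impl_agree_split] gives
    equality. *)
Lemma impl_agree C1 C2 F1 F2 x : big C1 -> big C2 ->
  implements g C1 F1 -> implements g C2 F2 ->
  context_set C1 x -> context_set C2 x -> F1 x = F2 x.
Proof.
move=> b1 b2 i1 i2 C1x C2x; pose C := context_meet C1 C2.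
have le1 : (C <= C1)%O := context_meet_lel _ _.
have le2 : (C <= C2)%O := context_meet_ler _ _.
have h1 := impl_hom i1; have h2 := impl_hom i2.
have [bC|/not_big_cases[scal|[p [pp Cp p0 q0 dec]]]] := pselect (big C).
- by apply: (impl_unique bC); [exact: impl_sub i1|exact: impl_sub i2|split].
- have [|a ->] := scal x; first by split.
  by rewrite (hom_on_scalar _ h1) (hom_on_scalar _ h2).
have [C1p C2p] := Cp.
have C1q : context_set C1 (1 - p) by apply: contextB => //; exact: context1.
have C2q : context_set C2 (1 - p) by apply: contextB => //; exact: context1.
suff F12 : F1 p = F2 p.
  have [|a [b ->]] := dec x; first by split.
  rewrite (hom_onL h1) ?(hom_onL h2) //; try exact: contextZ.
  by rewrite (hom_onZ _ h1) // (hom_onZ _ h2) // (impl_compl i1) // (impl_compl i2) // F12.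
have qq := projectionC pp; have p0' : 1 - (1 - p) <> 0 by rewrite subKr.
have [//|sw] := impl_same_or_swapped pp p0 q0 le1 le2 Cp dec i1 i2.
have sw' : F2 (1 - p) = 1 - F1 (1 - p) by rewrite (impl_compl i1) // (impl_compl i2) // sw.
case: (big_rich b1 C1p) => r1; case: (big_rich b2 C2p) => r2.
- by case: (impl_not_swapped pp p0 q0 C1p C2p r1 r2 i1 i2).
- exact: (impl_agree_split pp p0 q0 C1p C2p r1 r2 i1 i2).
- have r2' : rich C2 (1 - (1 - p)) by rewrite subKr.
  have := impl_agree_split qq q0 p0' C1q C2q r1 r2' i1 i2.
  by rewrite (impl_compl i1) // (impl_compl i2) // => /subrI.
- by case: (impl_not_swapped qq q0 p0' C1q C2q r1 r2 i1 i2).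
Qed.

End Gluing.

Section CornerScalars.
Variables (R : realType) (A : cstarAlgType R).
Variables (C : context A) (p : A).
Hypotheses (pp : projection p) (p0 : p <> 0) (q0 : 1 - p <> 0).
Hypothesis dec : forall x, context_set C x ->
  exists a b : R[i], x = a *: p + b *: (1 - p).
Hypothesis maximal : ~ exists2 C' : context A, (C <= C')%O & big C'.

(** For self-adjoint y, p and [p y p] lie in a common context, which contains C; it would be big if
    [p y p] were not a multiple of p. Real and imaginary parts give the general case. *)
Lemma corner_scalar x : exists a : R[i], p * x * p = a *: p.
Proof.
have [ppp ps] := pp.
have sa_case y : sa y -> exists a : R[i], p * y * p = a *: p.
  move=> sy; apply: contrapT => ny; apply: maximal.
  have sz : star (p * y * p) = p * y * p by rewrite !starM ps sy mulrA.
  have comm_pz : p * (p * y * p) = p * y * p * p.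
    by rewrite !mulrA ppp -[in RHS]mulrA ppp.
  have [||E ME] := @commuting_context _ _ [set z | z = p \/ z = p * y * p].
  - by move=> _ [->|->]; [left|right].
  - by move=> _ _ [->|->] [->|->].
  have Ep : context_set E p by apply: ME; left.
  exists E.
    apply/context_leP => z /dec[a [b ->]]; apply: contextL => //; apply: contextZ.
    by apply: contextB => //; exact: context1.
  apply: (@rich_big _ _ E p (y * p)) => //; first by apply: ME; right; rewrite mulrA.
  by move=> [a E1]; apply: ny; exists a; rewrite -mulrA.
have [a aE] := sa_case _ (sa_repart x); have [b bE] := sa_case _ (sa_impart x).
exists (a + 'i * b).
rewrite (repart_impart x) mulrDr mulrDl aE -scalerAr -scalerAl bE scalerA.
by rewrite -scalerDl.
Qed.

End CornerScalars.

Lemma star_isomorphic_sym (K : numClosedFieldType) (U V : starAlgType K) :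
  star_isomorphic U V -> star_isomorphic V U.
Proof.
move=> [f [[h fh hf] fm]]; exists h; exact: star_isomorphism_inverse fm fh hf.
Qed.

(** * Algebras in which a projection and its complement have scalar corners *)

Section Exclusion.
Variables (R : realType) (A : cstarAlgType R).
Variables p q : A.
Hypotheses (pp : projection p) (qE : q = 1 - p) (p0 : p <> 0) (q0 : q <> 0).
Hypothesis corner1 : forall x, exists a : R[i], p * x * p = a *: p.
Hypothesis corner2 : forall x, exists a : R[i], q * x * q = a *: q.

Let ppE : p * p = p. Proof. by case: pp. Qed.
Let ps : star p = p. Proof. by case: pp. Qed.
Let qqE : q * q = q. Proof. by rewrite qE; case: (projectionC pp). Qed.
Let qs : star q = q. Proof. by rewrite qE; case: (projectionC pp). Qed.
Let pq : p * q = 0. Proof. by rewrite qE mulrBr mulr1 ppE subrr. Qed.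
Let qp : q * p = 0. Proof. by rewrite qE mulrBl mul1r ppE subrr. Qed.
Let p1q : p + q = 1. Proof. by rewrite qE addrC subrK. Qed.

Let split4 x : x = p * x * p + p * x * q + (q * x * p + q * x * q).
Proof. by rewrite -!mulrDr p1q !mulr1 -mulrDl p1q mul1r. Qed.

Let scale_inj (y : A) (a b : R[i]) : y <> 0 -> a *: y = b *: y -> a = b.
Proof.
move=> y0 /eqP; rewrite -subr_eq0 -scalerBl scaler_eq0 subr_eq0.
by move=> /orP[/eqP //|/eqP].
Qed.

Lemma corner_C2 : (forall x, p * x * q = 0) -> star_isomorphic A (C2 R).
Proof.
move=> pxq; apply: star_isomorphic_sym.
have qxp x : q * x * p = 0.
  by have := congr1 star (pxq (star x)); rewrite !starM starK qs ps star0 mulrA.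
pose h (u : C2 R) : A := u.1 *: p + u.2 *: q.
have hM (a b c d : R[i]) :
    (a *: p + b *: q) * (c *: p + d *: q) = (a * c) *: p + (b * d) *: q.
  rewrite mulrDl !mulrDr -!scalerAl -!scalerAr !scalerA ppE pq qp qqE.
  by rewrite !scaler0 addr0 add0r.
have hL (k a b c d : R[i]) : (k * a + c) *: p + (k * b + d) *: q =
    k *: (a *: p + b *: q) + (c *: p + d *: q).
  by rewrite !scalerDl [k *: (_ + _)]scalerDr !scalerA addrACA.
exists h; split; last first.
  split=> [a x y||x].
  - exact: hL.
  - by split=> [|x y]; rewrite /h /= ?hM // !scale1r p1q.
  - by rewrite /h starD !starZ ps qs.
apply: injective_surjective_bijective => [[a b] [c d] /= E1|x].
  have := congr1 (fun z => p * z) E1; have := congr1 (fun z => q * z) E1.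
  rewrite /h /= !mulrDr -!scalerAr ppE pq qp qqE !scaler0 !addr0 !add0r.
  by move=> /(scale_inj q0) -> /(scale_inj p0) ->.
have [a aE] := corner1 x; have [b bE] := corner2 x.
by exists (a, b); rewrite /h /= [RHS]split4 pxq qxp addr0 add0r aE bE.
Qed.

Section Corner.
Variable w : A.
Hypotheses (pw : p * w = w) (wq : w * q = w) (w0 : w <> 0).

Let qw : q * w = 0. Proof. by rewrite -pw mulrA qp mul0r. Qed.
Let wp : w * p = 0. Proof. by rewrite -wq -mulrA qp mulr0. Qed.
Let ww : w * w = 0. Proof. by rewrite -{2}pw mulrA wp mul0r. Qed.
Let w'p : star w * p = star w. Proof. by rewrite -{1}ps -starM pw. Qed.
Let qw' : q * star w = star w. Proof. by rewrite -{1}qs -starM wq. Qed.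
Let pw' : p * star w = 0. Proof. by rewrite -qw' mulrA pq mul0r. Qed.
Let w'w' : star w * star w = 0. Proof. by rewrite -starM ww star0. Qed.

(** The square of the self-adjoint [h = w + star w] is a scalar c, hence c is real. If c were not
    positive, [nrm_sqr_le] with the root of -c would give h = 0, and then [w = p h = 0]. *)
Let partial_isometry : exists2 r : R, 0 < r &
  star w * w = r%:C *: q /\ w * star w = r%:C *: p.
Proof.
have [c cE] := corner2 (star w * w); have [c' c'E] := corner1 (w * star w).
have {}cE : star w * w = c *: q by rewrite -cE mulrA qw' -mulrA wq.
have {}c'E : w * star w = c' *: p by rewrite -c'E mulrA pw -mulrA w'p.
(* The two bracketings of [w * star w * w] agree. *)
have cc' : c' = c.
  apply: (scale_inj w0); rewrite -{1}pw scalerAl -c'E -mulrA cE -scalerAr.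
  by rewrite wq.
rewrite {}cc' {c'} in c'E.
have w'w0 : star w * w <> 0.
  move=> E1; apply: w0; apply: nrm0_eq0; apply/eqP.
  by rewrite -sqrf_eq0 -nrm_starM E1 nrm0.
pose h := w + star w; have sh : sa h by rewrite /h /sa starD starK addrC.
have hh : h ^+ 2 = c%:A.
  rewrite expr2 /h mulrDl !mulrDr ww w'w' cE c'E add0r addr0 -scalerDr.
  by rewrite p1q.
have cR : conjc c = c.
  have : star (h ^+ 2) = h ^+ 2 by rewrite expr2 starM sh.
  by rewrite hh starZ star1 => /scale_inj; apply; apply/eqP; rewrite oner_eq0.
have {}cR : c = (complex.Re c)%:C.
  case: c cR {cE c'E hh w'w0} => r s /= [] sE; congr (_ +i* _).
  by lra.
exists (complex.Re c); last by rewrite -cR.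
rewrite ltNge; apply/negP => c0; apply: w'w0.
have h0 : h = 0.
  apply: nrm0_eq0; apply/eqP; rewrite -sqrf_eq0 eq_le sqr_ge0 andbT.
  apply: le_trans (nrm_sqr_le sh (sa_rsc A (Num.sqrt (- complex.Re c))) (rscC _ _)) _.
  rewrite -rmorphXn /= sqr_sqrtr ?oppr_ge0 // hh {1}cR -[_%:A]/(rsc A _).
  by rewrite -rmorphD subrr rmorph0 nrm0.
have : p * h = 0 by rewrite h0 mulr0.
by rewrite /h mulrDr pw pw' addr0 => ->; rewrite mulr0.
Qed.

(** Rescaling w gives v with [v * star v = p] and [star v * v = q]. Then p, v, [star v] and q are
    matrix units, and the scalar corners show that they span A. *)
Lemma corner_M2 : star_isomorphic A (B_C2 R).
Proof.
apply: star_isomorphic_sym; have [r r0 [w'w wR]] := partial_isometry.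
pose s := (Num.sqrt r)^-1; have sr : s * s * r = 1.
  rewrite /s -invfM -expr2 sqr_sqrtr ?ltW // mulVf // gt_eqF //.
pose v := s%:C *: w; pose v' := s%:C *: star w.
have srC : s%:C * s%:C * r%:C = 1 :> R[i] by rewrite -!rmorphM /= sr.
have vs : star v = v' by rewrite /v starZ (CrealP _) // complex_real.
have v's : star v' = v by rewrite -vs starK.
have v'v : v' * v = q by rewrite -scalerAl -scalerAr w'w !scalerA srC scale1r.
have vv' : v * v' = p by rewrite -scalerAl -scalerAr wR !scalerA srC scale1r.
have pv : p * v = v by rewrite -scalerAr pw.
have vq : v * q = v by rewrite -scalerAl wq.
have qv : q * v = 0 by rewrite -scalerAr qw scaler0.
have vp : v * p = 0 by rewrite -scalerAl wp scaler0.
have vv : v * v = 0 by rewrite -scalerAl -scalerAr ww !scaler0.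
have v'p : v' * p = v' by rewrite -scalerAl w'p.
have qv' : q * v' = v' by rewrite -scalerAr qw'.
have pv' : p * v' = 0 by rewrite -scalerAr pw' scaler0.
have v'q : v' * q = 0 by rewrite -{1}v'p -mulrA pq mulr0.
have v'v' : v' * v' = 0 by rewrite -scalerAl -scalerAr w'w' !scaler0.
pose h (m : 'M[R[i]]_2) : A :=
  m 0 0 *: p + m 0 1 *: v + (m 1 0 *: v' + m 1 1 *: q).
clearbody v v'.
have v0 : v <> 0 by move=> E1; apply: p0; rewrite -vv' E1 mul0r.
have v'0 : v' <> 0 by move=> E1; apply: p0; rewrite -vv' E1 mulr0.
have pX a b c d : p * (a *: p + b *: v + (c *: v' + d *: q)) = a *: p + b *: v.
  by rewrite !mulrDr -!scalerAr ppE pv pv' pq !scaler0 !addr0.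
have qX a b c d : q * (a *: p + b *: v + (c *: v' + d *: q)) = c *: v' + d *: q.
  by rewrite !mulrDr -!scalerAr qp qv qv' qqE !scaler0 !add0r.
exists (h : B_C2 R -> A); split.
  apply: injective_surjective_bijective => [m n E1|y].
    apply/matrixP; have [E00 E01 E10 E11] : [/\ m 0 0 = n 0 0, m 0 1 = n 0 1,
        m 1 0 = n 1 0 & m 1 1 = n 1 1].
      have pE := congr1 (fun z => p * z) E1; have qE' := congr1 (fun z => q * z) E1.
      rewrite /= !pX in pE; rewrite /= !qX in qE'.
      have := congr1 (fun z => z * p) pE; have := congr1 (fun z => z * q) pE.
      have := congr1 (fun z => z * p) qE'; have := congr1 (fun z => z * q) qE'.
      rewrite /= !mulrDl -!scalerAl ppE vp vq pq v'p v'q qp qqE !scaler0 !addr0 !add0r.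
      by move=> /(scale_inj q0) -> /(scale_inj v'0) -> /(scale_inj v0) -> /(scale_inj p0) ->.
    move=> i j; have ord2 (k : 'I_2) : k = 0 \/ k = 1.
      by case: k => [[|[|//]] ?]; [left|right]; exact: val_inj.
    by case: (ord2 i) => ->; case: (ord2 j) => ->.
  have [a aE] := corner1 y; have [d dE] := corner2 y.
  (* Multiplication by [v'] or v moves an off-diagonal corner to a diagonal one, where it is
     scalar. *)
  have [b bE] := corner1 (y * v'); have [c cE] := corner2 (y * v).
  have {}bE : p * y * q = b *: v.
    by rewrite -v'v !mulrA -{1}v'p !mulrA -[p * y * v']mulrA bE -scalerAl pv.
  have {}cE : q * y * p = c *: v'.
    by rewrite -vv' !mulrA -{1}vq !mulrA -[q * y * v]mulrA cE -scalerAl qv'.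
  exists (\matrix_(i, j) if i == 0 then (if j == 0 then a else b)
                         else (if j == 0 then c else d)).
  by rewrite /h !mxE /= -aE -bE -cE -dE -split4.
split=> [a m n||m].
- rewrite /h !mxE !scalerDl !scalerDr !scalerA.
  by rewrite [RHS]addrACA; congr (_ + _); exact: addrACA.
- split=> [|m n]; first by rewrite /h !mxE /= !scale1r !scale0r addr0 add0r p1q.
  have mE i j : (m * n : B_C2 R) i j = m i 0 * n 0 j + m i 1 * n 1 j.
    rewrite -[m * n]/((m : 'M[R[i]]_2) *m n) mxE !big_ord_recl big_ord0 addr0.
    by congr (_ + m _ _ * n _ _); exact: val_inj.
  have vX a b c d : v * (a *: p + b *: v + (c *: v' + d *: q)) = c *: p + d *: v.
    by rewrite !mulrDr -!scalerAr vp vv vv' vq !scaler0 !add0r.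
  have v'X a b c d : v' * (a *: p + b *: v + (c *: v' + d *: q)) = a *: v' + b *: q.
    by rewrite !mulrDr -!scalerAr v'p v'v v'v' v'q !scaler0 !addr0.
  rewrite /h !mE !mulrDl -!scalerAl pX vX v'X qX !scalerDr !scalerDl !scalerA.
  by congr (_ + _); exact: addrACA.
- have sE i j : (star m : 'M[R[i]]_2) i j = (m j i)^*%R by rewrite /star /= !mxE.
  by rewrite /h !sE !starD !starZ ps qs vs v's addrACA.
Qed.

End Corner.

End Exclusion.

Section Global.
Variables (R : realType) (A B : cstarAlgType R).
Implicit Types (C : context A) (F : A -> B) (x p : A).

Lemma context_dichotomy C : ~ star_isomorphic A (C2 R) -> ~ star_isomorphic A (B_C2 R) ->
  (exists2 C', (C <= C')%O & big C') \/
  (forall x, context_set C x -> exists a : R[i], x = a%:A).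
Proof.
move=> hC2 hM2; have [|nb] := pselect (exists2 C', (C <= C')%O & big C'); first by left.
right; have nbC : ~ big C by move=> bC; apply: nb; exists C.
have [//|[p [pp Cp p0 q0 dec]]] := not_big_cases nbC; exfalso.
have corner1 := corner_scalar pp p0 q0 dec nb.
have dec' x : context_set C x -> exists a b : R[i], x = a *: (1 - p) + b *: (1 - (1 - p)).
  by move=> /dec[a [b ->]]; exists b, a; rewrite subKr addrC.
have p0' : 1 - (1 - p) <> 0 by rewrite subKr.
have corner2 := corner_scalar (projectionC pp) q0 p0' dec' nb.
have [pxq|] := pselect (forall x, p * x * (1 - p) = 0).
  by apply: hC2; exact: (corner_C2 pp erefl p0 q0 corner1 corner2 pxq).
move=> /existsNP[x pxq]; apply: hM2.
have [ppE _] := pp; have [qqE _] := projectionC pp.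
apply: (corner_M2 pp erefl p0 q0 corner1 corner2 _ _ pxq).
  by rewrite !mulrA ppE.
by rewrite -mulrA qqE.
Qed.

Variable g : order_iso (context A) (context B).

(** The scalars form the least context, and g preserves least elements; in B that context is
    realized by the elements on which all characters of [g C] agree. *)
Lemma scalar_image C : (forall x, context_set C x -> exists a : R[i], x = a%:A) ->
  forall y, context_set (g C) y -> exists a : R[i], y = a%:A.
Proof.
move=> scal y gy; have [h [gh hg]] := order_iso_inverse g.
have [l _] := spectrum_nonempty (context_alg (g C)).
pose S := supcontext (const_on (setT : set (spectrum (context_alg (g C))))).
have le_S : (g C <= S)%O.
  rewrite -[S]hg oiso_mono; apply/context_leP => _ /scal[a ->].
  by apply: contextZ; exact: context1.
have [u Su <-] : context_set S y by move: y gy; apply/context_leP.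
exists (ev l u); rewrite -[RHS]/(val ((ev l u)%:A : context_alg (g C))); congr val.
by apply: ev_inj => m; rewrite evZ ev1 mulr1; exact: Su.
Qed.

Lemma scalar_implements C F : (forall x, context_set C x -> exists a : R[i], x = a%:A) ->
  (forall a : R[i], F a%:A = a%:A) -> implements g C F.
Proof.
move=> scal FE.
split.
- split.
  + by rewrite -(scale1r 1) FE scale1r.
  + by move=> a _ _ /scal[b ->] /scal[c ->]; rewrite scalerA -scalerDl !FE scalerDl scalerA.
  + move=> _ _ /scal[b ->] /scal[c ->].
    by rewrite -!scalerAl !mul1r scalerA !FE -scalerAl mul1r scalerA.
  + by move=> _ /scal[b ->]; rewrite starZ star1 !FE starZ star1.
- by move=> _ _ /scal[b ->] /scal[c ->]; rewrite !FE => /(fmorph_inj (in_alg B)) ->.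
- move=> C' /context_leP le_C; have scal' x : context_set C' x -> exists a : R[i], x = a%:A.
    by move=> /le_C /scal.
  apply/seteqP; split=> [_ [_ /scal'[a ->] <-]|y].
    by rewrite FE; apply: contextZ; exact: context1.
  move=> /(scalar_image scal')[a ->]; exists (a%:A); last exact: FE.
  by apply: contextZ; exact: context1.
Qed.

Theorem order_iso_implemented : ~ star_isomorphic A (C2 R) -> ~ star_isomorphic A (B_C2 R) ->
  exists F, forall C, implements g C F.
Proof.
move=> hC2 hM2.
(* The second clause covers scalars, which lie in no big context when A is one-dimensional. By
   [context_dichotomy] every normal element falls under a clause; elsewhere F is 0. *)
pose val_at x := [set y : B | (exists C F, [/\ big C, context_set C x, implements g C F &
  y = F x]) \/ (exists a : R[i], x = a%:A /\ y = a%:A)].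
pose F x := xget 0 (val_at x).
have F_big C F1 x : big C -> context_set C x -> implements g C F1 -> F x = F1 x.
  move=> bC Cx i1; rewrite /F; case: xgetP => [y _|/(_ (F1 x))]; last first.
    by move=> H; exfalso; apply: H; left; exists C, F1.
  move=> [[C' [F' [bC' C'x i' ->]]]|[a [-> ->]]]; first exact: (impl_agree bC' bC i' i1).
  by rewrite (hom_on_scalar _ (impl_hom i1)).
have F_scalar (a : R[i]) : F a%:A = a%:A.
  rewrite /F; case: xgetP => [y _|/(_ a%:A)]; last first.
    by move=> H; exfalso; apply: H; right; exists a.
  move=> [[C' [F' [_ _ i' ->]]]|[b [/(fmorph_inj (in_alg A)) -> ->]]] //.
  by rewrite (hom_on_scalar _ (impl_hom i')).
exists F => C; have [[C' le_C bC']|scal] := context_dichotomy C hC2 hM2.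
  apply: (impl_sub le_C); have [F' i'] := impl_exists g bC'.
  by apply: (impl_ext _ i') => x C'x; apply: esym; exact: (F_big C').
exact: scalar_implements.
Qed.

Lemma implements_unique F F' : ~ star_isomorphic A (C2 R) -> ~ star_isomorphic A (B_C2 R) ->
  (forall C, implements g C F) -> (forall C, implements g C F') ->
  forall C x, context_set C x -> F x = F' x.
Proof.
move=> hC2 hM2 iF iF' C x Cx; have [[C' le_C bC']|scal] := context_dichotomy C hC2 hM2.
  by apply: (impl_unique bC' (iF C') (iF' C')); move: x Cx; apply/context_leP.
have [a ->] := scal _ Cx.
by rewrite (hom_on_scalar _ (impl_hom (iF C))) (hom_on_scalar _ (impl_hom (iF' C))).
Qed.

End Global.

(** * Quasi-Jordan isomorphisms *)

(** For self-adjoint u of norm below 1, C contains a self-adjoint root w of [1 - u ^+ 2]. Then F u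
    and F w have squares summing to 1, and [nrm_sqr_le] bounds F u. The C*-identity reduces general
    elements to this case. *)
Lemma star_hom_contractive (R : realType) (A B : cstarAlgType R) (C : context A) (F : A -> B) x :
  star_hom_on C F -> context_set C x -> nrm (F x) <= nrm x.
Proof.
move=> hF; have FC (r : R) y : context_set C y -> F (rsc A r * y) = rsc B r * F y.
  by move=> Cy; rewrite !rscE (hom_onZ _ hF).
have sa_case y : context_set C y -> sa y -> nrm (F y) <= nrm y.
  move=> Cy sy; apply/ler_addgt0Pl => e e0; pose t := e + nrm y.
  have t0 : 0 < t by rewrite ltr_pwDl ?nrm_ge0.
  pose u := rsc A t^-1 * y; have Cu : context_set C u.
    by apply: contextM => //; exact: context_rsc.
  have su : sa u by exact: sa_rscM.
  have u1 : nrm u < 1.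
    by rewrite nrm_rscM ger0_norm ?invr_ge0 ?ltW // mulrC ltr_pdivrMr // mul1r ltrDr.
  pose v : context_alg C := exist _ (u ^+ 2) (mem_set (contextX 2 Cu)).
  have sv : sa v by apply: val_inj; rewrite /= expr2 starM su.
  have v1 : nrm v < 1 by rewrite nrm_val /= nrm_sqr // exprn_ilt1 ?nrm_ge0.
  have [w [_ /(congr1 val) /= sw _ /(congr1 val) /= wE]] :=
    @sqrt_one_minus _ _ (full_context _) v I sv v1.
  have Cw := context_algP w.
  have {}wE : val w * val w = 1 - u ^+ 2 by [].
  have Fu : nrm (F u) <= 1.
    have sFu : sa (F u) by rewrite /sa -(hom_on_star hF) // su.
    have sFw : sa (F (val w)) by rewrite /sa -(hom_on_star hF) // sw.
    have FuFw : F u * F (val w) = F (val w) * F u.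
      by rewrite -!(hom_onM hF) // (context_comm Cu Cw).
    have := nrm_sqr_le sFu sFw FuFw.
    have -> : F u ^+ 2 + F (val w) ^+ 2 = 1.
      rewrite !expr2 -!(hom_onM hF) // -(hom_onD hF); [|exact: contextM|exact: contextM].
      by rewrite wE -expr2 addrC subrK (hom_on1 hF).
    by rewrite nrm1 expr_le1 ?nrm_ge0.
  have yE : y = rsc A t * u.
    by rewrite /u mulrA -rmorphM divff ?rmorph1 ?mul1r // gt_eqF.
  by rewrite {1}yE FC // nrm_rscM ger0_norm ?(ltW t0) // -/t ger_pMr.
move=> Cx; have Cxx : context_set C (star x * x).
  by apply: contextM => //; exact: context_star.
have := sa_case _ Cxx (sa_starM x); rewrite (hom_onM hF) //; last exact: context_star.
rewrite (hom_on_star hF) // !nrm_starM.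
by rewrite ler_sqr ?nnegrE ?nrm_ge0.
Qed.

(** * From quasi-Jordan homomorphisms to *-homomorphisms of contexts *)

Section JordanHom.
Variables (R : realType) (A B : cstarAlgType R).
Variable Q : self_adjoint A -> self_adjoint B.
Hypothesis jQ : quasi_jordan_hom Q.
Implicit Types (C : context A) (x y : A).

Definition jordan_map x : B := if insub x is Some u then val (Q u) else 0.

Definition jordan_extension x : B :=
  jordan_map (repart x) + 'i *: jordan_map (impart x).

Lemma jordan_map_val (u : self_adjoint A) : jordan_map (val u) = val (Q u).
Proof. by rewrite /jordan_map valK. Qed.

Let up x : sa x -> exists u : self_adjoint A, x = val u.
Proof. by move=> /eqP sx; exists (exist _ x sx). Qed.

Lemma sa_jordan_map x : sa x -> sa (jordan_map x).
Proof. by move=> /up[u ->]; rewrite jordan_map_val /sa; exact/eqP/(valP (Q u)). Qed.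

Section On.
Variable C : context A.

Let jC := jQ.2 C.

Lemma jordan_map1 : jordan_map 1 = 1.
Proof. by rewrite -[1 in LHS]/(val (sa_one A)) jordan_map_val jQ.1. Qed.

Lemma jordan_mapD x y : context_set C x -> context_set C y -> sa x -> sa y ->
  jordan_map (x + y) = jordan_map x + jordan_map y.
Proof.
move=> Cu Cv /up[u xE] /up[v yE]; subst x y.
have <- : val (sa_add u v) = val u + val v by [].
by rewrite !jordan_map_val (jordan_add jC Cu Cv).
Qed.

Lemma jordan_mapZ (r : R) x : context_set C x -> sa x ->
  jordan_map (r%:C *: x) = r%:C *: jordan_map x.
Proof.
move=> Cu /up[u xE]; subst x; have <- : val (sa_scale r u) = r%:C *: val u by [].
by rewrite !jordan_map_val (jordan_scale jC).
Qed.

Lemma jordan_mapN x : context_set C x -> sa x -> jordan_map (- x) = - jordan_map x.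
Proof.
by move=> Cx sx; have := jordan_mapZ (-1) Cx sx; rewrite rmorphN rmorph1 !scaleN1r.
Qed.

Let jordan_mapJ x y : context_set C x -> context_set C y -> sa x -> sa y ->
  (2 : R[i]) *: jordan_map (x * y) =
  jordan_map x * jordan_map y + jordan_map y * jordan_map x.
Proof.
move=> Cu Cv /up[u xE] /up[v yE]; subst x y.
have := congr1 val (jordan_mul jC Cu Cv); rewrite -jordan_map_val /= => E1.
have -> : val u * val v = (2^-1 : R[i]) *: (val u * val v + val v * val u).
  have half : (2^-1 : R[i]) + 2^-1 = 1 by field.
  by rewrite (context_comm Cv Cu) scalerDr -scalerDl half scale1r.
by rewrite E1 scalerA divff ?pnatr_eq0 // scale1r !jordan_map_val.
Qed.

(* Comparing [x (x y)] and [(x x) y] gives [[a, [a, c]] = 0] for the images [a], [c]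
   of [x], [y]. As this also holds for [c ^+ 2], the image of [y ^+ 2], the
   skew-adjoint [k := [a, c]] satisfies [2 k ^+ 2 = [a, [a, c ^+ 2]] = 0]. *)
Lemma jordan_map_comm x y : context_set C x -> context_set C y -> sa x -> sa y ->
  jordan_map x * jordan_map y = jordan_map y * jordan_map x.
Proof.
move=> Cx Cy sx sy; have n2 : (2 : R[i]) != 0 by rewrite pnatr_eq0.
have sC u v : context_set C u -> context_set C v -> sa u -> sa v -> sa (u * v).
  by move=> Cu Cv su sv; apply: saM => //; exact: context_comm Cu Cv.
have double z : context_set C z -> sa z ->
    let a := jordan_map x in let c := jordan_map z in
    a * (a * c - c * a) = (a * c - c * a) * a.
  move=> Cz sz a c.
  have Exx := jordan_mapJ Cx Cx sx sx; have Exz := jordan_mapJ Cx Cz sx sz.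
  have Cxx := contextM Cx Cx; have Cxz := contextM Cx Cz.
  have E1 := jordan_mapJ Cxx Cz (sC _ _ Cx Cx sx sx) sz.
  have E2 := jordan_mapJ Cx Cxz sx (sC _ _ Cx Cz sx sz).
  rewrite -/a -/c in Exx Exz E1 E2.
  have {}Exx : jordan_map (x * x) = a * a.
    by apply: (scalerI n2); rewrite Exx scaler_nat mulr2n.
  have key : a * a * c + c * (a * a) + (a * a * c + c * (a * a)) =
      a * (a * c + c * a) + (a * c + c * a) * a.
    by rewrite -mulr2n -scaler_nat -Exx -E1 -mulrA E2 scalerDr scalerAr scalerAl Exz.
  rewrite !(mulrDr, mulrDl) !mulrA in key; rewrite mulrBr mulrBl !mulrA.
  move: key; move: (a * a * c) (a * c * a) (c * a * a) => X Y Z key.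
  have {}key : X + Z = Y + Y.
    apply: (addrI (X + Z)); rewrite key addrACA [X + Y]addrC -addrA addrCA addrA.
    by rewrite -[in RHS]addrA [Z + _]addrC !addrA.
  by apply/eqP; rewrite subr_eq addrAC -key addrK.
set a := jordan_map x; set c := jordan_map y.
have [k kE] : exists k, k = a * c - c * a by exists (a * c - c * a).
have ak : a * k = k * a by rewrite kE; exact: double.
have cc : jordan_map (y * y) = c * c.
  by apply: (scalerI n2); rewrite jordan_mapJ // scaler_nat mulr2n.
have := double _ (contextM Cy Cy) (sC _ _ Cy Cy sy sy); rewrite /= -/a cc.
have -> : a * (c * c) - c * c * a = k * c + c * k.
  by rewrite kE mulrBl mulrBr !mulrA addrA subrK.
have -> : a * (k * c + c * k) = k * (a * c) + a * c * k.
  by rewrite mulrDr mulrA ak -mulrA [a * (c * k)]mulrA.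
have -> : (k * c + c * k) * a = k * (c * a) + c * a * k by rewrite mulrDl -!mulrA -ak.
move=> /eqP; rewrite -subr_eq0 opprD addrACA -mulrBr -mulrBl -kE => /eqP kk2.
have kk : k * k = 0.
  by apply: (scalerI n2); rewrite scaler0 scaler_nat mulr2n.
have sk : star k = - k.
  by rewrite kE starB !starM /a /c !sa_jordan_map // opprB.
suff /eqP : k = 0 by rewrite kE subr_eq0 => /eqP.
by apply: nrm0_eq0; apply/eqP; rewrite -sqrf_eq0 -nrm_starM sk mulNr kk oppr0 nrm0.
Qed.

Lemma jordan_mapM x y : context_set C x -> context_set C y -> sa x -> sa y ->
  jordan_map (x * y) = jordan_map x * jordan_map y.
Proof.
move=> Cx Cy sx sy; apply: (@scalerI _ _ (2 : R[i])); first by rewrite pnatr_eq0.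
by rewrite jordan_mapJ // -(jordan_map_comm Cx Cy sx sy) scaler_nat mulr2n.
Qed.

Lemma jordan_extension_parts p q : context_set C p -> context_set C q -> sa p -> sa q ->
  jordan_extension (p + 'i *: q) = jordan_map p + 'i *: jordan_map q.
Proof.
by move=> Cp Cq sp sq; rewrite /jordan_extension; have [-> ->] := parts_unique sp sq erefl.
Qed.

Lemma jordan_extension_hom : star_hom_on C jordan_extension.
Proof.
have sMC u v : context_set C u -> context_set C v -> sa u -> sa v -> sa (u * v).
  by move=> Cu Cv su sv; apply: saM => //; exact: context_comm Cu Cv.
have ii : ('i : R[i]) * 'i = -1 by rewrite -expr2 sqr_i.
have scaleC (V : cstarAlgType R) (k k' : R[i]) (z : V) : k *: (k' *: z) = k' *: (k *: z).
  by rewrite !scalerA mulrC.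
have scale_ii (V : cstarAlgType R) (z : V) : 'i *: ('i *: z) = - z.
  by rewrite scalerA ii scaleN1r.
have FD x y : context_set C x -> context_set C y ->
    jordan_extension (x + y) = jordan_extension x + jordan_extension y.
  move=> Cx Cy; rewrite {1}(repart_impart x) {1}(repart_impart y) addrACA -scalerDr.
  have [rx ry] := (context_repart Cx, context_repart Cy).
  have [ix iy] := (context_impart Cx, context_impart Cy).
  rewrite jordan_extension_parts; [|exact: contextD|exact: contextD| |]; last first.
  - by apply: saD; exact: sa_impart.
  - by apply: saD; exact: sa_repart.
  rewrite !jordan_mapD //; try exact: sa_repart; try exact: sa_impart.
  by rewrite scalerDr addrACA.
have FR (r : R) x : context_set C x ->
    jordan_extension (r%:C *: x) = r%:C *: jordan_extension x.
  move=> Cx; have [rx ix] := (context_repart Cx, context_impart Cx).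
  have -> : r%:C *: x = r%:C *: repart x + 'i *: (r%:C *: impart x).
    by rewrite {1}(repart_impart x) scalerDr; congr (_ + _); exact: scaleC.
  rewrite jordan_extension_parts; [|exact: contextZ|exact: contextZ| |]; last first.
  - by rewrite -rscE; apply: sa_rscM; exact: sa_impart.
  - by rewrite -rscE; apply: sa_rscM; exact: sa_repart.
  rewrite !jordan_mapZ //; try exact: sa_repart; try exact: sa_impart.
  by rewrite /jordan_extension scalerDr; congr (_ + _); exact: scaleC.
have Fi x : context_set C x -> jordan_extension ('i *: x) = 'i *: jordan_extension x.
  move=> Cx; have [rx ix] := (context_repart Cx, context_impart Cx).
  have -> : 'i *: x = - impart x + 'i *: repart x.
    by rewrite {1}(repart_impart x) scalerDr scale_ii addrC.
  rewrite jordan_extension_parts //; [|exact: contextN|apply: saN; exact: sa_impart|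
    exact: sa_repart].
  rewrite jordan_mapN //; last exact: sa_impart.
  by rewrite /jordan_extension scalerDr scale_ii addrC.
split.
- have := jordan_extension_parts (context1 C) (context0 C) (@sa1 _ A) (@sa0 _ A).
  rewrite scaler0 addr0 => ->; rewrite jordan_map1.
  have := jordan_mapD (context0 C) (context0 C) (@sa0 _ A) (@sa0 _ A).
  by rewrite addr0 -[LHS]addr0 => /addrI <-; rewrite scaler0 addr0.
- move=> k x y Cx Cy; rewrite FD //; last exact: contextZ.
  congr (_ + _); rewrite [k]complexE !scalerDl -!scalerA FD; [|exact: contextZ|].
    by rewrite FR // Fi ?FR //; exact: contextZ.
  by apply: contextZ; exact: contextZ.
- move=> x y Cx Cy; have [rx ix] := (context_repart Cx, context_impart Cx).
  have [ry iy] := (context_repart Cy, context_impart Cy).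
  have mulE (V : cstarAlgType R) (p q p' q' : V) : (p + 'i *: q) * (p' + 'i *: q') =
      (p * p' - q * q') + 'i *: (p * q' + q * p').
    rewrite mulrDl !mulrDr -!scalerAl -!scalerAr scalerA ii scaleN1r scalerDr.
    by rewrite [RHS]addrACA [- _ + _]addrC.
  rewrite {1}(repart_impart x) {1}(repart_impart y) mulE /jordan_extension mulE.
  move: (sa_repart x) (sa_impart x) (sa_repart y) (sa_impart y).
  move: rx ix ry iy.
  move: (repart x) (impart x) (repart y) (impart y) => p q p' q' Cp Cq Cp' Cq' sp sq sp' sq'.
  rewrite -/(jordan_extension _) jordan_extension_parts; first last.
  - by apply: saD; exact: sMC.
  - by apply: saB; exact: sMC.
  - by apply: contextD; exact: contextM.
  - by apply: contextB; exact: contextM.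
  rewrite !jordan_mapD; try exact: contextM; try exact: sMC;
    try (by apply: contextN; exact: contextM); try (by apply: saN; exact: sMC).
  rewrite jordan_mapN; [|exact: contextM|exact: sMC].
  by rewrite !jordan_mapM.
- move=> x Cx; have [rx ix] := (context_repart Cx, context_impart Cx).
  have -> : star x = repart x + 'i *: (- impart x) by rewrite scalerN; exact: star_parts.
  rewrite jordan_extension_parts //; [|exact: contextN|exact: sa_repart|
    apply: saN; exact: sa_impart].
  rewrite jordan_mapN //; last exact: sa_impart.
  rewrite /jordan_extension starD starZ !sa_jordan_map; [|exact: sa_impart|exact: sa_repart].
  rewrite scalerN -scaleNr; congr (_ + _ *: _).
  by apply/eqP; rewrite eq_complex /= oppr0 !eqxx.
Qed.

End On.

End JordanHom.

Lemma jordan_extension_cancel (R : realType) (A B : cstarAlgType R)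
    (Q : self_adjoint A -> self_adjoint B)
    (Q' : self_adjoint B -> self_adjoint A) :
  cancel Q Q' -> cancel (jordan_extension Q) (jordan_extension Q').
Proof.
move=> QQ' x.
have mapK y : sa y -> jordan_map Q' (jordan_map Q y) = y.
  move=> /eqP sy; have -> : y = val (exist _ y sy : self_adjoint A) by [].
  by rewrite !jordan_map_val QQ'.
have [rE iE] : repart (jordan_extension Q x) = jordan_map Q (repart x) /\
    impart (jordan_extension Q x) = jordan_map Q (impart x).
  apply: (parts_unique _ _ erefl); apply: sa_jordan_map;
    [exact: sa_repart|exact: sa_impart].
rewrite {1}/jordan_extension rE iE !mapK; [|exact: sa_impart|exact: sa_repart].
by rewrite -repart_impart.
Qed.

(* An element [y] of the closure of the image still commutes with it, so the inverse is
   defined, linear and contractive on a context containing the image and [y]. *)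
Lemma jordan_image_context (R : realType) (A B : cstarAlgType R)
    (Q : self_adjoint A -> self_adjoint B)
    (Q' : self_adjoint B -> self_adjoint A) (C : context A) :
  cancel Q Q' -> cancel Q' Q -> quasi_jordan_hom Q -> quasi_jordan_hom Q' ->
  exists D : context B, context_set D = jordan_extension Q @` context_set C.
Proof.
move=> QQ' Q'Q jQ jQ'; set F := jordan_extension Q; pose G := jordan_extension Q'.
have GF : cancel F G by exact: jordan_extension_cancel.
have FG : cancel G F by exact: jordan_extension_cancel.
have hF : star_hom_on C F by exact: jordan_extension_hom.
pose S := F @` context_set C.
have S1 : S 1 by exists 1; [exact: context1|exact: hom_on1 hF].
have SL (a : R[i]) x y : S x -> S y -> S (a *: x + y).
  move=> [u Cu <-] [v Cv <-]; exists (a *: u + v); first exact: contextL.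
  exact: hom_onL hF _ _ _ Cu Cv.
have SM x y : S x -> S y -> S (x * y).
  move=> [u Cu <-] [v Cv <-]; exists (u * v); first exact: contextM.
  exact: hom_onM hF _ _ Cu Cv.
have Ss x : S x -> S (star x).
  move=> [u Cu <-]; exists (star u); first exact: context_star.
  exact: hom_on_star hF _ Cu.
have Sc x y : S x -> S y -> x * y = y * x.
  by move=> [u Cu <-] [v Cv <-]; rewrite -!(hom_onM hF) // (context_comm Cu Cv).
have [E SE] := commuting_context Ss Sc.
have hG : star_hom_on E G by exact: jordan_extension_hom.
have Scl : closed (S : set (normed_space B)).
  apply/closed_nrmP => y cly; exists (G y); last exact: FG.
  have Ey : context_set E y.
    have /closed_nrmP := @context_closed _ _ E; apply => e /cly[z Sz yz].
    by exists z => //; exact: SE.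
  have /closed_nrmP := @context_closed _ _ C; apply => e /cly[_ [x Cx <-] yx].
  exists x => //; have EFx : context_set E (F x) by apply: SE; exists x.
  rewrite -{1}(GF x) -(hom_onB hG) //; apply: le_lt_trans yx.
  by apply: star_hom_contractive hG _; exact: contextB.
by exists (Context S1 SL SM Ss Sc Scl).
Qed.

Section JordanIso.
Variables (R : realType) (A B : cstarAlgType R).

Lemma jordan_iso_implements (Q : self_adjoint A -> self_adjoint B) :
  quasi_jordan_iso Q ->
  exists g : order_iso (context A) (context B), forall C, implements g C (jordan_extension Q).
Proof.
move=> [Q' [QQ' Q'Q jQ jQ']].
have GF : cancel (jordan_extension Q) (jordan_extension Q') by exact: jordan_extension_cancel.
have [f fE] := choice (fun C => jordan_image_context C QQ' Q'Q jQ jQ').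
have f_mono : {mono f : C C' / (C <= C')%O}.
  move=> C C'; apply/context_leP/context_leP => le_C x.
    move=> Cx; have := le_C (jordan_extension Q x); rewrite !fE.
    case; first by exists x.
    by move=> y C'y /(can_inj GF) <-.
  by rewrite !fE => -[y Cy <-]; exists y => //; exact: le_C.
have f_inj : injective f.
  by move=> C C' E1; apply/eqP; rewrite eq_le -!f_mono E1 lexx.
have f_surj D : exists C, f C = D.
  have [C CE] := jordan_image_context D Q'Q QQ' jQ' jQ.
  have FG : cancel (jordan_extension Q') (jordan_extension Q) by exact: jordan_extension_cancel.
  exists C; apply: context_eq; rewrite fE CE; apply/seteqP; split=> [_ [_ [y Dy <-] <-]|y Dy].
    by rewrite FG.
  by exists (jordan_extension Q' y); [exists y|exact: FG].
exists (OrderIso (injective_surjective_bijective f_inj f_surj) f_mono) => C; split.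
- exact: jordan_extension_hom.
- by move=> x y _ _; exact: (can_inj GF).
- by move=> C' _; rewrite /= fE.
Qed.

Lemma context_of_normal (x : partial_alg A) : exists C : context A, context_set C (val x).
Proof. exact/normal_context/eqP/(valP x). Qed.

Lemma partial_of_sa (x : partial_alg A) : exists (u v : self_adjoint A)
  (uv : GRing.comm (val u) (val v)), x = normal_of_sa uv /\
  (val u = repart (val x) /\ val v = impart (val x)).
Proof.
have [C Cx] := context_of_normal x.
have /eqP su := sa_repart (val x); have /eqP sv := sa_impart (val x).
pose u : self_adjoint A := exist _ (repart (val x)) su.
pose v : self_adjoint A := exist _ (impart (val x)) sv.
have uv : GRing.comm (val u) (val v).
  by apply: (@context_comm _ _ C); [exact: context_repart|exact: context_impart].
by exists u, v, uv; split=> //; apply: val_inj; exact: repart_impart.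
Qed.

Definition represents (F : A -> B) (T : partial_alg A -> partial_alg B) : Prop :=
  forall x, val (T x) = F (val x).

Lemma quasi_jordan_star_iso_implements (T : partial_alg A -> partial_alg B) :
  quasi_jordan_star_iso T -> exists (g : order_iso (context A) (context B)) F,
    (forall C, implements g C F) /\ represents F T.
Proof.
move=> [Q /jordan_iso_implements[g gF] TQ]; exists g, (jordan_extension Q); split=> // x.
have [u [v [uv [-> [uE vE]]]]] := partial_of_sa x.
rewrite TQ /jordan_extension; have [-> ->] :=
  @parts_unique _ _ (val (normal_of_sa uv)) (val u) (val v)
  (eqP (valP u)) (eqP (valP v)) erefl.
by rewrite !jordan_map_val.
Qed.

Variable g : order_iso (context A) (context B).

(** Injectivity across contexts: the common value lies in [g C] and [g C'], so it is attained on a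
    context below both C and C', and local injectivity identifies x and x' with that preimage. *)
Lemma implements_inj (F : A -> B) : (forall C, implements g C F) ->
  forall C C' x x', context_set C x -> context_set C' x' -> F x = F x' -> x = x'.
Proof.
move=> iF C C' x x' Cx C'x' Fxx'; have [h [gh hg]] := order_iso_inverse g.
pose D := context_meet (g C) (g C').
have le1 : (h D <= C)%O by rewrite -(oiso_mono g) hg context_meet_lel.
have le2 : (h D <= C')%O by rewrite -(oiso_mono g) hg context_meet_ler.
have [y hDy Fy] : (F @` context_set (h D)) (F x).
  rewrite (impl_image (iF (h D)) (lexx _)) hg.
  by split; [exact: impl_mem (iF C) Cx|rewrite Fxx'; exact: impl_mem (iF C') C'x'].
have Cy : context_set C y by move: y hDy {Fy}; apply/context_leP.
have C'y : context_set C' y by move: y hDy {Fy Cy}; apply/context_leP.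
rewrite -(impl_inj (iF C) Cy Cx Fy).
by apply: (impl_inj (iF C') C'y C'x'); rewrite Fy.
Qed.

Lemma implements_inverse (F : A -> B) (h : order_iso (context B) (context A)) :
  cancel g h -> cancel h g -> (forall C, implements g C F) ->
  exists G : B -> A, (forall D, implements h D G) /\
    forall C x, context_set C x -> G (F x) = x.
Proof.
move=> gh hg iF; pose G y := xget 0 [set x | (exists C : context A, context_set C x) /\ F x = y].
have GF C x : context_set C x -> G (F x) = x.
  move=> Cx; rewrite /G; case: xgetP => [z _ [[C' C'z] Fz]|/(_ x)].
    exact: (implements_inj iF C'z Cx).
  by move=> H; exfalso; apply: H; split=> //; exists C.
exists G; split=> // D; have [G1 [iG1 G1F]] := impl_inverse gh hg (iF (h D)).
rewrite hg in iG1; apply: (impl_ext _ iG1) => y Dy.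
have [x hDx <-] : (F @` context_set (h D)) y by rewrite (impl_image (iF _) (lexx _)) hg.
by rewrite G1F // (GF _ _ hDx).
Qed.

End JordanIso.

Section ToJordan.
Variables (R : realType).

Lemma implements_sa (A B : cstarAlgType R) (g : order_iso (context A) (context B)) F :
  (forall C, implements g C F) -> exists Q : self_adjoint A -> self_adjoint B,
    quasi_jordan_hom Q /\ forall u, val (Q u) = F (val u).
Proof.
move=> iF.
have ctx (u : self_adjoint A) : exists C : context A, context_set C (val u).
  by apply: normal_context; rewrite (eqP (valP u)).
have saF (u : self_adjoint A) : star (F (val u)) == F (val u).
  have [C Cu] := ctx u.
  by rewrite -(hom_on_star (impl_hom (iF C))) // (eqP (valP u)).
pose Q u : self_adjoint B := exist _ (F (val u)) (saF u).
have [C0 _] := ctx (sa_one A).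
have Q1 : Q (sa_one A) = sa_one B by apply: val_inj; exact: hom_on1 (impl_hom (iF C0)).
exists Q; split=> //; split=> // C; have hF := impl_hom (iF C); split=> //.
- by move=> x y Cx Cy; apply: val_inj; exact: hom_onD hF Cx Cy.
- by move=> a x Cx; apply: val_inj; exact: hom_onZ _ hF Cx.
- move=> x y Cx Cy; apply: val_inj => /=.
  have Cxy := contextM Cx Cy; have Cyx := contextM Cy Cx.
  by rewrite (hom_onZ _ hF) ?(hom_onD hF) ?(hom_onM hF) //; exact: contextD.
Qed.

Lemma implements_jordan (A B : cstarAlgType R) (g : order_iso (context A) (context B)) F :
  (forall C, implements g C F) ->
  exists T : partial_alg A -> partial_alg B, quasi_jordan_star_iso T /\ represents F T.
Proof.
move=> iF; have [h [gh hg]] := order_iso_inverse g.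
have [G [iG GF]] := implements_inverse gh hg iF.
have FG D y : context_set D y -> F (G y) = y.
  move=> Dy; have [x hDx <-] : (F @` context_set (h D)) y.
    by rewrite (impl_image (iF _) (lexx _)) hg.
  by rewrite (GF _ _ hDx).
have [Q [jQ QF]] := implements_sa iF; have [Q' [jQ' Q'G]] := implements_sa iG.
have ctx (V : cstarAlgType R) (u : self_adjoint V) : exists C : context V, context_set C (val u).
  by apply: normal_context; rewrite (eqP (valP u)).
have QQ' : cancel Q Q'.
  by move=> u; apply: val_inj; rewrite Q'G QF; have [C Cu] := ctx _ u; rewrite (GF _ _ Cu).
have Q'Q : cancel Q' Q.
  by move=> u; apply: val_inj; rewrite QF Q'G; have [D Du] := ctx _ u; rewrite (FG _ _ Du).
have nF (x : partial_alg A) : star (F (val x)) * F (val x) == F (val x) * star (F (val x)).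
  have [C Cx] := context_of_normal x; have hF := impl_hom (iF C).
  rewrite -(hom_on_star hF) // -!(hom_onM hF) //; try exact: context_star.
  by rewrite (eqP (valP x)).
pose T x : partial_alg B := exist _ (F (val x)) (nF x).
exists T; split=> //; exists Q; first by exists Q'.
move=> x y xy; have [C Cz] := context_of_normal (normal_of_sa xy).
have [rE iE] := @parts_unique _ _ (val (normal_of_sa xy)) (val x) (val y)
  (eqP (valP x)) (eqP (valP y)) erefl.
have Cx := context_repart Cz; have Cy := context_impart Cz; rewrite rE in Cx; rewrite iE in Cy.
have hF := impl_hom (iF C); rewrite !QF /=.
by rewrite (hom_onD hF) ?(hom_onZ _ hF) //; exact: contextZ.
Qed.

End ToJordan.

(** * Isomorphisms of Bohrifications and of spectral presheaves *)

Section BohrSpectral.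
Variables (R : realType) (A B : cstarAlgType R).
Implicit Types (g : order_iso (context A) (context B)) (F : A -> B).

Definition bohr_represents F (b : bohr_iso A B) : Prop :=
  forall C (x : context_alg C), val (cpsh_kappa b C x : context_alg _) = F (val x).

(** y is tied to F by an equation because [F (val x)] need not be known to lie in the target
    context. *)
Definition spectral_represents F (s : spectral_iso A B) : Prop :=
  forall C (l : spectrum (context_alg (psh_base s C))) (x : context_alg C) y,
    val y = F (val x) -> ev (psh_iota s C l : spectrum (context_alg C)) x = ev l y.

(** Naturality along the inclusions of [C] meet [C'] makes the components depend only on the
    underlying element, so they glue to one function. *)
Lemma bohr_iso_implements (b : bohr_iso A B) :
  exists F, (forall C, implements (cpsh_base b) C F) /\ bohr_represents F b.
Proof.
pose k C (x : context_alg C) : context_alg (cpsh_base b C) := cpsh_kappa b C x.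
have k_incl C C' (le_C : (C <= C')%O) (x : context_alg C) (x' : context_alg C') :
    val x = val x' -> val (k C x) = val (k C' x').
  move=> xx'; have -> : x' = context_incl le_C x by exact: val_inj.
  have := cnat_natural (cpsh_kappa b) le_C x.
  by rewrite /k => /= ->.
have kE C C' (x : context_alg C) (x' : context_alg C') :
    val x = val x' -> val (k C x) = val (k C' x').
  move=> xx'; pose D := context_meet C C'.
  have Dx : context_set D (val x).
    by split; [|rewrite xx']; exact: context_algP.
  pose y : context_alg D := exist _ (val x) (mem_set Dx).
  rewrite -(k_incl D C (context_meet_lel _ _) y x) //.
  exact: (k_incl D C' (context_meet_ler _ _) y x').
pose F x := xget 0 [set y | exists C (u : context_alg C), val u = x /\ y = val (k C u)].
have FE C (x : context_alg C) : val (k C x) = F (val x).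
  rewrite /F; case: xgetP => [y _ [C' [u [ux ->]]]|/(_ (val (k C x)))]; first exact: kE.
  by move=> H; exfalso; apply: H; exists C, x.
exists F; split=> // C.
have up x (Cx : context_set C x) : exists u : context_alg C, x = val u.
  by exists (exist _ x (mem_set Cx)).
have [[U kU Uk] [kl [k1 kM] ks]] := cnat_iso (cpsh_kappa b) C.
split.
- split.
  + by rewrite -[1]/(val (1 : context_alg C)) -FE /k k1.
  + by move=> a _ _ /up[u ->] /up[v ->]; rewrite -[_ + _]/(val (a *: u + v)) -!FE /k kl.
  + by move=> _ _ /up[u ->] /up[v ->]; rewrite -[_ * _]/(val (u * v)) -!FE /k kM.
  + by move=> _ /up[u ->]; rewrite -[star _]/(val (star u)) -!FE /k ks.
- by move=> _ _ /up[u ->] /up[v ->]; rewrite -!FE => /val_inj/(can_inj kU) ->.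
- move=> C' le_C; apply/seteqP; split=> [_ [x C'x <-]|y gy].
    by rewrite -[x]/(val (exist _ x (mem_set C'x) : context_alg C')) -FE; exact: context_algP.
  have [[V kV Vk] _] := cnat_iso (cpsh_kappa b) C'.
  pose v : context_alg (cpsh_base b C') := exist _ y (mem_set gy).
  exists (val (V v)); first exact: context_algP.
  by rewrite -FE /k Vk.
Qed.

Lemma implements_bohr_iso g F : (forall C, implements g C F) ->
  exists b : bohr_iso A B, cpsh_base b = g /\ bohr_represents F b.
Proof.
move=> iF.
have gF C (x : context_alg C) : context_set (g C) (F (val x)).
  by apply: (impl_mem (iF C)); exact: context_algP.
pose k C (x : context_alg C) : context_alg (g C) := exist _ (F (val x)) (mem_set (gF C x)).
have k_iso C : star_isomorphism (k C).
  have [T [isoT _ TF]] := iso_of_impl (iF C).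
  by have -> : k C = T by apply/funext => x; apply: val_inj; rewrite TF.
have k_nat C C' (le_C : (C <= C')%O) x :
    k C' (context_incl le_C x) = context_incl (oiso_homo g le_C) (k C x).
  exact: val_inj.
pose kappa := @CopresheafNatIso R _ _ (bohrification A) (co_inverse_image g (bohrification B))
  k k_iso k_nat.
by exists (@CopresheafIso R _ _ _ _ (bohrification A) (bohrification B) g kappa).
Qed.

(* [l |-> ev (f l) x] is continuous, hence the Gelfand transform of an element [T x]. *)
Lemma homeomorphism_star_iso (D E : comCstarAlgType R) (f : spectrum E -> spectrum D) :
  homeomorphism f -> exists T : D -> E, star_isomorphism T /\
    forall l x, ev l (T x) = ev (f l) x.
Proof.
move=> [h [fh hf fc hc]].
have dual (D' E' : comCstarAlgType R) (k : spectrum E' -> spectrum D') : continuous k ->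
    forall x, sa x -> near_continuous (fun l => rv (k l) x).
  by move=> kc x sx l e e0; exact: kc (rv_near_continuous sx (k l) e0).
have [T TE] := dual_map_exists (dual _ _ _ fc).
have [U UE] := dual_map_exists (dual _ _ _ hc).
have [_ _ T_iso] := dual_map_star_isomorphism hf fh TE UE.
by exists T.
Qed.

Lemma ev_spectrum_res (V : cstarAlgType R) (C C' : context V) (le_C : (C' <= C)%O)
    (l : spectrum (context_alg C)) x :
  ev (spectrum_res le_C l) x = ev l (context_incl le_C x).
Proof. by []. Qed.

(** Dualizing each component gives *-isomorphisms in the opposite direction, whose naturality is
    tested on characters; the Bohrification case then applies. *)
Lemma spectral_iso_implements (s : spectral_iso A B) :
  exists F, (forall C, implements (psh_base s) C F) /\ spectral_represents F s.
Proof.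
case: s => g iota.
pose k_ex C := @homeomorphism_star_iso (context_alg C) (context_alg (g C)) _
  (pnat_homeo iota C).
pose k C := sval (cid (k_ex C)).
have k_iso C : star_isomorphism (k C) := (svalP (cid (k_ex C))).1.
have kE C l x : ev l (k C x) = ev (iota C l : spectrum (context_alg C)) x.
  exact: (svalP (cid (k_ex C))).2.
have k_nat C C' (le_C : (C <= C')%O) x :
    k C' (context_incl le_C x) = context_incl (oiso_homo g le_C) (k C x).
  apply: ev_inj => l; rewrite kE -ev_spectrum_res -ev_spectrum_res kE; congr (ev _ x).
  exact/esym/(pnat_natural iota le_C l).
pose kappa := @CopresheafNatIso R _ _ (bohrification A) (co_inverse_image g (bohrification B))
  k k_iso k_nat.
have [F [iF bF]] := bohr_iso_implements
  (@CopresheafIso R _ _ _ _ (bohrification A) (bohrification B) g kappa).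
exists F; split=> // C l x y yE /=; rewrite -kE; congr (ev l _); apply: val_inj.
by rewrite yE; exact: (bF C x).
Qed.

Lemma pullback_continuous (D E : comCstarAlgType R) (T : D -> E) (Tm : star_morphism T) :
  continuous (pullback Tm).
Proof.
apply: continuous_to_spectrum => x l.
rewrite /ev; exact: (@spectrum_eval_continuous R E (T x) l).
Qed.

Lemma implements_spectral_iso g F : (forall C, implements g C F) ->
  exists s : spectral_iso A B, psh_base s = g /\ spectral_represents F s.
Proof.
move=> /implements_bohr_iso[[g' kappa] /= [gg' bF]]; subst g'.
pose k C : context_alg C -> context_alg (g C) := kappa C.
have k_iso C : star_isomorphism (k C) := cnat_iso kappa C.
pose iota C := pullback (k_iso C).2.
have iotaE C l x : ev (iota C l) x = ev l (k C x) by [].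
have i_homeo C : homeomorphism (iota C).
  have [[U kU Uk] km] := k_iso C; have [_ Um] := star_isomorphism_inverse km kU Uk.
  exists (pullback Um); split; [| |exact: pullback_continuous|exact: pullback_continuous].
    by move=> l; apply: spectrum_ev_eq => x; rewrite !ev_pullback Uk.
  by move=> l; apply: spectrum_ev_eq => x; rewrite !ev_pullback kU.
have i_nat C C' (h : (C' <= C)%O) l :
    iota C' (spectrum_res (oiso_homo g h) l) = spectrum_res h (iota C l).
  apply: spectrum_ev_eq => x; rewrite iotaE !ev_spectrum_res iotaE; congr (ev l _).
  exact/esym/(cnat_natural kappa h x).
pose nat := @PresheafNatIso _ _ (inverse_image g (spectral_presheaf B)) (spectral_presheaf A)
  iota i_homeo i_nat.
exists (@PresheafIso _ _ _ _ (spectral_presheaf B) (spectral_presheaf A) g nat).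
split=> // C l x y yE; rewrite -[LHS]/(ev l (k C x)); congr (ev l _); apply: val_inj.
by rewrite yE; exact: (bF C x).
Qed.

Lemma order_iso_ext d d' (P : porderType d) (Q : porderType d') (g h : order_iso P Q) :
  g =1 h -> g = h.
Proof.
case: g h => [f fb fm] [f' fb' fm'] /= ff'; have E1 : f = f' by exact/funext.
by subst f'; congr OrderIso; exact: Prop_irrelevance.
Qed.

Lemma bohr_iso_ext F (b b' : bohr_iso A B) : cpsh_base b = cpsh_base b' ->
  bohr_represents F b -> bohr_represents F b' -> b = b'.
Proof.
case: b b' => [g [k ki kn]] [g' [k' ki' kn']] /= gg' bF bF'; subst g'.
have kk' : k = k'.
  apply: functional_extensionality_dep => C; apply/funext => x; apply: val_inj.
  exact: etrans (bF C x) (esym (bF' C x)).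
subst k'; congr CopresheafIso; congr CopresheafNatIso; exact: Prop_irrelevance.
Qed.

(** [spectral_represents] constrains a component at x only if [F (val x)] lies in the target
    context; [implements] guarantees this. *)
Lemma spectral_iso_ext g F (s s' : spectral_iso A B) : psh_base s = g -> psh_base s' = g ->
  (forall C, implements g C F) ->
  spectral_represents F s -> spectral_represents F s' -> s = s'.
Proof.
case: s s' => [g1 [k ki kn]] [g2 [k' ki' kn']] /= gg1 gg2 iF sF sF'; subst g1 g2.
have kk' : k = k'.
  apply: functional_extensionality_dep => C; apply/funext => l.
  apply: spectrum_ev_eq => x.
  have gFx : context_set (g C) (F (val x)).
    by apply: (impl_mem (iF C)); exact: context_algP.
  pose y : context_alg (g C) := exist _ (F (val x)) (mem_set gFx).
  by rewrite (sF C l x y erefl) (sF' C l x y erefl).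
subst k'; congr PresheafIso; congr PresheafNatIso; exact: Prop_irrelevance.
Qed.

End BohrSpectral.

(** * Translation between represented maps and the correspondences *)

Section Correspondences.
Variables (R : realType) (A B : cstarAlgType R).
Implicit Types (g : order_iso (context A) (context B)) (F : A -> B).
Implicit Types (T : partial_alg A -> partial_alg B).

Lemma context_image_represents F T C : represents F T ->
  context_image T C = F @` context_set C.
Proof.
move=> TF; apply/seteqP; split=> [_ [x Cx <-]|_ [x Cx <-]].
  by exists (val x) => //; rewrite TF.
pose u : context_alg C := exist _ x (mem_set Cx).
by exists (partial_of_context u) => //; rewrite TF.
Qed.

Lemma base_corresponds_implements g F T : (forall C, implements g C F) -> represents F T ->
  base_corresponds g T.
Proof.
by move=> iF TF C; rewrite (context_image_represents _ TF) (impl_image (iF C) (lexx _)).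
Qed.

Lemma base_corresponds_unique g g' T : base_corresponds g T -> base_corresponds g' T -> g = g'.
Proof.
by move=> gT g'T; apply: order_iso_ext => C; apply: context_eq; rewrite -gT -g'T.
Qed.

Lemma bohr_correspondsP F T (b : bohr_iso A B) : represents F T ->
  base_corresponds (cpsh_base b) T -> (bohr_represents F b <-> bohr_corresponds b T).
Proof.
move=> TF bT; split=> [bF|[Tb bTE] C x]; last by rewrite bTE /= TF.
by exists bT => C x; apply: val_inj; rewrite bF /= TF.
Qed.

Lemma spectral_correspondsP F T (s : spectral_iso A B) : represents F T ->
  base_corresponds (psh_base s) T -> (spectral_represents F s <-> spectral_corresponds s T).
Proof.
move=> TF sT; split=> [sF|[Ts sTE] C l x y yE].
  exists sT => C l x; have := sF C l x (context_restrict (sT C) x); rewrite /ev; apply.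
  by rewrite /= TF.
rewrite /ev sTE; congr (_ _); apply: val_inj; by rewrite yE /= TF.
Qed.

Lemma represents_ext F F' T T' : represents F T -> represents F' T' ->
  (forall (C : context A) x, context_set C x -> F x = F' x) -> T = T'.
Proof.
move=> TF T'F' FF'; apply/funext => x; apply: val_inj; rewrite TF T'F'.
by have [C Cx] := context_of_normal x; exact: FF' Cx.
Qed.

End Correspondences.

Theorem theorem5p27 (R : realType) (A B : cstarAlgType R)
  (hAC2 : ~ star_isomorphic A (C2 R)) (hAM2 : ~ star_isomorphic A (B_C2 R))
  (hBC2 : ~ star_isomorphic B (C2 R)) (hBM2 : ~ star_isomorphic B (B_C2 R)) :
  (* spectral presheaves *)
  (forall s : spectral_iso A B,
     exists! T, quasi_jordan_star_iso T /\ spectral_corresponds s T) /\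
  (forall T : partial_alg A -> partial_alg B, quasi_jordan_star_iso T ->
     exists! s : spectral_iso A B, spectral_corresponds s T) /\
  (* Bohrifications *)
  (forall T : partial_alg A -> partial_alg B, quasi_jordan_star_iso T ->
     exists! b : bohr_iso A B, bohr_corresponds b T) /\
  (forall b : bohr_iso A B,
     exists! T, quasi_jordan_star_iso T /\ bohr_corresponds b T) /\
  (* context categories *)
  (forall T : partial_alg A -> partial_alg B, quasi_jordan_star_iso T ->
     exists! g : order_iso (context A) (context B), base_corresponds g T) /\
  (forall g : order_iso (context A) (context B),
     exists! T, quasi_jordan_star_iso T /\ base_corresponds g T) /\
  (forall g : order_iso (context A) (context B),
     exists! b : bohr_iso A B, cpsh_base b = g) /\
  (* compatibility of the base maps *)
  (forall (T : partial_alg A -> partial_alg B) (s : spectral_iso A B)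
     (b : bohr_iso A B) (g : order_iso (context A) (context B)),
     quasi_jordan_star_iso T -> spectral_corresponds s T ->
     bohr_corresponds b T -> base_corresponds g T ->
     g = psh_base s /\ g = cpsh_base b).
Proof.
(* The spectral and Bohr correspondences both contain the one of base maps, so recovering T from its
   base map settles all three uniqueness claims about T. *)
have T_unique (g : order_iso (context A) (context B)) T T' :
    quasi_jordan_star_iso T -> base_corresponds g T ->
    quasi_jordan_star_iso T' -> base_corresponds g T' -> T = T'.
  move=> /quasi_jordan_star_iso_implements[h [F [iF TF]]] gT.
  move=> /quasi_jordan_star_iso_implements[h' [F' [iF' TF']]] gT'.
  have hg := base_corresponds_unique (base_corresponds_implements iF TF) gT.
  have h'g := base_corresponds_unique (base_corresponds_implements iF' TF') gT'.
  subst h h'; apply: represents_ext TF TF' _ => C x.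
  exact: implements_unique iF iF' C x.
split.
  move=> s; have [F [iF sF]] := spectral_iso_implements s.
  have [T [jT TF]] := implements_jordan iF; exists T.
  have sT := base_corresponds_implements iF TF.
  split=> [|T' [jT' [sT' _]]]; last exact: T_unique jT sT jT' sT'.
  by split=> //; apply/(spectral_correspondsP TF sT).
split.
  move=> T /quasi_jordan_star_iso_implements[g [F [iF TF]]].
  have gT := base_corresponds_implements iF TF.
  have [s [sg sF]] := implements_spectral_iso iF; exists s.
  have sT : base_corresponds (psh_base s) T by rewrite sg.
  split=> [|s' s'T]; first by apply/(spectral_correspondsP TF sT).
  have [s'b _] := s'T; have s'g := base_corresponds_unique s'b gT.
  by apply: (spectral_iso_ext sg s'g iF sF); apply/(spectral_correspondsP TF s'b).
split.
  move=> T /quasi_jordan_star_iso_implements[g [F [iF TF]]].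
  have gT := base_corresponds_implements iF TF.
  have [b [bg bF]] := implements_bohr_iso iF; exists b.
  have bT : base_corresponds (cpsh_base b) T by rewrite bg.
  split=> [|b' b'T]; first by apply/(bohr_correspondsP TF bT).
  have [b'b _] := b'T; have b'g := base_corresponds_unique b'b gT.
  apply: bohr_iso_ext bF _; first by rewrite bg b'g.
  by apply/(bohr_correspondsP TF b'b).
split.
  move=> b; have [F [iF bF]] := bohr_iso_implements b.
  have [T [jT TF]] := implements_jordan iF; exists T.
  have bT := base_corresponds_implements iF TF.
  split=> [|T' [jT' [bT' _]]]; last exact: T_unique jT bT jT' bT'.
  by split=> //; apply/(bohr_correspondsP TF bT).
split.
  move=> T /quasi_jordan_star_iso_implements[g [F [iF TF]]].
  have gT := base_corresponds_implements iF TF.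
  by exists g; split=> // g'; exact: base_corresponds_unique.
split.
  move=> g; have [F iF] := order_iso_implemented g hAC2 hAM2.
  have [T [jT TF]] := implements_jordan iF.
  have gT := base_corresponds_implements iF TF.
  by exists T; split=> [|T' [jT' gT']]; [split|exact: T_unique jT gT jT' gT'].
split.
  move=> g; have [F iF] := order_iso_implemented g hAC2 hAM2.
  have [b [bg bF]] := implements_bohr_iso iF; exists b; split=> // b' b'g.
  (* Any competitor over g has its own representing function, which also implements g and hence
     agrees with F on every context. *)
  have [F' [iF' b'F']] := bohr_iso_implements b'; rewrite b'g in iF'.
  apply: bohr_iso_ext bF _; first by rewrite bg b'g.
  move=> C x; rewrite b'F'.
  exact: (implements_unique hAC2 hAM2 iF' iF (context_algP x)).
move=> T s b g _ [sT _] [bT _] gT.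
by split; [exact: base_corresponds_unique gT sT|exact: base_corresponds_unique gT bT].
Qed.
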